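(* (a) For all $u\in C_c^\infty(\mathbb{R}^n,\mathbb{R}^n)$, $$\operatorname{div}^s_\delta\operatorname{cof}D^s_\delta u=\operatorname{div}\operatorname{cof}D^s_\delta u=\operatorname{div}^s_\delta\operatorname{cof}Du=0.$$ (b) For all $u\in H^{s,p,\delta}(\Omega,\mathbb{R}^n)$ with $1\le p<\infty$ and $p\ge n-1$, and all $\varphi\in C_c^\infty(\Omega_{-\delta})$, $$\int_\Omega\operatorname{cof}D^s_\delta u\,D^s_\delta\varphi\,dx=0,$$ while for all $\varphi\in C_c^\infty(\Omega)$, $$\int_\Omega\operatorname{cof}D^s_\delta u\,D\varphi\,dx=0.$$
   Context: Setting. $n\in\mathbb{N}$, $0<s<1$, $\delta>0$, $\Omega\subset\mathbb{R}^n$ is a non-empty bounded open set, $B(x,r)$ is the open ball, $\Omega_\delta=\Omega+B(0,\delta)$, $\Omega_{-\delta}=\{x\in\Omega:\operatorname{dist}(x,\partial\Omega)>\delta\}$, and $\delta$ is small enough that $\Omega_{-\delta}\neq\emptyset$. Cut-off. $w_\delta:\mathbb{R}^n\to[0,\infty)$ is a fixed radial function in $C_c^\infty(B(0,\delta))$ such that $w_\delta(x_1)\ge w_\delta(x_2)$ if $|x_1|\le|x_2|$, and for some constants $a_0>0$, $0<b_0<1$ one has $0\le w_\delta\le a_0$ and $w_\delta=a_0$ on $B(0,b_0\delta)$. Constants. $\gamma(\sigma)=\pi^{n/2}2^{\sigma}\Gamma(\sigma/2)/\Gamma((n-\sigma)/2)$ and $c_{n,s}=\frac{n-1+s}{\gamma(1-s)}$.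 Nonlocal gradient. For $u\in C_c^\infty(\mathbb{R}^n)$, $$D^s_\delta u(x)=c_{n,s}\int_{B(x,\delta)}\frac{u(x)-u(y)}{|x-y|}\frac{x-y}{|x-y|}\frac{w_\delta(x-y)}{|x-y|^{n-1+s}}\,dy,\qquad x\in\mathbb{R}^n,$$ and for $u\in C^\infty_c(\mathbb{R}^n,\mathbb{R}^n)$ the matrix $D^s_\delta u$ is given by the same formula with $(u(x)-u(y))\otimes(x-y)$ (its rows are the nonlocal gradients of the components). If $u\in L^1(\Omega_\delta)$ is the $L^1(\Omega_\delta)$-limit of functions $u_j\in C_c^\infty(\mathbb{R}^n)$ such that $D^s_\delta u_j\to U$ in $L^1(\Omega,\mathbb{R}^n)$, then $D^s_\delta u:=U$ (independent of the sequence). Nonlocal divergence. For a $C^1$ vector field $\phi:\mathbb{R}^n\to\mathbb{R}^n$, $$\operatorname{div}^s_\delta\phi(x)=c_{n,s}\int_{B(x,\delta)}\frac{\phi(x)-\phi(y)}{|x-y|}\cdot\frac{x-y}{|x-y|}\frac{w_\delta(x-y)}{|x-y|^{n-1+s}}\,dy,\qquad x\in\mathbb{R}^n .$$ The divergence (classical or nonlocal) of a matrix field is the vector whose components are the divergences of the rows. Spaces. For $1\le p<\infty$, $H^{s,p,\delta}(\Omega)$ is the closure of $C_c^\infty(\mathbb{R}^n)$ under the norm $(\|u\|_{L^p(\Omega_\delta)}^p+\|D^s_\delta u\|_{L^p(\Omega)}^p)^{1/p}$; its elements are functions defined a.e. in $\Omega_\delta$, with nonlocal gradient defined a.e. in $\Omega$.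 $H^{s,p,\delta}(\Omega,\mathbb{R}^n)$ is defined componentwise. $\operatorname{cof}A$ is the cofactor matrix, satisfying $\operatorname{cof}A\,A^T=(\det A)I$ (equal to $1$ if $n=1$). In (b), $\operatorname{cof}D^s_\delta u\,D^s_\delta\varphi$ and $\operatorname{cof}D^s_\delta u\,D\varphi$ are matrix-vector products. *)

(* Defs.v *)
From HB Require Import structures.
From mathcomp Require Import all_boot all_order all_algebra.
From mathcomp Require Import all_classical all_reals all_analysis.

Set Implicit Arguments.
Unset Strict Implicit.
Unset Printing Implicit Defensive.

Import Order.TTheory GRing.Theory Num.Theory.
Import numFieldNormedType.Exports.

Local Open Scope classical_set_scope.
Local Open Scope ring_scope.

(* The sigma-algebra of 'rV[R]_n is generated by the coordinates; it is the
   Borel sigma-algebra of R^n. *)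
Section measurable_rV.
Context {R : realType}.
Variable n : nat.

Definition rV_coor (i : 'I_n) (x : 'rV[R]_n) : R := x ord0 i.

Let rV_set0 : g_sigma_preimage rV_coor set0.
Proof. exact: sigma_algebra0. Qed.

Let rV_setC A : g_sigma_preimage rV_coor A -> g_sigma_preimage rV_coor (~` A).
Proof. exact: sigma_algebraC. Qed.

Let rV_bigcup (F : _^nat) : (forall i, g_sigma_preimage rV_coor (F i)) ->
  g_sigma_preimage rV_coor (\bigcup_i (F i)).
Proof. exact: sigma_algebra_bigcup. Qed.

HB.instance Definition _ := @isMeasurable.Build default_measure_display
  'rV[R]_n (g_sigma_preimage rV_coor) rV_set0 rV_setC rV_bigcup.

Lemma measurable_coor (i : 'I_n) :
  measurable_fun [set: 'rV[R]_n] (fun x => x ord0 i).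
Proof.
move=> _ Y mY; rewrite setTI; apply: sub_sigma_algebra => /=.
rewrite -bigcup_seq/=; exists i => /=; first by rewrite mem_index_enum.
by exists Y => //; rewrite setTI.
Qed.

Lemma measurable_fun_rV d (T : measurableType d) (f : T -> 'rV[R]_n) :
  (forall i, measurable_fun [set: T] (fun t => f t ord0 i)) ->
  measurable_fun [set: T] f.
Proof.
move=> mf _ A mA; rewrite setTI.
suff : g_sigma_preimage rV_coor `<=` [set B | measurable (f @^-1` B)] by exact.
apply: smallest_sub.
  split => /= [|B mB|F mF]; rewrite ?preimage_set0 //.
    by rewrite setTD preimage_setC; exact: measurableC.
  by rewrite preimage_bigcup; exact: bigcupT_measurable.
rewrite -bigcup_seq => B [i _ [C mC <-]] /=.
by rewrite setTI -comp_preimage -[X in measurable X]setTI; exact: mf.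
Qed.

End measurable_rV.

Section lebesgue_rV.
Context {R : realType}.

Definition rV_cons n (p : measurableTypeR R * 'rV[R]_n) : 'rV[R]_n.+1 :=
  \row_i oapp (fun j => p.2 ord0 j) p.1 (unlift ord0 i).

Definition rV_uncons n (x : 'rV[R]_n.+1) : measurableTypeR R * 'rV[R]_n :=
  (x ord0 ord0, \row_j x ord0 (lift ord0 j)).

Lemma rV_consK n : cancel (@rV_cons n) (@rV_uncons n).
Proof.
move=> [a x]; rewrite /rV_uncons /rV_cons mxE unlift_none; congr pair.
by apply/rowP => j; rewrite !mxE liftK.
Qed.

Lemma measurable_rV_cons n : measurable_fun [set: measurableTypeR R * 'rV[R]_n] (@rV_cons n).
Proof.
apply: measurable_fun_rV => i; rewrite /rV_cons.
under eq_fun do rewrite mxE.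
case: unliftP => [j _|_] /=; last exact: measurable_fst.
by apply: (measurableT_comp (measurable_coor j)); exact: measurable_snd.
Qed.

Lemma measurable_rV_uncons n :
  measurable_fun [set: 'rV[R]_n.+1] (@rV_uncons n).
Proof.
apply/measurable_fun_pairP; split; first exact: measurable_coor.
apply: measurable_fun_rV => j /=.
by under eq_fun do rewrite mxE; exact: measurable_coor.
Qed.

(* n-fold product of the one-dimensional Lebesgue measure *)
Fixpoint lebesgue_rV_fun n : set 'rV[R]_n -> \bar R :=
  match n with
  | 0 => dirac (0 : 'rV[R]_0)
  | n'.+1 => pushforward (lebesgue_measure \x @lebesgue_rV_fun n')%E (@rV_cons n')
  end.

Lemma sigma_finite_measureP d (T : measurableType d) (m : set T -> \bar R) :
  m set0 = 0%E -> (forall A, 0 <= m A)%E -> semi_sigma_additive m ->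
  sigma_finite setT m ->
  exists mu : {sigma_finite_measure set T -> \bar R}, m = mu.
Proof.
move=> m0 m_ge0 m_sigma m_fin.
pose mM := isMeasure.Build _ _ _ m m0 m_ge0 m_sigma.
pose m1 := HB.pack_for {measure set T -> \bar R} m mM.
pose m2 := HB.pack_for {sigma_finite_measure set T -> \bar R} m mM
  (Measure_isSigmaFinite.Build _ _ _ m1 m_fin).
by exists m2.
Qed.

Lemma lebesgue_rV_fun_ex n :
  exists mu : {sigma_finite_measure set 'rV[R]_n -> \bar R},
    @lebesgue_rV_fun n = mu.
Proof.
elim: n => [|n [mu /= ->]].
  by exists (dirac (0 : 'rV[R]_0)).
pose leb : {sigma_finite_measure set (measurableTypeR R) -> \bar R} :=
  lebesgue_measure.
pose nu : {measure set _ -> \bar R} := (leb \x mu)%E.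
have nu_fin : sigma_finite setT nu.
  have /sigma_finiteP[F [TF ndF Foo]] := sigma_finiteT leb.
  have /sigma_finiteP[G [TG ndG Goo]] := sigma_finiteT mu.
  exists (fun k => F k `*` G k).
    rewrite -setXTT TF TG predeqE => -[x y]; split.
      move=> [/= [k _ Fkx] [l _ Gly]]; exists (maxn k l) => //; split.
      - by move: x Fkx; exact/subsetPset/ndF/leq_maxl.
      - by move: y Gly; exact/subsetPset/ndG/leq_maxr.
    by move=> [k _ []/= ? ?]; split; exists k.
  move=> k; have [mFk Fk] := Foo k; have [mGk Gk] := Goo k.
  split; first exact: measurableX.
  by rewrite /nu /= product_measure1E// lte_mul_pinfty// ge0_fin_numE.
pose m := pushforward nu (@rV_cons n).
have m0 : m set0 = 0%E by rewrite /m /pushforward preimage_set0 measure0.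
have m_ge0 A : (0 <= m A)%E by exact: (measure_ge0 nu).
have m_sigma : semi_sigma_additive m.
  move=> F mF tF mUF; rewrite /m /pushforward preimage_bigcup.
  have mcons A : measurable A -> measurable (@rV_cons n @^-1` A).
    by move=> mA; rewrite -[X in measurable X]setTI; exact: measurable_rV_cons.
  apply: measure_semi_sigma_additive.
  - by move=> k; exact: mcons.
  - apply/trivIsetP => /= i j _ _ ij; rewrite -preimage_setI.
    by move/trivIsetP : tF => /(_ _ _ _ _ ij) ->//; rewrite preimage_set0.
  - by rewrite -preimage_bigcup; exact: mcons.
have m_fin : sigma_finite setT m.
  have [F UF mF] := nu_fin.
  exists (fun k => @rV_uncons n @^-1` (F k)).
    by rewrite -preimage_bigcup -UF preimage_setT.
  move=> k; have [mFk Fk] := mF k; split.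
    by rewrite -[X in measurable X]setTI; exact: measurable_rV_uncons.
  rewrite /m /pushforward -comp_preimage.
  by rewrite (_ : _ \o _ = id) ?preimage_id//; apply/funext => p; exact: rV_consK.
exact: sigma_finite_measureP.
Qed.

Section lebesgue_rV_measure.
Local Open Scope ereal_scope.
Variable n : nat.

Definition lebesgue_rV : set 'rV[R]_n -> \bar R := @lebesgue_rV_fun n.

Let lebesgue_rV0 : lebesgue_rV set0 = 0.
Proof.
by rewrite /lebesgue_rV; have [mu ->] := lebesgue_rV_fun_ex n; exact: measure0.
Qed.

Let lebesgue_rV_ge0 A : 0 <= lebesgue_rV A.
Proof.
by rewrite /lebesgue_rV; have [mu ->] := lebesgue_rV_fun_ex n; exact: measure_ge0.
Qed.

Let lebesgue_rV_sigma_additive : semi_sigma_additive lebesgue_rV.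
Proof.
rewrite /lebesgue_rV; have [mu ->] := lebesgue_rV_fun_ex n.
exact: measure_semi_sigma_additive.
Qed.

HB.instance Definition _ := isMeasure.Build _ _ _ lebesgue_rV
  lebesgue_rV0 lebesgue_rV_ge0 lebesgue_rV_sigma_additive.

Let lebesgue_rV_sigma_finite : sigma_finite setT lebesgue_rV.
Proof.
by rewrite /lebesgue_rV; have [mu ->] := lebesgue_rV_fun_ex n; exact: sigma_finiteT.
Qed.

HB.instance Definition _ := Measure_isSigmaFinite.Build _ _ _ lebesgue_rV
  lebesgue_rV_sigma_finite.

End lebesgue_rV_measure.

Lemma lebesgue_rV_box n (A : 'I_n -> set (measurableTypeR R)) :
  (forall i, measurable (A i)) ->
  lebesgue_rV [set x : 'rV[R]_n | forall i, A i (x ord0 i)] =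
  (\prod_(i < n) lebesgue_measure (A i))%E.
Proof.
elim: n A => [|n IHn] A mA.
  rewrite big_ord0 /lebesgue_rV /= diracE mem_set//.
  by move=> [].
rewrite big_ord_recl /= -IHn//.
rewrite /lebesgue_rV /= -/(lebesgue_rV _) /pushforward.
have -> : @rV_cons n @^-1` [set x : 'rV[R]_n.+1 | forall i, A i (x ord0 i)] =
    A ord0 `*` [set x : 'rV[R]_n | forall i, A (lift ord0 i) (x ord0 i)].
  apply/seteqP; split => [[a x] /= Aax|[a x] /= [Aa Ax] i]; last first.
    rewrite /rV_cons mxE; case: unliftP => [j ->|->] /=; [exact: Ax|exact: Aa].
  split=> [|j].
    by have := Aax ord0; rewrite /rV_cons mxE unlift_none.
  by have := Aax (lift ord0 j); rewrite /rV_cons mxE liftK.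
rewrite -[LHS]/((lebesgue_measure \x @lebesgue_rV n)%E _) product_measure1E//.
have -> : [set x : 'rV[R]_n | forall i, A (lift ord0 i) (x ord0 i)] =
    \bigcap_(i in [set: 'I_n]) (fun x : 'rV[R]_n => x ord0 i) @^-1` A (lift ord0 i).
  by apply/seteqP; split => [x Ax i _|x Ax i]; [exact: Ax|exact: (Ax i I)].
apply: fin_bigcap_measurable => // i _.
by rewrite -[X in measurable X]setTI; exact: (measurable_coor i measurableT (mA _)).
Qed.

End lebesgue_rV.

Section nonlocal.
Context {R : realType} {n : nat}.
Implicit Types (u w : 'rV[R]_n -> R) (D Omega : set 'rV[R]_n).
Implicit Types (x y : 'rV[R]_n) (s delta p : R).

Local Notation leb := (lebesgue_rV (n := n)).

(* The norm of 'rV[R]_n in the library is the sup norm; enorm is the Euclidean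
   one and eball its open balls. *)
Definition enorm x : R := Num.sqrt (\sum_(i < n) x ord0 i ^+ 2).

Definition eball x (r : R) : set 'rV[R]_n := [set y | enorm (y - x) < r].

Definition enlarge Omega delta : set 'rV[R]_n :=
  [set x + y | x in Omega & y in eball 0 delta].

Definition boundary Omega : set 'rV[R]_n := closure Omega `\` interior Omega.

Definition dist_set x D : R := inf [set enorm (x - y) | y in D].

Definition shrink Omega delta : set 'rV[R]_n :=
  [set x | Omega x /\ delta < dist_set x (boundary Omega)].

Definition partial (i : 'I_n) u x : R := 'D_(delta_mx ord0 i) u x.

Definition grad u x : 'rV[R]_n := \row_i partial i u x.

Fixpoint Ck (k : nat) u : Prop :=
  continuous u /\
  match k with
  | 0 => True
  | k'.+1 => forall i, (forall x, derivable u x (delta_mx ord0 i)) /\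
                       Ck k' (partial i u)
  end.

Definition Cinfty u : Prop := forall k, Ck k u.

Definition supp u : set 'rV[R]_n := closure [set x | u x != 0].

Definition Cc_infty D u : Prop :=
  [/\ Cinfty u, compact (supp u) & supp u `<=` D].

Definition cutoff delta w : Prop :=
  [/\ Cc_infty (eball 0 delta) w,
      forall x y, enorm x = enorm y -> w x = w y,
      forall x y, enorm x <= enorm y -> w y <= w x &
      exists a0 b0 : R,
        [/\ 0 < a0, 0 < b0 < 1, forall x, 0 <= w x <= a0 &
            forall x, eball 0 (b0 * delta) x -> w x = a0]].

Definition Gamma (z : R) : R :=
  \int[lebesgue_measure]_(t in `]0, +oo[) (t `^ (z - 1) * expR (- t)).

Definition riesz_gamma (sigma : R) : R :=
  pi `^ (n%:R / 2) * 2 `^ sigma * Gamma (sigma / 2)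
  / Gamma ((n%:R - sigma) / 2).

Definition c_ns s : R := (n%:R - 1 + s) / riesz_gamma (1 - s).

Definition nlgrad s delta w u x : 'rV[R]_n :=
  \row_j (c_ns s * \int[leb]_(y in eball x delta)
    ((u x - u y) / enorm (x - y) * ((x - y) ord0 j / enorm (x - y))
     * (w (x - y) / enorm (x - y) `^ (n%:R - 1 + s)))).

Definition nldiv s delta w (phi : 'rV[R]_n -> 'rV[R]_n) x : R :=
  c_ns s * \int[leb]_(y in eball x delta)
    ((\sum_(j < n) (phi x - phi y) ord0 j / enorm (x - y)
                   * ((x - y) ord0 j / enorm (x - y)))
     * (w (x - y) / enorm (x - y) `^ (n%:R - 1 + s))).

Definition divergence (phi : 'rV[R]_n -> 'rV[R]_n) x : R :=
  \sum_(j < n) partial j (fun y => phi y ord0 j) x.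

(* The rows of the (nonlocal) gradient of a vector field are the gradients of its
   components, and the divergence of a matrix field is taken row by row; so
   grad_mx is the transpose of the library's jacobian. *)
Definition component (u : 'rV[R]_n -> 'rV[R]_n) (i : 'I_n) : 'rV[R]_n -> R :=
  fun x => u x ord0 i.

Definition grad_mx (u : 'rV[R]_n -> 'rV[R]_n) x : 'M[R]_n :=
  \matrix_i grad (component u i) x.

Definition nlgrad_mx s delta w (u : 'rV[R]_n -> 'rV[R]_n) x : 'M[R]_n :=
  \matrix_i nlgrad s delta w (component u i) x.

Definition divergence_mx (F : 'rV[R]_n -> 'M[R]_n) x : 'cV[R]_n :=
  \col_i divergence (fun y => row i (F y)) x.

Definition nldiv_mx s delta w (F : 'rV[R]_n -> 'M[R]_n) x : 'cV[R]_n :=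
  \col_i nldiv s delta w (fun y => row i (F y)) x.

Definition cof (A : 'M[R]_n) : 'M[R]_n := \matrix_(i, j) cofactor A i j.

Definition Lpnorm p D u : \bar R :=
  'N[leb]_p%:E[(EFin \o u) \_ D]%E.

Definition Lpnorm_rV p D (U : 'rV[R]_n -> 'rV[R]_n) : \bar R :=
  Lpnorm p D (fun x => enorm (U x)).

(* U is the nonlocal gradient on Omega of the L^1(Omega_delta) function u. The
   values of u off Omega_delta and of U off Omega are irrelevant. *)
Definition is_nlgrad s delta w Omega u (U : 'rV[R]_n -> 'rV[R]_n) : Prop :=
  [/\ leb.-integrable (enlarge Omega delta) (EFin \o u),
      forall j, leb.-integrable Omega (fun x => (U x ord0 j)%:E) &
      exists u_ : nat -> 'rV[R]_n -> R,
        [/\ forall k, Cc_infty setT (u_ k),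
            Lpnorm 1 (enlarge Omega delta) (u_ k \- u) @[k --> \oo] --> 0%E &
            Lpnorm_rV 1 Omega (nlgrad s delta w (u_ k) \- U)
              @[k --> \oo] --> 0%E]].

Definition Hnorm p delta Omega u (U : 'rV[R]_n -> 'rV[R]_n) : \bar R :=
  ((Lpnorm p (enlarge Omega delta) u `^ p + Lpnorm_rV p Omega U `^ p)
    `^ p^-1)%E.

(* u belongs to H^{s,p,delta}(Omega) and U is its nonlocal gradient: the pair
   (u, U) is the limit of pairs (u_k, nlgrad u_k) in the norm of the space. *)
Definition Hspace s p delta w Omega u (U : 'rV[R]_n -> 'rV[R]_n) : Prop :=
  is_nlgrad s delta w Omega u U /\
  exists u_ : nat -> 'rV[R]_n -> R,
    (forall k, Cc_infty setT (u_ k)) /\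
    Hnorm p delta Omega (u_ k \- u) (nlgrad s delta w (u_ k) \- U)
      @[k --> \oo] --> 0%E.

End nonlocal.

(* Main.v *)
(* The vector kernel z w(z) / |z|^(n+1+s) is, up to a regularisation
   |z|^2 + eps of the singularity, the gradient of a compactly supported radial
   function, so its integral against a C^1 divergence-free field v with v(0) = 0
   vanishes. Applied to v(z) = psi(x) - psi(x - z), this shows that
   divergence-free fields have zero nonlocal divergence; applied to
   v = f e_j - g e_i with D_j f = D_i g, it shows that the nonlocal gradient of
   a smooth function is curl-free. Piola's identity is pure algebra for
   curl-free rows, so it holds for cof D^s u and cof D u alike, which gives (a).
   By Fubini the same vanishing gives a duality between divergence-free fields
   and nonlocal gradients, hence (b) for smooth u. The passage to the limit uses
   |cof A - cof B| <= C d (1 + |B| + d)^(p-1) with d = |A - B|, and that D^s phi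
   vanishes off Omega because Omega contains the delta-neighbourhood of
   Omega_{-delta}. *)
Require Import Defs.
From HB Require Import structures.
From mathcomp Require Import all_boot all_order all_algebra.
From mathcomp Require Import all_classical all_reals all_analysis.
From mathcomp Require Import perm measurable_realfun ring lra.

Set Implicit Arguments.
Unset Strict Implicit.
Unset Printing Implicit Defensive.

Import Order.TTheory GRing.Theory Num.Theory.
Import numFieldNormedType.Exports.

Local Open Scope classical_set_scope.
Local Open Scope ring_scope.

(** * Lebesgue measure on R^n *)

Section measure_rV.
Context {R : realType}.

(** The vector kernel has size |z|^(-n-s) and is not integrable, but against a factor of order |z|
    it is dominated by |z|^2 times the scalar kernel, that is by |z|^(1-n-s), integrable because s <
    1. This is why v has to vanish at the origin and to be C^1, and one majorant serves the limit
    eps -> 0, Fubini, and the differentiation in x. The regularisation sits inside the power of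
    |z|^2 because |z|^2 is a polynomial: the radial function becomes a one-variable integral
    composed with it, differentiable at the origin too. In the duality the divergence-free field is
    merely C^1, without decay, so each integral is localised by the test function, and the
    difference moves from one to the other by a translation. The limit needs no Hoelder inequality:
    d M^(p-1) is split into eps M^p + eps^(1-p) d^p, which covers p = 1 as well. Both halves of (b)
    are instances of one statement on test fields that vanish off Omega and annihilate the
    divergence-free C^1 fields. *)

Lemma coord_le_norm n (x : 'rV[R]_n) i : `|x ord0 i| <= `|x|.
Proof.
rewrite [leRHS]mx_normrE.
exact: (le_bigmax_cond _ (fun p : 'I_1 * 'I_n => `|x p.1 p.2|) (j := (ord0, i))).
Qed.

Lemma norm_le_coord n (x : 'rV[R]_n) M : 0 <= M ->
  (forall i, `|x ord0 i| <= M) -> `|x| <= M.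
Proof.
move=> M0 xM; rewrite [leLHS]mx_normrE; apply: bigmax_le => //= -[i j] _ /=.
by rewrite (ord1 i).
Qed.

Lemma measurable_box n (A : 'I_n -> set R) :
  (forall i, measurable (A i)) ->
  measurable [set x : 'rV[R]_n | forall i, A i (x ord0 i)].
Proof.
move=> mA.
have -> : [set x : 'rV[R]_n | forall i, A i (x ord0 i)] =
    \bigcap_(i in [set: 'I_n]) (fun x : 'rV[R]_n => x ord0 i) @^-1` A i.
  by apply/seteqP; split => [x Ax i _|x Ax i]; [exact: Ax|exact: (Ax i I)].
apply: fin_bigcap_measurable => // i _.
by rewrite -[X in measurable X]setTI; exact: (measurable_coor i measurableT (mA _)).
Qed.

(** The sigma-algebra is generated by the coordinates, so an open set has to be rebuilt from
    countably many boxes: those with rational corners that it contains. The other boxes are replaced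
    by [set0] to keep a countable type as index set. *)
Lemma open_measurable_rV n (U : set 'rV[R]_n) : open U -> measurable U.
Proof.
move=> oU.
pose box (q : 'rV[rat]_n * 'rV[rat]_n) := [set x : 'rV[R]_n |
  forall i, `](ratr (q.1 ord0 i)), (ratr (q.2 ord0 i))[%classic (x ord0 i)].
have -> : U = \bigcup_(q in [set: 'rV[rat]_n * 'rV[rat]_n])
    (if `[< box q `<=` U >] then box q else set0).
  apply/seteqP; split => [x Ux|x [q _]]; last by case: asboolP => // bU /bU.
  have [P xP PU] : nbhs x U by exact: open_nbhs_nbhs.
  have /choice[f fP] : forall i : 'I_n, exists q : rat * rat,
      `]ratr q.1, (ratr q.2 : R)[%classic (x ord0 i) /\
      `]ratr q.1, (ratr q.2 : R)[%classic `<=` P ord0 i.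
    move=> i; have /nbhs_ballP[e /= e0 eP] := xP ord0 i.
    have /rat_in_itvoo[a] : x ord0 i - e < x ord0 i by rewrite gtrBl.
    have /rat_in_itvoo[b] : x ord0 i < x ord0 i + e by rewrite ltrDl.
    rewrite !in_itv/= => /andP[xb bx] /andP[xa ax]; exists (a, b); split => /=.
      by rewrite in_itv/= ax xb.
    move=> y; rewrite /= in_itv/= => /andP[ay yb]; apply: eP.
    by rewrite /ball/= ltr_distlC; apply/andP; split; [exact: lt_trans ay|exact: lt_trans bx].
  exists (\row_i (f i).1, \row_i (f i).2) => //.
  case: asboolP => [_ /= i|[]].
    by rewrite !mxE; exact: (fP i).1.
  move=> y yb; apply: PU => i j; rewrite (ord1 i); apply: (fP j).2.
  by have := yb j; rewrite /= !mxE.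
apply: countable_bigcupT_measurable => [|q]; first exact: countableP.
case: ifP => // _.
by apply: (@measurable_box n (fun i => `]ratr (q.1 ord0 i), ratr (q.2 ord0 i)[%classic)) => i; exact: measurable_itv.
Qed.

Lemma continuous_measurable_rV n (f : 'rV[R]_n -> R) :
  continuous f -> measurable_fun setT f.
Proof.
move=> /continuousP cf; apply: (measurability _ (RGenOpens.measurableE R)).
move=> /= _ [_ [a [b ->]]] <-; rewrite setTI; apply: open_measurable_rV.
by apply: cf; exact: itv_open.
Qed.

Local Open Scope ereal_scope.

Let leb1 : {sigma_finite_measure set (measurableTypeR R) -> \bar R} :=
  lebesgue_measure.

Lemma integral_rV0 (f : 'rV[R]_0 -> \bar R) :
  \int[lebesgue_rV (n := 0)]_x f x = f 0%R.
Proof.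
rewrite (eq_measure_integral (dirac (0%R : 'rV[R]_0))); last by [].
have mf : measurable_fun [set: 'rV[R]_0] f.
  move=> _ A mA; rewrite setTI.
  have [fA|fA] := pselect (A (f 0%R)).
    rewrite (_ : _ @^-1` _ = setT)//; apply/seteqP; split => // x _ /=.
    by rewrite (thinmx0 x).
  rewrite (_ : _ @^-1` _ = set0)//; apply/seteqP; split => // x /=.
  by rewrite (thinmx0 x).
by rewrite integral_dirac// diracT mul1e.
Qed.


Lemma measurable_rV_add n : measurable_fun [set: 'rV[R]_n * 'rV[R]_n]
  (fun p : 'rV[R]_n * 'rV[R]_n => (p.1 + p.2)%R).
Proof.
apply: measurable_fun_rV => i; under eq_fun do rewrite mxE.
by apply: measurable_funD; apply: (measurableT_comp (measurable_coor i));
  [exact: measurable_fst|exact: measurable_snd].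
Qed.

Lemma measurable_rV_opp n : measurable_fun [set: 'rV[R]_n] (fun x : 'rV[R]_n => (- x)%R).
Proof.
apply: measurable_fun_rV => i; under eq_fun do rewrite mxE.
exact: (measurableT_comp (@oppr_measurable R setT) (measurable_coor i)).
Qed.

Lemma measurable_rV_addl n (x : 'rV[R]_n) :
  measurable_fun [set: 'rV[R]_n] (fun z : 'rV[R]_n => (x + z)%R).
Proof.
apply: measurable_fun_rV => i; under eq_fun do rewrite mxE.
by apply: measurable_funD => //; exact: measurable_coor.
Qed.

Lemma measurable_rV_subl n (x : 'rV[R]_n) :
  measurable_fun [set: 'rV[R]_n] (fun z : 'rV[R]_n => (x - z)%R).
Proof. exact: (measurableT_comp (measurable_rV_addl x) (@measurable_rV_opp n)). Qed.

HB.instance Definition _ n := isMeasurableFun.Build _ _ _ _ (@rV_cons R n)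
  (@measurable_rV_cons R n).

(** The two measures agree as functions by definition but carry different structures; change of
    variables and Fubini apply to the right-hand one. *)
Lemma integral_rV_pushforward n (f : 'rV[R]_n.+1 -> \bar R) :
  \int[lebesgue_rV (n := n.+1)]_x f x =
  \int[pushforward (leb1 \x lebesgue_rV (n := n)) (@rV_cons R n)]_x f x.
Proof. exact: eq_measure_integral. Qed.

Lemma ge0_integral_rV_cons n (f : 'rV[R]_n.+1 -> \bar R) :
  measurable_fun [set: 'rV[R]_n.+1] f -> (forall x, 0 <= f x) ->
  \int[lebesgue_rV (n := n.+1)]_x f x =
  \int[(leb1 \x lebesgue_rV (n := n))]_p f (rV_cons p).
Proof.
move=> mf f0; rewrite integral_rV_pushforward.
by rewrite ge0_integral_pushforward//; exact: measurable_rV_cons.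
Qed.

Lemma ge0_integral_rV_fubini n (f : 'rV[R]_n.+1 -> \bar R) :
  measurable_fun [set: 'rV[R]_n.+1] f -> (forall x, 0 <= f x) ->
  \int[lebesgue_rV (n := n.+1)]_x f x =
  \int[leb1]_a \int[lebesgue_rV (n := n)]_x f (rV_cons (a, x)).
Proof.
move=> mf f0; rewrite ge0_integral_rV_cons//.
apply: (fubini_tonelli1 (f \o @rV_cons R n)) => [|p]; last exact: f0.
exact: (measurableT_comp mf (@measurable_rV_cons R n)).
Qed.

Lemma integrable_rV_cons n (f : 'rV[R]_n.+1 -> \bar R) :
  (lebesgue_rV (n := n.+1)).-integrable setT f ->
  (leb1 \x lebesgue_rV (n := n)).-integrable setT (f \o @rV_cons R n).
Proof.
move=> /integrableP[mf foo]; apply/integrableP; split.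
  by apply: measurableT_comp => //; exact: measurable_rV_cons.
move: foo; rewrite ge0_integral_rV_cons//.
by apply: measurableT_comp.
Qed.

Lemma integral_rV_cons n (f : 'rV[R]_n.+1 -> \bar R) :
  (lebesgue_rV (n := n.+1)).-integrable setT f ->
  \int[lebesgue_rV (n := n.+1)]_x f x =
  \int[(leb1 \x lebesgue_rV (n := n))]_p f (rV_cons p).
Proof.
move=> intf; rewrite integral_rV_pushforward integral_pushforward//.
- by have /integrableP[] := intf.
- exact: integrable_rV_cons.
Qed.

Lemma integral_rV_fubini1 n (f : 'rV[R]_n.+1 -> \bar R) :
  (lebesgue_rV (n := n.+1)).-integrable setT f ->
  \int[lebesgue_rV (n := n.+1)]_x f x =
  \int[leb1]_a \int[lebesgue_rV (n := n)]_x f (rV_cons (a, x)).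
Proof.
move=> intf; rewrite integral_rV_cons//.
rewrite -(@integral12_prod_meas1 _ _ _ _ _ leb1 (lebesgue_rV (n := n)) (f \o @rV_cons R n))//.
exact: integrable_rV_cons.
Qed.

Lemma integral_rV_fubini2 n (f : 'rV[R]_n.+1 -> \bar R) :
  (lebesgue_rV (n := n.+1)).-integrable setT f ->
  \int[lebesgue_rV (n := n.+1)]_x f x =
  \int[lebesgue_rV (n := n)]_x \int[leb1]_a f (rV_cons (a, x)).
Proof.
move=> intf; rewrite integral_rV_cons//.
rewrite -(@integral21_prod_meas1 _ _ _ _ _ leb1 (lebesgue_rV (n := n)) (f \o @rV_cons R n))//.
exact: integrable_rV_cons.
Qed.

(** Uniqueness of Lebesgue measure: the preimage of a generator []a, b]] is [[c - b, c - a[], of the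
    same length. *)
Lemma lebesgue_itv_reflect (c : R) (A : set (measurableTypeR R)) :
  measurable A -> leb1 A = leb1 ((fun a => c - a)%R @^-1` A).
Proof.
have mr : measurable_fun [set: measurableTypeR R] (fun a : measurableTypeR R => (c - a)%R : measurableTypeR R).
  by apply: continuous_measurable_fun => x; apply: cvgB; [exact: cvg_cst|exact: cvg_id].
move=> mA.
pose rf : {mfun measurableTypeR R >-> measurableTypeR R} :=
  HB.pack (fun a : measurableTypeR R => (c - a)%R : measurableTypeR R) (isMeasurableFun.Build _ _ _ _ _ mr).
rewrite -[RHS]/(pushforward leb1 rf A).
apply: lebesgue_measure_unique => // X [[a b] _ <-] /=.
rewrite /pushforward.
have -> : (fun a0 : measurableTypeR R => (c - a0)%R) @^-1` `]a, b]%classic%R = `[c - b, c - a[%classic%R.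
  apply/seteqP; split => x /=; rewrite !in_itv/= => /andP[h1 h2]; apply/andP; split; lra.
by rewrite !lebesgue_measure_itv/= !lte_fin ltrD2l ltrN2 -!EFinB; case: ifP => // _; congr EFin; ring.
Qed.

Lemma ge0_integral_reflect (c : R) (f : measurableTypeR R -> \bar R) :
  measurable_fun setT f -> (forall x, 0 <= f x) ->
  \int[leb1]_a f (c - a)%R = \int[leb1]_a f a.
Proof.
have mr : measurable_fun [set: measurableTypeR R] (fun a : measurableTypeR R => (c - a)%R : measurableTypeR R).
  by apply: continuous_measurable_fun => x; apply: cvgB; [exact: cvg_cst|exact: cvg_id].
move=> mf f0; rewrite [RHS](eq_measure_integral (pushforward leb1 (fun a : measurableTypeR R => (c - a)%R : measurableTypeR R))).
  by rewrite ge0_integral_pushforward.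
by move=> A mA _; exact: lebesgue_itv_reflect.
Qed.

(** Tonelli splits off the first coordinate, where the one-dimensional reflection applies, and
    induction treats the others. Reflection is the basic change of variables because y = x - z turns
    an integral over the ball around x into one over z. *)
Lemma ge0_integral_rV_reflect n (x : 'rV[R]_n) (f : 'rV[R]_n -> \bar R) :
  measurable_fun [set: 'rV[R]_n] f -> (forall x, 0 <= f x) ->
  \int[lebesgue_rV (n := n)]_z f (x - z)%R = \int[lebesgue_rV (n := n)]_z f z.
Proof.
elim: n x f => [|n IHn] x f mf f0.
  by rewrite !integral_rV0; congr f; rewrite (thinmx0 x) (thinmx0 (_ - _)%R).
have mc : measurable_fun setT (f \o @rV_cons R n).
  by apply: measurableT_comp => //; exact: measurable_rV_cons.
have mcx : measurable_fun [set: 'rV[R]_n.+1] (fun z => f (x - z)%R).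
  by apply: (measurableT_comp mf); exact: measurable_rV_subl.
rewrite (ge0_integral_rV_fubini mf f0).
rewrite (ge0_integral_rV_fubini mcx); last by move=> z; exact: f0.
rewrite -[RHS](ge0_integral_reflect (x ord0 ord0)); last 2 first.
- by apply: (measurable_fun_fubini_tonelli_F (f \o @rV_cons R n)) => // p; exact: f0.
- by move=> a; exact: integral_ge0.
apply: eq_integral => a _.
rewrite -[RHS](IHn (\row_j x ord0 (lift ord0 j))) //; last first.
  exact: (measurableT_comp mc (pair1_measurable _)).
apply: eq_integral => z _ /=; congr f; apply/rowP => i.
rewrite !mxE/= ; case: unliftP => [j ->|->] /=.
  by rewrite !mxE.
by [].
Qed.

Lemma integral_rV_reflect n (x : 'rV[R]_n) (f : 'rV[R]_n -> \bar R) :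
  measurable_fun [set: 'rV[R]_n] f ->
  \int[lebesgue_rV (n := n)]_z f (x - z)%R = \int[lebesgue_rV (n := n)]_z f z.
Proof.
move=> mf; rewrite [LHS]integralE [RHS]integralE; congr (_ - _).
  rewrite -(ge0_integral_rV_reflect x (f := f^\+)) => [|//|//].
    have -> // : (fun z => f (x - z)%R)^\+ = f^\+ \o (fun z => (x - z)%R) by exact: funepos_comp.
  exact: measurable_funepos.
rewrite -(ge0_integral_rV_reflect x (f := f^\-)) => [|//|//].
  have -> // : (fun z => f (x - z)%R)^\- = f^\- \o (fun z => (x - z)%R) by exact: funeneg_comp.
exact: measurable_funeneg.
Qed.

(** A translation is the composite of two reflections. *)
Lemma integral_rV_translate n (x : 'rV[R]_n) (f : 'rV[R]_n -> \bar R) :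
  measurable_fun [set: 'rV[R]_n] f ->
  \int[lebesgue_rV (n := n)]_z f (x + z)%R = \int[lebesgue_rV (n := n)]_z f z.
Proof.
move=> mf; rewrite -(integral_rV_reflect 0%R (f := fun z => f (x + z)%R)); last first.
  by apply: (measurableT_comp mf); exact: measurable_rV_addl.
under eq_integral do rewrite sub0r.
exact: integral_rV_reflect.
Qed.

Lemma lebesgue_rV_ball n (r : R) : (0 < r)%R ->
  lebesgue_rV [set x : 'rV[R]_n | (`|x| < r)%R] <= (((2 * r) ^+ n)%R)%:E.
Proof.
move=> r0.
have le1 : lebesgue_rV [set x : 'rV[R]_n | (`|x| < r)%R] <=
    lebesgue_rV [set x : 'rV[R]_n | forall i, `]-r, r[%classic%R (x ord0 i)].
  apply: le_measure; rewrite ?inE.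
  - by apply: open_measurable_rV; rewrite (_ : mkset _ = ball 0%R r); [exact: ball_open|
      rewrite mx_norm_ball; apply/seteqP; split => x /=; rewrite sub0r normrN].
  - by apply: (@measurable_box _ (fun=> `]-r, r[%classic%R)).
  - move=> x /= xr i; rewrite in_itv/= -ltr_norml; apply: le_lt_trans xr.
    exact: coord_le_norm.
apply: (le_trans le1).
rewrite (@lebesgue_rV_box _ _ (fun=> `]-r, r[%classic%R)); last by move=> i; exact: measurable_itv.
under eq_bigr do rewrite lebesgue_measure_itv/= lte_fin gtrN// -EFinD.
rewrite prodEFin lee_fin big_const iter_mulr_1 card_ord opprK.
by rewrite -mulr2n mulr_natl.
Qed.

Lemma bounded_finite_measure n (D : set 'rV[R]_n) : measurable D -> bounded_set D ->
  lebesgue_rV D < +oo.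
Proof.
move=> mD /pinfty_ex_gt0[M /= M0 DM].
apply: (@le_lt_trans _ _ (lebesgue_rV [set x : 'rV[R]_n | (`|x| < M + 1)%R])).
  apply: le_measure; rewrite ?inE//.
    by apply: open_measurable_rV; rewrite (_ : mkset _ = ball 0%R (M + 1)); [exact: ball_open|
      rewrite mx_norm_ball; apply/seteqP; split => x /=; rewrite sub0r normrN].
  by move=> x /DM /= /le_lt_trans; apply; rewrite ltrDl.
by apply: (le_lt_trans (lebesgue_rV_ball _ _)); rewrite ?ltry// addr_gt0.
Qed.

End measure_rV.

(** * Calculus of C^k functions *)

Section calculus_rV.
Context {R : realType} {n : nat}.
Implicit Types (u v : 'rV[R]_n -> R) (x y z : 'rV[R]_n) (i j : 'I_n).
Local Notation e_ := (delta_mx (ord0 : 'I_1)).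

(** The two difference quotients are the same function of h. This lemma and its converse at t = 0
    bring the one-variable mean value theorem and chain rule to directional derivatives. *)
Lemma is_derive_line u (x v : 'rV[R]_n) (t d : R) : is_derive (x + t *: v) v u d ->
  is_derive t (1 : R) (fun t : R => u (x + t *: v)) d.
Proof.
have E : (fun h : R => h^-1 *: (((fun t : R => u (x + t *: v)) \o shift t) (h *: 1) - u (x + t *: v))) =
    (fun h : R => h^-1 *: ((u \o shift (x + t *: v)) (h *: v) - u (x + t *: v))).
  apply/funext => h /=; rewrite [h *: 1]mulr1 scalerDl; congr (_ *: (u _ - _)).
  by rewrite addrCA.
case=> du dE; split; first by rewrite /derivable E.
by rewrite -dE /derive E.
Qed.

Lemma is_derive_line0 u (x v : 'rV[R]_n) (d : R) : is_derive (0 : R) (1 : R) (fun t : R => u (x + t *: v)) d ->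
  is_derive x v u d.
Proof.
have E : (fun h : R => h^-1 *: (((fun t : R => u (x + t *: v)) \o shift 0) (h *: 1) - u (x + 0 *: v))) =
    (fun h : R => h^-1 *: ((u \o shift x) (h *: v) - u x)).
  apply/funext => h /=; rewrite [h *: 1]mulr1 addr0 scale0r addr0; congr (_ *: (u _ - _)).
  by rewrite addrC.
case=> du dE; split; first by rewrite /derivable -E.
by rewrite -dE /derive E.
Qed.

Lemma MVT_line u (du : 'rV[R]_n -> R) (x v : 'rV[R]_n) (a : R) :
  (forall y, is_derive y v u (du y)) ->
  exists2 t : R, Num.min 0 a <= t <= Num.max 0 a & u (x + a *: v) - u x = a * du (x + t *: v).
Proof.
move=> uv; have d (t : R) : is_derive t (1 : R) (fun t : R => u (x + t *: v)) (du (x + t *: v)).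
  exact: is_derive_line.
have c : continuous (fun t : R => u (x + t *: v)).
  by move=> t; apply/differentiable_continuous/derivable1_diffP; have [] := d t.
have u0 : u x = u (x + 0 *: v) by rewrite scale0r addr0.
(* For a negative increment the mean value theorem is used on [a, 0]; hence min and max in the
   conclusion. *)
have [a0|a0] := leP 0 a.
  have [t ta e] := MVT_segment a0 (fun t _ => d t) (continuous_subspaceT c).
  by exists t => //; rewrite u0 e subr0 mulrC.
have [t ta e] := MVT_segment (ltW a0) (fun t _ => d t) (continuous_subspaceT c).
by exists t => //; rewrite u0 -opprB e sub0r mulrN opprK mulrC.
Qed.

Lemma C1P u : Ck 1 u <-> [/\ continuous u,
   forall i x, is_derive x (e_ i) u (partial i u x) & forall i, continuous (partial i u)].
Proof.
split=> [[cu du]|[cu du cd]].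
  split=> [//|i x|i]; first by have [d _] := du i; exact: derivableP.
  by case: (du i) => _ [].
split; first exact: cu.
move=> i; split=> [x|]; first by have [] := du i x.
by split; first exact: cd.
Qed.

(** [partial] is total and says nothing without derivability. Giving the candidate [du] proves
    regularity and computes the derivative at once; the closure lemmas below return the same
    pair. *)
Lemma C1_intro u (du : 'I_n -> 'rV[R]_n -> R) : continuous u ->
  (forall i x, is_derive x (e_ i) u (du i x)) -> (forall i, continuous (du i)) ->
  Ck 1 u /\ forall i, partial i u = du i.
Proof.
move=> cu dU cdu; have E i : partial i u = du i.
  by apply/funext => x; have [_ <-] := dU i x.
split; last exact: E.
by apply/C1P; split=> [|i x|i]; rewrite ?E.
Qed.

Lemma Ck_partial k u i : Ck k.+1 u -> Ck k (partial i u).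
Proof. by move=> /= [_ /(_ i)[]]. Qed.

Lemma CkS k u : Ck k.+1 u -> Ck k u.
Proof.
elim: k u => [|k IHk] u; first by case.
move=> [cu du]; split => // i; have [dui Cui] := du i; split => //.
exact: IHk.
Qed.

Lemma Cinfty_partial u i : Cinfty u -> Cinfty (partial i u).
Proof. by move=> Cu k; exact: Ck_partial. Qed.

Lemma supp_partial u i : supp (partial i u) `<=` supp u.
Proof.
apply: (@subset_trans _ (closure (supp u))); last by rewrite -(closure_id (supp u)).1//; exact: closed_closure.
apply: closure_subset => x /=; apply: contraNP => xu.
have nx : \forall y \near x, u y = 0.
  have : nbhs x (~` supp u).
    by apply: open_nbhs_nbhs; split => //; apply: closed_openC; exact: closed_closure.
  apply: filterS => y yu; apply/eqP; apply: contra_notT yu => uy.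
  exact: subset_closure.
apply/eqP; rewrite /partial.
rewrite (@near_eq_derive _ _ _ u (cst 0))//; first exact: derive_cst.
Qed.

Lemma supp0 u x : ~ supp u x -> u x = 0.
Proof. by move=> h; apply/eqP; apply: contra_notT h => ux; exact: subset_closure. Qed.

Lemma Cc_partial D u i : Cc_infty D u -> Cc_infty D (partial i u).
Proof.
move=> [Cu cu uD]; split; first exact: Cinfty_partial.
  by apply: subclosed_compact cu _; [exact: closed_closure|exact: supp_partial].
exact: subset_trans (@supp_partial _ _) _.
Qed.

Lemma Cc_supp_bounded D u : Cc_infty D u -> exists2 r : R, 0 < r & forall x, r < `|x| -> u x = 0.
Proof.
move=> [_ cu _]; have /pinfty_ex_gt0[r /= r0 rP] := compact_bounded cu.
exists r => // x rx; apply: supp0 => /rP /=.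
by rewrite leNgt rx.
Qed.

Lemma continuous_bounded_ball u (r : R) : continuous u ->
  exists2 M : R, 0 <= M & forall x, `|x| <= r -> `|u x| <= M.
Proof.
move=> cu.
have cB : compact [set x : 'rV[R]_n | `|x| <= r].
  apply: bounded_closed_compact.
    by exists r; split; [exact: num_real|move=> M rM x /= /le_trans; apply; exact: ltW].
  rewrite (_ : mkset _ = (fun x : 'rV[R]_n => `|x|) @^-1` [set t | t <= r])//.
  by apply: closed_comp => [x _|]; [exact: norm_continuous|exact: closed_le].
have cuB : compact (u @` [set x : 'rV[R]_n | `|x| <= r]).
  by apply: continuous_compact => //; exact: continuous_subspaceT.
have /pinfty_ex_gt0[M /= M0 MP] := compact_bounded cuB.
exists M => [|x xr]; first exact: ltW.
by apply: MP; exists x.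
Qed.

Lemma Cc_bounded D u : Cc_infty D u -> exists2 M : R, 0 <= M & forall x, `|u x| <= M.
Proof.
move=> Cu; have [r r0 rP] := Cc_supp_bounded Cu.
have [/(_ 0%N)[cu _] _ _] := Cu.
have [M M0 MP] := continuous_bounded_ball r cu.
exists M => // x; have [xr|/rP ->] := leP `|x| r; first exact: MP.
by rewrite normr0.
Qed.

(** The coordinates of x are replaced by those of y one at a time, so that only derivatives along
    the axes occur; each replacement costs M |x - y|, hence the factor n. The intermediate points
    stay in the ball because it is a cube. In the induction k bounds the indices at which x and y
    may differ. *)
Lemma bounded_partials_lipschitz u (du : 'I_n -> 'rV[R]_n -> R) (r M : R) :
  0 <= M -> (forall i x, is_derive x (e_ i) u (du i x)) ->
  (forall i x, `|x| <= r -> `|du i x| <= M) ->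
  forall x y, `|x| <= r -> `|y| <= r -> `|u x - u y| <= n%:R * M * `|x - y|.
Proof.
move=> M0 dU bdu.
suff H k x y : (k <= n)%N -> (forall i : 'I_n, (k <= i)%N -> x ord0 i = y ord0 i) ->
    `|x| <= r -> `|y| <= r -> `|u x - u y| <= k%:R * M * `|x - y|.
  by move=> x y; apply: H => // i; rewrite leqNgt ltn_ord.
elim: k x y => [|k IHk] x y kn xy xr yr.
  have -> : x = y by apply/rowP => i; exact: xy.
  by rewrite !subrr !normr0 mulr0.
pose i := Ordinal kn.
pose a := y ord0 i - x ord0 i.
have ax : `|a| <= `|x - y|.
  by apply: le_trans (coord_le_norm _ i); rewrite !mxE distrC.
pose x' := x + a *: e_ i.
have x'E (l : 'I_n) : x' ord0 l = if l == i then y ord0 l else x ord0 l.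
  rewrite !mxE eqxx/=; have [->|li] := eqVneq l i; last by rewrite mulr0 addr0.
  by rewrite mulr1 /a addrC subrK.
have r0 : 0 <= r by apply: le_trans xr.
have xtr t : Num.min 0 a <= t <= Num.max 0 a -> `|x + t *: e_ i| <= r.
  move=> ta; apply: norm_le_coord => // l; rewrite !mxE eqxx/=.
  have := le_trans (coord_le_norm x l) xr; have := le_trans (coord_le_norm y l) yr.
  have [->|li] := eqVneq l i; last by rewrite mulr0 addr0.
  rewrite mulr1 !ler_norml; move: ta; rewrite /a.
  by case: (leP 0 (y ord0 i - x ord0 i)) => ? /andP[? ?] /andP[? ?] /andP[? ?]; apply/andP; split; lra.
have x'r : `|x'| <= r.
  by apply: xtr; rewrite ge_min le_max !lexx !orbT.
have -> : u x - u y = (u x' - u y) - (u x' - u x) by ring.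
apply: (le_trans (ler_normB _ _)); rewrite -natr1 mulrDl mulrDl mul1r; apply: lerD.
  apply: (@le_trans _ _ (k%:R * M * `|x' - y|)).
    apply: IHk => //; first exact: ltnW.
    move=> l kl; rewrite x'E; have [//|li] := eqVneq l i.
    by apply: xy; rewrite ltn_neqAle kl andbT eq_sym.
  rewrite ler_wpM2l ?mulr_ge0//; apply: norm_le_coord => // l.
  have -> : (x' - y) ord0 l = x' ord0 l - y ord0 l by rewrite mxE [X in _ + X]mxE.
  have := coord_le_norm (x - y) l; rewrite mxE [X in _ + X]mxE => h.
  by rewrite x'E; case: eqVneq => // _; rewrite subrr normr0.
have [t ta ->] := MVT_line x a (dU i).
by rewrite normrM mulrC ler_pM// bdu// xtr.
Qed.

Lemma C1_lipschitz_ball u (r : R) : Ck 1 u ->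
  exists2 L : R, 0 <= L & forall x y, `|x| <= r -> `|y| <= r -> `|u x - u y| <= L * `|x - y|.
Proof.
move=> /C1P[cu du cdu].
have /choice[M MP] : forall i, exists M : R, 0 <= M /\ forall x, `|x| <= r -> `|partial i u x| <= M.
  by move=> i; have [M M0 MP] := continuous_bounded_ball r (cdu i); exists M.
have S0 : 0 <= \sum_i M i by apply: sumr_ge0 => i _; exact: (MP i).1.
exists (n%:R * \sum_i M i); first by rewrite mulr_ge0.
apply: bounded_partials_lipschitz (du) _ => // i x xr.
rewrite (bigD1 i)//=; apply: (le_trans ((MP i).2 _ xr)); rewrite lerDl.
by apply: sumr_ge0 => l _; exact: (MP l).1.
Qed.

Lemma Cc_lipschitz D u : Cc_infty D u ->
  exists2 L : R, 0 <= L & forall x y, `|u x - u y| <= L * `|x - y|.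
Proof.
move=> Cu; have [/(_ 1%N)/C1P[cu du cdu] _ _] := Cu.
have /choice[M MP] : forall i, exists M : R, 0 <= M /\ forall x, `|partial i u x| <= M.
  by move=> i; have [M M0 MP] := Cc_bounded (Cc_partial i Cu); exists M.
have S0 : 0 <= \sum_i M i by apply: sumr_ge0 => i _; exact: (MP i).1.
exists (n%:R * \sum_i M i); first by rewrite mulr_ge0.
move=> x y; apply: (@bounded_partials_lipschitz u _ (Num.max `|x| `|y|) _ _ (du)) => //;
  rewrite ?le_max ?lexx ?orbT//.
move=> i z _; rewrite (bigD1 i)//=; apply: (le_trans ((MP i).2 z)); rewrite lerDl.
by apply: sumr_ge0 => l _; exact: (MP l).1.
Qed.

Lemma dist_half_le (a b c e : R) : `|a - c| < e / 2 -> `|b - c| < e / 2 -> `|a - b| <= e.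
Proof.
by rewrite !ltr_norml ler_norml => /andP[? ?] /andP[? ?]; apply/andP; split; lra.
Qed.

(** The second difference of u over a square of side h is symmetric in the two directions and equals
    h^2 times either mixed derivative, each at some point within 2h of x; continuity at x identifies
    the two limits. *)
Lemma C2_partialC u i j : Ck 2 u -> partial i (partial j u) = partial j (partial i u).
Proof.
move=> Cu; apply/funext => x.
have /C1P[cu du cdu] := CkS Cu.
have dd k l y : is_derive y (e_ l) (partial k u) (partial l (partial k u) y).
  by have /C1P[_ + _] := Ck_partial k Cu; exact.
have cdd k l : continuous (partial l (partial k u)).
  by have /C1P[_ _] := Ck_partial k Cu; exact.
have key k l (h : R) : 0 < h -> exists2 y, `|y - x| <= 2 * h &
    u (x + h *: e_ k + h *: e_ l) - u (x + h *: e_ k) - u (x + h *: e_ l) + u x =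
    h * (h * partial l (partial k u) y).
  move=> h0.
  (* Mean value theorem in direction k for the increment of u in direction l, then in direction l
     for [partial k u]. *)
  pose g y := u (y + h *: e_ l) - u y.
  have dg y : is_derive y (e_ k) g (partial k u (y + h *: e_ l) - partial k u y).
    apply: is_deriveB; apply: is_derive_line0.
    have -> : (fun t : R => u (y + t *: e_ k + h *: e_ l)) =
        (fun t : R => u (y + h *: e_ l + t *: e_ k)).
      by apply/funext => t; rewrite addrAC.
    by apply: is_derive_line; rewrite scale0r addr0.
  have [t th gE] := MVT_line x h dg.
  have [t' th' dE] := MVT_line (x + t *: e_ k) h (dd k l).
  exists (x + t *: e_ k + t' *: e_ l); last first.
    rewrite -dE -gE /g [in RHS]addrAC; ring.
  move: th th'; rewrite (min_l (ltW h0)) (max_r (ltW h0)) => /andP[t0 th] /andP[t0' th'].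
  have -> : x + t *: e_ k + t' *: e_ l - x = t *: e_ k + t' *: e_ l.
    by apply/rowP => m; rewrite !mxE; ring.
  apply: norm_le_coord => [|m]; first by rewrite mulr_ge0// ltW.
  rewrite !mxE eqxx/= ger0_norm; last by rewrite addr_ge0// mulr_ge0.
  rewrite mulr_natl mulr2n; apply: lerD.
    by apply: le_trans th; rewrite ler_piMr// lern1 leq_b1.
  by apply: le_trans th'; rewrite ler_piMr// lern1 leq_b1.
apply/eqP; rewrite -subr_eq0 -normr_le0; apply/ler_addgt0Pr => eps eps0; rewrite add0r.
have c1 := cdd i j x; have c2 := cdd j i x.
have e20 : 0 < eps / 2 by rewrite divr_gt0.
have /nbhs_normP[d1 /= d10 H1] := c1 _ (nbhsx_ballx (partial j (partial i u) x) _ e20).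
have /nbhs_normP[d2 /= d20 H2] := c2 _ (nbhsx_ballx (partial i (partial j u) x) _ e20).
(* The divisor 4 puts the distance 2h strictly below both radii of continuity. *)
pose h := Num.min d1 d2 / 4.
have h0 : 0 < h by rewrite divr_gt0// lt_min d10 d20.
have hd : 2 * h < d1 /\ 2 * h < d2.
  by clear -d10 d20; rewrite /h; case: (leP d1 d2) => ?; split; lra.
have [y1 y1x E1] := key i j h h0; have [y2 y2x E2] := key j i h h0.
have E : partial j (partial i u) y1 = partial i (partial j u) y2.
  have hn : h != 0 by rewrite gt_eqF.
  have E0 : x + h *: e_ i + h *: e_ j = x + h *: e_ j + h *: e_ i by exact: addrAC.
  have E3 : h * (h * partial j (partial i u) y1) = h * (h * partial i (partial j u) y2).
    apply: (etrans (esym E1)); apply: (etrans _ E2); rewrite E0.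
    by congr (_ + _); exact: addrAC.
  exact: (mulfI hn (mulfI hn E3)).
have B1 := H1 y1 (le_lt_trans (etrans (congr1 (fun a => a <= 2 * h) (distrC x y1)) y1x) hd.1).
have B2 := H2 y2 (le_lt_trans (etrans (congr1 (fun a => a <= 2 * h) (distrC x y2)) y2x) hd.2).
apply: (@dist_half_le _ _ (partial i (partial j u) y2)); first exact: B2.
by rewrite -E; exact: B1.
Qed.


Lemma C1_continuous u : Ck 1 u -> continuous u.
Proof. by case/C1P. Qed.

Lemma C1_is_derive u i x : Ck 1 u -> is_derive x (e_ i) u (partial i u x).
Proof. by case/C1P => _ + _; exact. Qed.

Lemma C1_continuous_partial u i : Ck 1 u -> continuous (partial i u).
Proof. by case/C1P. Qed.

Lemma C1_cst (c : R) : Ck 1 (fun _ : 'rV[R]_n => c) /\ forall i, partial i (fun _ : 'rV[R]_n => c) = cst 0.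
Proof.
by apply: C1_intro => [|i]; exact: cst_continuous.
Qed.

Lemma C1D u v : Ck 1 u -> Ck 1 v -> Ck 1 (fun x => u x + v x) /\
  forall i, partial i (fun x => u x + v x) = fun x => partial i u x + partial i v x.
Proof.
move=> /C1P[cu du cdu] /C1P[cv dv cdv]; apply: C1_intro => [x|i x].
- exact: (cvgD (cu x) (cv x)).
- exact: (cvgD (cdu i x) (cdv i x)).
Qed.

Lemma C1N u : Ck 1 u -> Ck 1 (fun x => - u x) /\
  forall i, partial i (fun x => - u x) = fun x => - partial i u x.
Proof.
move=> /C1P[cu du cdu]; apply: C1_intro => [x|i x].
- exact: (cvgN (cu x)).
- exact: (cvgN (cdu i x)).
Qed.

Lemma C1M u v : Ck 1 u -> Ck 1 v -> Ck 1 (fun x => u x * v x) /\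
  forall i, partial i (fun x => u x * v x) = fun x => u x * partial i v x + v x * partial i u x.
Proof.
move=> /C1P[cu du cdu] /C1P[cv dv cdv]; apply: C1_intro => [x|i x].
- exact: (cvgM (cu x) (cv x)).
- exact: (cvgD (cvgM (cu x) (cdv i x)) (cvgM (cv x) (cdu i x))).
Qed.

Lemma C1_sum (I : Type) (r : seq I) (F : I -> 'rV[R]_n -> R) : (forall k, Ck 1 (F k)) ->
  Ck 1 (fun x => \sum_(k <- r) F k x) /\
  forall i, partial i (fun x => \sum_(k <- r) F k x) = fun x => \sum_(k <- r) partial i (F k) x.
Proof.
move=> CF; elim: r => [|a r [IH1 IH2]].
  have [C0 P0] := C1_cst 0.
  have -> : (fun x => \sum_(k <- [::]) F k x) = fun=> 0 by apply/funext => x; rewrite big_nil.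
  by split => // i; rewrite P0; apply/funext => x; rewrite big_nil.
have -> : (fun x => \sum_(k <- a :: r) F k x) = fun x => F a x + \sum_(k <- r) F k x.
  by apply/funext => x; rewrite big_cons.
have [CD PD] := C1D (CF a) IH1.
by split => // i; rewrite PD IH2; apply/funext => x; rewrite big_cons.
Qed.

(** [uniq r] ensures that the test [l == k] singles out exactly one factor, the differentiated
    one. *)
Lemma C1_prod (I : eqType) (r : seq I) (F : I -> 'rV[R]_n -> R) : uniq r -> (forall k, Ck 1 (F k)) ->
  Ck 1 (fun x => \prod_(k <- r) F k x) /\
  forall i, partial i (fun x => \prod_(k <- r) F k x) = fun x =>
    \sum_(k <- r) \prod_(l <- r) (if l == k then partial i (F l) x else F l x).
Proof.
move=> + CF; elim: r => [_|a r IH /= /andP[ar ur]].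
  have [C1 P1] := C1_cst 1.
  have -> : (fun x => \prod_(k <- [::]) F k x) = fun=> 1 by apply/funext => x; rewrite big_nil.
  by split => // i; rewrite P1; apply/funext => x; rewrite big_nil.
have [IH1 IH2] := IH ur.
have -> : (fun x => \prod_(k <- a :: r) F k x) = fun x => F a x * \prod_(k <- r) F k x.
  by apply/funext => x; rewrite big_cons.
have [CD PD] := C1M (CF a) IH1.
split => // i; rewrite PD IH2; apply/funext => x; rewrite big_cons big_cons eqxx addrC; congr (_ + _).
  rewrite mulrC; congr (_ * _); apply: eq_big_seq => l lr /=.
  by case: eqP lr ar => // -> ->.
rewrite mulr_sumr; apply: eq_big_seq => k kr.
rewrite big_cons; case: eqP kr ar => // -> ->.
by [].
Qed.

(** Each term of the expansion over permutations is differentiated by the product rule; exchanging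
    the two sums collects the terms by differentiated row. *)
Lemma C1_det m (F : 'rV[R]_n -> 'M[R]_m) : (forall k l, Ck 1 (fun x => F x k l)) ->
  Ck 1 (fun x => \det (F x)) /\ forall i, partial i (fun x => \det (F x)) = fun x =>
   \sum_k \det (\matrix_(a, b) if a == k then partial i (fun y => F y a b) x else F x a b).
Proof.
move=> CF.
have CP (s : 'S_m) : Ck 1 (fun x => (-1) ^+ s * \prod_k F x k (s k)) /\
   forall i, partial i (fun x => (-1) ^+ s * \prod_k F x k (s k)) =
   fun x => (-1) ^+ s * \sum_k \prod_l (if l == k then partial i (fun y => F y l (s l)) x else F x l (s l)).
  have [C1 P1] := C1_cst ((-1) ^+ s).
  have [C2 P2] := C1_prod (index_enum_uniq _) (fun k => CF k (s k)).
  have [C3 P3] := C1M C1 C2.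
  by split => // i; rewrite P3 P2 P1; apply/funext => x; rewrite mulr0 addr0.
have [C4 P4] := C1_sum (index_enum _) (fun s => (CP s).1).
split; first exact: C4.
move=> i; rewrite [LHS]P4; apply/funext => x.
rewrite /determinant exchange_big/=; apply: eq_bigr => s _.
rewrite (CP s).2 mulr_sumr; apply: eq_bigr => k _; congr (_ * _).
by apply: eq_bigr => l _; rewrite mxE.
Qed.

End calculus_rV.

(** * Piola's identity *)

Section cofactors.
Context {R : realType} {n : nat}.

(** Writing a cofactor as a full determinant with a unit vector in row i avoids the index shifts of
    minors; the derivative and the antisymmetry of determinants then apply directly. *)
Lemma cofactor_det_row (A : 'M[R]_n) i j :
  cofactor A i j = \det (\matrix_(a, b) if a == i then (b == j)%:R else A a b).
Proof.
rewrite (expand_det_row _ i) (bigD1 j)//= big1 ?addr0 => [|l lj]; last first.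
  by rewrite mxE eqxx (negbTE lj) mul0r.
rewrite mxE !eqxx mul1r /cofactor; congr (_ * \det _).
by apply/matrixP => a b; rewrite !mxE eq_sym (negbTE (neq_lift _ _)).
Qed.

Lemma det_two_rows_antisym (A : 'M[R]_n) (i k : 'I_n) (p q : 'I_n -> R) : i != k ->
  \det (\matrix_(a, b) if a == i then p b else if a == k then q b else A a b) =
  - \det (\matrix_(a, b) if a == i then q b else if a == k then p b else A a b).
Proof.
move=> ik.
set B := (X in \det X = _); set C := (X in _ = - \det X).
have -> : B = tperm_mx i k *m C.
  rewrite -xrowE; apply/matrixP => a b; rewrite !mxE.
  case: tpermP => [->|->|/eqP ai /eqP ak]; rewrite ?eqxx.
  - by rewrite eq_sym (negbTE ik).
  - by rewrite eq_sym (negbTE ik).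
  - by rewrite (negbTE ai) (negbTE ak).
by rewrite det_mulmx det_perm odd_tperm ik expr1 mulN1r.
Qed.

Lemma C1_cofactor (F : 'rV[R]_n -> 'M[R]_n) i j : (forall k l, Ck 1 (fun x => F x k l)) ->
  Ck 1 (fun x => cofactor (F x) i j).
Proof.
move=> CF; have -> : (fun x => cofactor (F x) i j) = fun x =>
   \det (\matrix_(a, b) if a == i then (b == j)%:R else F x a b).
  by apply/funext => x; rewrite cofactor_det_row.
apply: (C1_det (F := fun x => \matrix_(a, b) if a == i then (b == j)%:R else F x a b) _).1 => a b.
have -> : (fun x => (\matrix_(a, b) (if a == i then (b == j)%:R else F x a b)) a b) =
   fun x => if a == i then (b == j)%:R else F x a b.
  by apply/funext => x; rewrite mxE.
by case: (a == i); [exact: (C1_cst _).1|exact: CF].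
Qed.

(* In each term of the sum the determinant is antisymmetric in (j, l), while the
   derivatives D_j F_kl it multiplies are symmetric. *)
Lemma piola (F : 'rV[R]_n -> 'M[R]_n) i x : (forall k l, Ck 1 (fun x => F x k l)) ->
  (forall k j l, partial j (fun x => F x k l) = partial l (fun x => F x k j)) ->
  \sum_j partial j (fun x => cofactor (F x) i j) x = 0.
Proof.
move=> CF curl.
pose N k j l := \det (\matrix_(a, b) if a == i then (b == j)%:R else
   if a == k then (b == l)%:R else F x a b).
have E j : partial j (fun x => cofactor (F x) i j) x =
    \sum_(k | k != i) \sum_l partial j (fun x => F x k l) x * N k j l.
  have -> : (fun x => cofactor (F x) i j) = fun x =>
     \det (\matrix_(a, b) if a == i then (b == j)%:R else F x a b).
    by apply/funext => y; rewrite cofactor_det_row.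
  have e a b : (fun x => (\matrix_(a, b) (if a == i then (b == j)%:R else F x a b)) a b) =
     fun x => if a == i then (b == j)%:R else F x a b.
    by apply/funext => y; rewrite mxE.
  rewrite (C1_det (F := fun x => \matrix_(a, b) if a == i then (b == j)%:R else F x a b) _).2; last first.
    by move=> a b; rewrite e; case: (a == i); [exact: (C1_cst _).1|exact: CF].
  (* Row i is a constant unit vector, so differentiating it contributes zero. Every other term is
     expanded along its differentiated row k, which leaves a determinant with unit vectors in rows i
     and k. *)
  rewrite (bigD1 i)//= (expand_det_row _ i) big1 ?add0r => [|b _]; last first.
    by rewrite mxE eqxx e eqxx (C1_cst _).2 mul0r.
  apply: eq_bigr => k ki; rewrite (expand_det_row _ k); apply: eq_bigr => l _.
  rewrite mxE eqxx e (negbTE ki); congr (_ * _).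
  rewrite cofactor_det_row /N; congr (\det _); apply/matrixP => a b; rewrite !mxE.
  by have [->|ak] := eqVneq a k; rewrite ?(negbTE ki)// mxE.
rewrite (eq_bigr _ (fun j _ => E j)) exchange_big/= big1// => k ki.
have ik : i != k by rewrite eq_sym.
set S := (X in X = 0).
suff : S = - S by move=> h; lra.
rewrite {1}/S exchange_big/= /S -sumrN; apply: eq_bigr => l _; rewrite -sumrN; apply: eq_bigr => j _.
by rewrite curl /N det_two_rows_antisym// mulrN.
Qed.

End cofactors.

(** * Limits and integrals of finite sums *)

Lemma cvg_sumr (R : realType) (T : Type) (F : set_system T) {FF : Filter F} (I : Type) (r : seq I)
    (f : I -> T -> R) (l : I -> R) :
  (forall i, f i x @[x --> F] --> l i) ->
  (\sum_(i <- r) f i x) @[x --> F] --> \sum_(i <- r) l i.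
Proof.
move=> fl; elim: r => [|i r IH].
  have -> : (fun x => \sum_(i <- [::]) f i x) = (fun=> 0) by apply/funext => x; rewrite big_nil.
  by rewrite [X in _ --> X]big_nil; exact: cvg_cst.
have -> : (fun x => \sum_(j <- i :: r) f j x) = (fun x => f i x + \sum_(j <- r) f j x).
  by apply/funext => x; rewrite big_cons.
by rewrite [X in _ --> X]big_cons; exact: cvgD.
Qed.

Lemma Rintegral_sum d (T : measurableType d) (R : realType) (mu : {measure set T -> \bar R})
    (D : set T) (I : Type) (r : seq I) (f : I -> T -> R) : measurable D ->
  (forall i, mu.-integrable D (EFin \o f i)) ->
  \int[mu]_(x in D) (\sum_(i <- r) f i x) = \sum_(i <- r) \int[mu]_(x in D) f i x.
Proof.
move=> mD fi; rewrite /Rintegral; under eq_integral do rewrite -sumEFin.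
have ffin i : (\int[mu]_(x in D) (f i x)%:E)%E \is a fin_num by exact: (integrable_fin_num mD (fi i)).
rewrite integral_sum//; elim: r => [|i r IH]; first by rewrite !big_nil.
rewrite !big_cons fineD ?IH//.
by elim: (r) => [|j l IHl]; rewrite ?big_nil// big_cons fin_numD ffin.
Qed.

(** * Integration by parts *)

Section integration_rV.
Context {R : realType}.
Local Notation e_ := (delta_mx (ord0 : 'I_1)).
Let leb1 : {sigma_finite_measure set (measurableTypeR R) -> \bar R} :=
  lebesgue_measure.

Lemma continuous_rV (T : topologicalType) n (f : T -> 'rV[R]_n) :
  (forall i, continuous (fun t => f t ord0 i)) -> continuous f.
Proof.
move=> cf t A [P fP PA].
have : \forall s \near t, forall i : 'I_n, P ord0 i (f s ord0 i).
  by apply: filter_forall => i; exact: (cf i t _ (fP ord0 i)).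
by apply: filterS => s Ps; apply: PA => i j; rewrite (ord1 i).
Qed.

Lemma rV_cons_coord n (p : R * 'rV[R]_n) :
  (rV_cons p ord0 ord0 = p.1) * (forall j, rV_cons p ord0 (lift ord0 j) = p.2 ord0 j).
Proof. by split => [|j]; rewrite mxE ?unlift_none ?liftK. Qed.

Lemma rV_cons_delta0 n (a : R) (x : 'rV[R]_n) : rV_cons (a, x) = rV_cons (0, x) + a *: e_ ord0.
Proof.
apply/rowP => i; rewrite !mxE eqxx/=; case: unliftP => [j ->|->] /=; last by rewrite mulr1 add0r.
by rewrite mulr0 addr0.
Qed.

Lemma rV_cons_delta n (a t : R) (x : 'rV[R]_n) j :
  rV_cons (a, x + t *: e_ j) = rV_cons (a, x) + t *: e_ (lift ord0 j).
Proof.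
apply/rowP => i; rewrite !mxE eqxx/=; case: unliftP => [k ->|->] /=.
  by rewrite !mxE eqxx/= (inj_eq (@lift_inj _ _)).
by rewrite mulr0 addr0.
Qed.

Lemma continuous_rV_cons_l n (x : 'rV[R]_n) : continuous (fun a : R => rV_cons (a, x)).
Proof.
apply: continuous_rV => i a; case: (unliftP ord0 i) => [j ->|->].
  by under eq_fun do rewrite rV_cons_coord; exact: cst_continuous.
by under eq_fun do rewrite rV_cons_coord; exact: cvg_id.
Qed.

Lemma continuous_rV_cons_r n (a : R) : continuous (fun x : 'rV[R]_n => rV_cons (a, x)).
Proof.
apply: continuous_rV => i x; case: (unliftP ord0 i) => [j ->|->].
  by under eq_fun do rewrite rV_cons_coord; exact: coord_continuous.
by under eq_fun do rewrite rV_cons_coord; exact: cst_continuous.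
Qed.

Lemma le_norm_rV_cons n (a : R) (x : 'rV[R]_n) :
  (`|a| <= `|rV_cons (a, x)|) * (`|x| <= `|rV_cons (a, x)|).
Proof.
split; first by have := coord_le_norm (rV_cons (a, x)) ord0; rewrite rV_cons_coord.
apply: norm_le_coord => // j.
by have := coord_le_norm (rV_cons (a, x)) (lift ord0 j); rewrite rV_cons_coord.
Qed.

Lemma measurable_ball0 n (r : R) : measurable [set x : 'rV[R]_n | `|x| <= r].
Proof.
have -> : [set x : 'rV[R]_n | `|x| <= r] = ~` [set x | r < `|x|].
  by apply/seteqP; split => x /=; [move=> ?; apply/negP; rewrite -leNgt|move/negP; rewrite -leNgt].
apply: measurableC; apply: open_measurable_rV.
rewrite (_ : mkset _ = (fun x : 'rV[R]_n => `|x|) @^-1` [set t | r < t])//.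
by apply: open_comp => [x _|]; [exact: norm_continuous|exact: open_gt].
Qed.

Lemma lebesgue_ball0_lty n (r : R) : (lebesgue_rV [set x : 'rV[R]_n | (`|x| <= r)%R] < +oo)%E.
Proof.
apply: bounded_finite_measure; first exact: measurable_ball0.
by exists r; split; [exact: num_real|move=> M rM x /= /le_trans; apply; exact: ltW].
Qed.

Lemma bounded_support_integrable n (f : 'rV[R]_n -> R) (M r : R) :
  measurable_fun setT f -> (forall x, `|f x| <= M) -> (forall x, r < `|x| -> f x = 0) ->
  (lebesgue_rV (n := n)).-integrable setT (EFin \o f).
Proof.
move=> mf fM fr; pose D := [set x : 'rV[R]_n | `|x| <= r].
have -> : EFin \o f = (EFin \o f) \_ D.
  apply/funext => x; rewrite patchE; case: ifPn => // /negP xD /=.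
  by rewrite fr// ltNge; apply/negP => xr; apply: xD; rewrite inE.
apply/(integrable_mkcond _ (measurable_ball0 r)).
apply: measurable_bounded_integrable.
- exact: measurable_ball0.
- exact: lebesgue_ball0_lty.
- exact: measurable_funTS.
- by exists M; split; [exact: num_real|move=> N MN x /= _; apply: le_trans (ltW MN)].
Qed.

Lemma continuous_support_integrable n (f : 'rV[R]_n -> R) (r : R) :
  continuous f -> (forall x, r < `|x| -> f x = 0) ->
  (lebesgue_rV (n := n)).-integrable setT (EFin \o f).
Proof.
move=> cf fr; have [M M0 MP] := continuous_bounded_ball r cf.
apply: (@bounded_support_integrable _ _ M r) => //.
  exact: continuous_measurable_rV.
by move=> x; have [/MP//|/fr ->] := leP `|x| r; rewrite normr0.
Qed.

Lemma partial_support n (f df : 'rV[R]_n -> R) (v : 'rV[R]_n) (r : R) :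
  (forall x, is_derive x v f (df x)) -> (forall x, r < `|x| -> f x = 0) ->
  forall x, r < `|x| -> df x = 0.
Proof.
move=> fd fr x rx; have [_ <-] := fd x.
rewrite (@near_eq_derive _ _ _ f (cst 0)); first exact: derive_cst.
have : open [set x : 'rV[R]_n | r < `|x|].
  rewrite (_ : mkset _ = (fun x : 'rV[R]_n => `|x|) @^-1` [set t | r < t])//.
  by apply: open_comp => [y _|]; [exact: norm_continuous|exact: open_gt].
by move=> o; apply: (filterS fr); exact: open_nbhs_nbhs.
Qed.

Lemma integral_derive_compact_support (g dg : R -> R) (r : R) :
  (forall t : R, is_derive t (1 : R) g (dg t)) -> continuous dg -> (forall t, r < `|t| -> g t = 0) ->
  (\int[leb1]_t (dg t)%:E = 0)%E.
Proof.
move=> gd cdg gr.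
(* No sign is known for [r]; this bound is positive and exceeds it, so g vanishes at both ends of a
   proper interval. *)
pose a : R := `|r| + 1.
have ra : r < a by rewrite ltr_pwDr// ler_norm.
have a0 : 0 < a by rewrite ltr_pwDr.
have dg0 t : r < `|t| -> dg t = 0.
  move=> rt; have [_ <-] := gd t.
  rewrite (@near_eq_derive _ _ _ g (cst 0)); first exact: derive_cst.
  have : open [set x : R | r < `|x|].
    rewrite (_ : mkset _ = (fun x : R => `|x|) @^-1` [set t | r < t])//.
    by apply: open_comp => [y _|]; [exact: norm_continuous|exact: open_gt].
  by move=> o; apply: (filterS gr); exact: open_nbhs_nbhs.
have cg : continuous g.
  by move=> t; apply/differentiable_continuous/derivable1_diffP; have [] := gd t.
have <- : (\int[leb1]_(t in `[(- a)%R, a]%classic) (dg t)%:E = \int[leb1]_t (dg t)%:E)%E.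
  rewrite integral_mkcond; apply: eq_integral => t _; rewrite patchE.
  case: ifPn => // /negP ta; rewrite dg0//; apply: (lt_le_trans ra).
  rewrite leNgt; apply/negP => /ltW; rewrite ler_norml => h; apply: ta.
  by rewrite inE/= in_itv/=.
rewrite (@continuous_FTC2 _ dg g).
- by rewrite !gr ?subee// ?normrN gtr0_norm.
- by rewrite gtrN.
- exact: continuous_subspaceT.
- split => [t _||]; first by have [] := gd t.
    by apply: cvg_at_right_filter; exact: cg.
  by apply: cvg_at_left_filter; exact: cg.
- by move=> t _; rewrite derive1E; have [_ ->] := gd t.
Qed.

(** Fubini takes the order that suits the direction: for the first coordinate the inner integral
    runs along that line and vanishes by the fundamental theorem of calculus; for any other the
    first coordinate is frozen and induction applies. *)
Lemma integral_partial_compact_support n (f df : 'rV[R]_n -> R) (i : 'I_n) (r : R) :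
  continuous f -> (forall x, is_derive x (e_ i) f (df x)) -> continuous df ->
  (forall x, r < `|x| -> f x = 0) ->
  (\int[lebesgue_rV (n := n)]_x (df x)%:E = 0)%E.
Proof.
elim: n f df i => [|n IHn] f df i cf fd cdf fr; first by case: i fd => [].
have dfr := partial_support fd fr.
have idf := continuous_support_integrable cdf dfr.
case: (unliftP ord0 i) fd => [j ->|->] fd.
  rewrite (integral_rV_fubini1 idf); apply: integral0_eq => a _ /=.
  apply: (IHn (fun x => f (rV_cons (a, x))) _ j).
  - by move=> x; apply: continuous_comp; [exact: continuous_rV_cons_r|exact: cf].
  - move=> x; apply: is_derive_line0.
    under eq_fun do rewrite rV_cons_delta.
    by apply: is_derive_line; rewrite scale0r addr0.
  - by move=> x; apply: (@continuous_comp _ _ _ (fun x => rV_cons (a, x)) df); [exact: continuous_rV_cons_r|exact: cdf].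
  - move=> x rx; apply: fr; apply: lt_le_trans rx _.
    exact: (le_norm_rV_cons a x).2.
rewrite (integral_rV_fubini2 idf); apply: integral0_eq => x _ /=.
apply: (@integral_derive_compact_support (fun a => f (rV_cons (a, x))) _ r).
- move=> a; under eq_fun do rewrite rV_cons_delta0.
  by apply: is_derive_line; rewrite -rV_cons_delta0.
- by move=> a; apply: (@continuous_comp _ _ _ (fun a => rV_cons (a, x)) df); [exact: continuous_rV_cons_l|exact: cdf].
- move=> a ra; apply: fr; apply: lt_le_trans ra _.
  exact: (le_norm_rV_cons a x).1.
Qed.

(** Only g has bounded support: f will be a component of a field such as psi(x) - psi(x - z), which
    need not decay. *)
Lemma integration_by_parts_rV n (f g : 'rV[R]_n -> R) (i : 'I_n) (r : R) :
  Ck 1 f -> Ck 1 g -> (forall x, r < `|x| -> g x = 0) ->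
  \int[lebesgue_rV (n := n)]_x (f x * partial i g x) =
  - \int[lebesgue_rV (n := n)]_x (g x * partial i f x).
Proof.
move=> Cf Cg gr; have [Cfg pfg] := C1M Cf Cg.
have fgr x : r < `|x| -> f x * g x = 0 by move=> /gr ->; rewrite mulr0.
have dgr := partial_support (fun x => C1_is_derive i x Cg) gr.
have := integral_partial_compact_support (C1_continuous Cfg)
  (fun x => C1_is_derive i x Cfg) (C1_continuous_partial (i:=i) Cfg) fgr.
have i1 : (lebesgue_rV (n := n)).-integrable setT (EFin \o (fun x => f x * partial i g x)).
  apply: (@continuous_support_integrable _ _ r) => [x|x rx]; last by rewrite dgr// mulr0.
  exact: (cvgM (C1_continuous Cf (x:=x)) (C1_continuous_partial (i:=i) Cg (x:=x))).
have i2 : (lebesgue_rV (n := n)).-integrable setT (EFin \o (fun x => g x * partial i f x)).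
  apply: (@continuous_support_integrable _ _ r) => [x|x rx]; last by rewrite gr// mul0r.
  exact: (cvgM (C1_continuous Cg (x:=x)) (C1_continuous_partial (i:=i) Cf (x:=x))).
move=> /(congr1 fine) /=; rewrite pfg -/(Rintegral _ _ _) RintegralD// => /eqP.
by rewrite addr_eq0 => /eqP.
Qed.

End integration_rV.

(** * The Euclidean norm *)

Section enorm_theory.
Context {R : realType} {n : nat}.
Implicit Types (x y z : 'rV[R]_n).

Lemma sum_sqr_ge0 x : 0 <= \sum_(i < n) x ord0 i ^+ 2.
Proof. by apply: sumr_ge0 => i _; exact: sqr_ge0. Qed.

Lemma enorm_ge0 x : 0 <= enorm x.
Proof. exact: sqrtr_ge0. Qed.

Lemma sqr_enorm x : enorm x ^+ 2 = \sum_(i < n) x ord0 i ^+ 2.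
Proof. by rewrite sqr_sqrtr// sum_sqr_ge0. Qed.

Lemma enormZ (a : R) x : enorm (a *: x) = `|a| * enorm x.
Proof.
rewrite /enorm; under eq_bigr do rewrite mxE exprMn.
by rewrite -mulr_sumr sqrtrM ?sqr_ge0// sqrtr_sqr.
Qed.

Lemma enormN x : enorm (- x) = enorm x.
Proof. by rewrite -scaleN1r enormZ normrN1 mul1r. Qed.

Lemma coord_le_enorm x i : `|x ord0 i| <= enorm x.
Proof.
rewrite -sqrtr_sqr ler_wsqrtr// (bigD1 i)//= lerDl.
by apply: sumr_ge0 => j _; exact: sqr_ge0.
Qed.

Lemma norm_le_enorm x : `|x| <= enorm x.
Proof. by apply: norm_le_coord => [|i]; [exact: enorm_ge0|exact: coord_le_enorm]. Qed.

Lemma enorm_le_norm x : enorm x <= n%:R * `|x|.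
Proof.
rewrite -[leRHS]ger0_norm ?mulr_ge0// -sqrtr_sqr ler_wsqrtr//.
apply: (@le_trans _ _ (\sum_(i < n) `|x| ^+ 2)).
  apply: ler_sum => i _; rewrite -[x ord0 i ^+ 2]ger0_norm ?sqr_ge0// normrX.
  by rewrite ler_pXn2r ?nnegrE// coord_le_norm.
rewrite sumr_const card_ord -[leLHS]mulr_natl exprMn; apply: ler_wpM2r; first exact: sqr_ge0.
by rewrite -natrX ler_nat -mulnn; case: (n) => // m; rewrite leq_pmulr.
Qed.

Lemma enorm_eq0 x : (enorm x == 0) = (x == 0).
Proof.
apply/idP/idP => [/eqP x0|/eqP ->].
  by rewrite -normr_le0 -x0 norm_le_enorm.
have := enorm_le_norm 0; rewrite normr0 mulr0 => h.
by rewrite eq_le h enorm_ge0.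
Qed.

Lemma continuous_sqr_enorm : continuous (fun x : 'rV[R]_n => enorm x ^+ 2).
Proof.
have -> : (fun x : 'rV[R]_n => enorm x ^+ 2) = fun x => \sum_(i < n) x ord0 i * x ord0 i.
  by apply/funext => x; rewrite sqr_enorm; apply: eq_bigr => i _; rewrite expr2.
have c i : continuous (fun y : 'rV[R]_n => y ord0 i * y ord0 i).
  by move=> x; apply: continuousM; exact: coord_continuous.
move=> x; apply: (@cvg_sumr R _ (nbhs x) (nbhs_filter x) _ _ (fun i (y : 'rV[R]_n) => y ord0 i * y ord0 i)) => i.
exact: c.
Qed.

Lemma continuous_enorm : continuous (@enorm R n).
Proof.
have -> : @enorm R n = Num.sqrt \o (fun x : 'rV[R]_n => enorm x ^+ 2).
  by apply/funext => x /=; rewrite sqrtr_sqr ger0_norm// enorm_ge0.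
by move=> x; apply: continuous_comp; [exact: continuous_sqr_enorm|exact: sqrt_continuous].
Qed.

Lemma measurable_enorm : measurable_fun [set: 'rV[R]_n] (@enorm R n).
Proof. by apply: continuous_measurable_rV; exact: continuous_enorm. Qed.

(** Radial functions are differentiated through the squared norm, a polynomial, so that the origin
    is not exceptional. *)
Lemma is_derive_sqr_enorm x i :
  is_derive x (delta_mx ord0 i) (fun y : 'rV[R]_n => enorm y ^+ 2) (2 * x ord0 i).
Proof.
apply: is_derive_line0.
have -> : (fun t : R => enorm (x + t *: delta_mx ord0 i) ^+ 2) =
    (fun t : R => enorm x ^+ 2 + (2 * x ord0 i) * t + t * t).
  apply/funext => t; rewrite !sqr_enorm (bigD1 i)//= [in RHS](bigD1 i)//=.
  rewrite !mxE !eqxx mulr1.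
  have -> : \sum_(j < n | j != i) (x + t *: delta_mx ord0 i) ord0 j ^+ 2 =
     \sum_(j < n | j != i) x ord0 j ^+ 2.
    by apply: eq_bigr => j ji; rewrite !mxE (negbTE ji) andbF mulr0 addr0.
  by ring.
have d1 : is_derive (0 : R) (1 : R) (fun t : R => (2 * x ord0 i) * t) (2 * x ord0 i).
  by apply: is_derive_eq; rewrite /GRing.scale/= mulr1.
have d2 : is_derive (0 : R) (1 : R) (fun t : R => t * t) 0.
  by apply: is_derive_eq; rewrite !scale0r addr0.
apply: (is_derive_eq (is_deriveD (is_deriveD (is_derive_cst (enorm x ^+ 2) (0 : R) (1 : R)) d1) d2)).
by rewrite add0r addr0.
Qed.

End enorm_theory.

(** * Real powers *)

Section powR_facts.
Context {R : realType}.

Lemma continuous_powR_base (a p : R) : 0 < a -> {for a, continuous (fun t => t `^ p)}.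
Proof.
move=> a0; apply/differentiable_continuous/derivable1_diffP.
by apply: derivable_powR; rewrite in_itv/= a0.
Qed.

Lemma ler_powR_neg (a b p : R) : 0 < a -> a <= b -> 0 <= p -> b `^ (- p) <= a `^ (- p).
Proof.
move=> a0 ab p0; rewrite !powRN lef_pV2 ?posrE ?powR_gt0//; last exact: lt_le_trans ab.
by rewrite ge0_ler_powR// nnegrE ltW// (lt_le_trans a0).
Qed.

Lemma sqr_powR_half (a p : R) : 0 <= a -> (a ^+ 2) `^ (p / 2) = a `^ p.
Proof.
move=> a0; rewrite -powR_mulrn// -powRrM; congr (_ `^ _).
by rewrite mulrC divfK.
Qed.

End powR_facts.

(** * The singular kernel *)

Section kernel.
Context {R : realType} {n : nat} (s delta : R) (w : 'rV[R]_n -> R).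
Hypotheses (n_gt0 : (0 < n)%N) (s01 : 0 < s < 1) (delta_gt0 : 0 < delta)
  (hw : cutoff delta w).
Local Notation leb := (lebesgue_rV (n := n)).
Local Notation e_ := (delta_mx (ord0 : 'I_1)).

Let p := n%:R + 1 + s.

(** The scalar factor whose product with z is the vector kernel. It keeps the shape of the factors
    in [nlgrad] and [nldiv], so that [ring] can match them; [radial_kernelE] gives the usual
    form. *)
Definition radial_kernel (z : 'rV[R]_n) : R :=
  (enorm z)^-1 * (enorm z)^-1 * (w z / enorm z `^ (n%:R - 1 + s)).
Local Notation kap := radial_kernel.

Let s_gt0 : 0 < s. Proof. by case/andP: s01. Qed.
Let s_lt1 : s < 1. Proof. by case/andP: s01. Qed.
Let n_ge1 : 1 <= n%:R :> R. Proof. by rewrite ler1n. Qed.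

Lemma radial_kernelE z : kap z = w z * enorm z `^ (- p).
Proof.
(* At the origin both sides are 0 by convention: the inverse of 0 is 0, and so is 0 raised to the
   non-zero exponent [- p]. *)
have [e0|e0] := eqVneq (enorm z) 0.
  rewrite /kap e0 invr0 !mul0r powR0 ?mulr0// oppr_eq0 gt_eqF// /p; have := s_gt0; have := n_ge1; lra.
rewrite /kap -powRN -powR_inv1 ?enorm_ge0// mulrCA -!powRD ?e0 ?implybT//.
by congr (_ * _ `^ _); rewrite /p; ring.
Qed.

#[local] Opaque radial_kernel.

Lemma cutoff_ge0 z : 0 <= w z.
Proof. by have [_ _ _ [a0 [b0 [_ _ /(_ z)/andP[]]]]] := hw. Qed.

Lemma cutoff_bounded : exists2 a0 : R, 0 < a0 & forall z, w z <= a0.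
Proof. by have [_ _ _ [a0 [b0 [a00 _ h _]]]] := hw; exists a0 => // z; case/andP: (h z). Qed.

Lemma cutoff_out z : delta <= enorm z -> w z = 0.
Proof.
move=> dz; have [[_ _ sw] _ _ _] := hw; apply: supp0 => /sw.
by rewrite /eball /= subr0 ltNge dz.
Qed.

Lemma cutoff_radial y z : enorm y = enorm z -> w y = w z.
Proof. by have [_ + _ _] := hw; exact. Qed.

Lemma cutoff_C1 : Ck 1 w.
Proof. by have [[/(_ 1%N)]] := hw. Qed.

Lemma radial_kernel_ge0 z : 0 <= kap z.
Proof. by rewrite radial_kernelE mulr_ge0// ?cutoff_ge0// powR_ge0. Qed.

Lemma radial_kernel_out z : delta <= enorm z -> kap z = 0.
Proof. by move=> dz; rewrite radial_kernelE cutoff_out// mul0r. Qed.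

Lemma measurable_radial_kernel : measurable_fun [set: 'rV[R]_n] kap.
Proof.
have -> : kap = fun z => w z * enorm z `^ (- p) by apply/funext => z; exact: radial_kernelE.
apply: measurable_funM.
  by apply: continuous_measurable_rV; exact: C1_continuous cutoff_C1.
apply: (@measurableT_comp _ _ _ _ _ _ (fun x : R => x `^ (- p)) _ (@enorm R n)).
  exact: measurable_powR.
exact: measurable_enorm.
Qed.

(** The remaining order n - 1 + s of the singularity is below the dimension. *)
Lemma sqr_enorm_kernelE z : enorm z ^+ 2 * kap z = w z * enorm z `^ (- (n%:R - 1 + s)).
Proof.
have [e0|e0] := eqVneq (enorm z) 0.
  by rewrite e0 expr0n mul0r powR0 ?mulr0// oppr_eq0 gt_eqF//; have := s_gt0; have := n_ge1; lra.
rewrite radial_kernelE -powR_mulrn ?enorm_ge0// mulrCA -powRD ?e0 ?implybT//.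
by congr (_ * _ `^ _); rewrite /p; ring.
Qed.

Let rho (k : nat) := delta / 2 ^+ k.

Lemma dyadic_shell (m : R) : 0 < m -> m < delta -> exists k, rho k.+1 <= m < rho k.
Proof.
move=> m0 md.
have ex : exists k, rho k <= m.
  (* 2^N exceeds N, which bounds delta / m. The least such index is positive because m < delta, and
     its predecessor is the shell. *)
  exists (Num.bound (delta / m)); rewrite /rho ler_pdivrMr ?exprn_gt0// mulrC -ler_pdivrMr//.
  apply: (le_trans (ltW (archi_boundP _))); first by rewrite divr_ge0// ltW.
  by rewrite -natrX ler_nat ltnW// ltn_expl.
have [k km kmin] := ex_minnP ex.
case: k km kmin => [|k] km kmin.
  by move: km; rewrite /rho expr0 divr1 leNgt md.
exists k; rewrite km/= ltNge; apply/negP => /kmin; rewrite ltnn.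
by [].
Qed.

(* Comparison with a geometric series over the dyadic shells rho_{k+1} <= |z| < rho_k, on which the
   kernel is at most a0 rho_{k+1}^{-(n-1+s)}. *)
Lemma integrable_sqr_enorm_kernel : leb.-integrable setT (fun z => (enorm z ^+ 2 * kap z)%:E).
Proof.
have mh : measurable_fun [set: 'rV[R]_n] (fun z => enorm z ^+ 2 * kap z).
  apply: measurable_funM; last exact: measurable_radial_kernel.
  by apply: continuous_measurable_rV; exact: continuous_sqr_enorm.
apply/integrableP; split; first exact/measurable_EFinP.
have [a0 a00 wa0] := cutoff_bounded.
pose al := n%:R - 1 + s.
have al0 : 0 < al by rewrite /al; have := s_gt0; have := n_ge1; lra.
pose B k := [set z : 'rV[R]_n | `|z| < rho k].
pose c k := a0 * rho k.+1 `^ (- al).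
have rho0 k : 0 < rho k by rewrite divr_gt0// exprn_gt0.
have c0 k : 0 <= c k by rewrite mulr_ge0 ?powR_ge0// ltW.
have mB k : measurable (B k).
  apply: open_measurable_rV; rewrite (_ : B k = ball 0 (rho k)); first exact: ball_open.
  by rewrite mx_norm_ball; apply/seteqP; split => x /=; rewrite sub0r normrN.
pose F k z := ((c k)%:E * (\1_(B k) z)%:E)%E.
have F0 k z : (0 <= F k z)%E by rewrite mule_ge0// ?lee_fin.
have mF k : measurable_fun setT (F k).
  by apply: emeasurable_funM => //; apply/measurable_EFinP; exact: measurable_indic.
have hF z : ((enorm z ^+ 2 * kap z)%:E <= \sum_(k <oo) F k z)%E.
  have [z0|z0] := eqVneq z 0.
    have e0 : enorm z = 0 by apply/eqP; rewrite enorm_eq0 z0.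
    by rewrite e0 expr0n mul0r; exact: nneseries_ge0.
  have [dz|zd] := leP delta (enorm z).
    by rewrite radial_kernel_out// mulr0; exact: nneseries_ge0.
  (* The shells are those of the sup norm, whose balls are cubes of known volume; since the
     Euclidean norm is the larger one, the lower bound on the shell still controls the kernel. *)
  have [k /andP[k1 k2]] := dyadic_shell (etrans (normr_gt0 z) z0) (le_lt_trans (norm_le_enorm z) zd).
  apply: (@le_trans _ _ (F k z)); last first.
    rewrite (@nneseriesD1 _ (F^~ z) k xpredT)//.
    by rewrite leeDl//; exact: nneseries_ge0.
  rewrite /F /B indicE mem_set// mule1 lee_fin sqr_enorm_kernelE.
  apply: ler_pM => //; [exact: cutoff_ge0|exact: powR_ge0|].
  apply: ler_powR_neg => //; last exact: ltW.
  exact: (le_trans k1 (norm_le_enorm z)).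
(* Shell k contributes a multiple of rho_k^(1-s), which is geometric in k with this ratio, below 1
   because s < 1. *)
pose q := (2 : R) `^ (s - 1).
have q01 : 0 < q < 1.
  rewrite powR_gt0//= /q /powR pnatr_eq0/= -[X in _ < X]expR0 ltr_expR.
  by rewrite nmulr_rlt0 ?ln_gt0 ?ltr1n// subr_lt0.
(* The factor [2 ^ al] pays for replacing rho_{k+1} by rho_k, and [2 ^+ n] comes from the side 2
   rho_k of the cube. *)
pose C := a0 * (2 `^ al * 2 ^+ n * delta `^ (1 - s)).
apply: (@le_lt_trans _ _ (\int[leb]_z (\sum_(k <oo) F k z))%E).
  apply: ge0_le_integral => //.
  - by apply: measurableT_comp => //; exact/measurable_EFinP.
  - by apply: ge0_emeasurable_sum => // k z _ _; exact: F0.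
  - move=> z _; rewrite gee0_abs ?hF// lee_fin mulr_ge0 ?sqr_ge0//.
    exact: radial_kernel_ge0.
rewrite integral_nneseries//.
apply: (@le_lt_trans _ _ (C / (1 - q))%:E); last exact: ltry.
apply: lime_le; first by apply: is_cvg_nneseries => k _ _; exact: integral_ge0.
apply: nearW => N.
apply: (@le_trans _ _ (\sum_(0 <= k < N) (C * q ^+ k)%:E)%E).
  apply: lee_sum => k _.
  rewrite ge0_integralZl//; last 2 first.
    by apply/measurable_EFinP; exact: measurable_indic.
    by rewrite lee_fin.
  rewrite integral_indic// setIT.
  apply: (@le_trans _ _ ((c k)%:E * ((2 * rho k) ^+ n)%:E)%E).
    by apply: lee_wpmul2l; [rewrite lee_fin|exact: lebesgue_rV_ball].
  rewrite -EFinM lee_fin /c /C -!mulrA; apply: ler_wpM2l; first exact: ltW.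
  have -> : rho k.+1 = rho k / 2 by rewrite /rho exprS invfM mulrA mulrAC.
  have -> : (rho k / 2) `^ (- al) = rho k `^ (- al) * 2 `^ al.
    rewrite powRM ?invr_ge0// ?ltW//; congr (_ * _).
    by rewrite -powR_inv1// -powRrM; congr (_ `^ _); ring.
  have -> : delta `^ (1 - s) * q ^+ k = rho k `^ (1 - s).
    rewrite /rho powRM ?invr_ge0 ?exprn_ge0// ?ltW//; congr (_ * _).
    rewrite -powR_mulrn ?powR_ge0// /q -powRrM -powR_inv1 ?exprn_ge0// -powR_mulrn// -!powRrM.
    by congr (_ `^ _); ring.
  have -> : rho k `^ (1 - s) = rho k `^ (- al) * rho k ^+ n.
    rewrite -powR_mulrn ?ltW// -powRD; last by apply/implyP => _; rewrite gt_eqF.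
    by congr (_ `^ _); rewrite /al; ring.
  by rewrite exprMn le_eqVlt; apply/orP; left; apply/eqP; ring.
rewrite sumEFin lee_fin.
have -> : \sum_(0 <= k < N) C * q ^+ k = series (geometric C q) N by [].
case/andP: q01 => q0 q1.
rewrite geometric_seriesE ?lt_eqF//; apply: ler_wpM2r; first by rewrite invr_ge0 subr_ge0; exact: ltW.
have C0 : 0 < C by rewrite !mulr_gt0// ?powR_gt0.
by rewrite (ger_pMr _ C0) gerBl exprn_ge0//; exact: ltW.
Qed.

(** A factor d of order |z| and the coordinate z_j absorb two orders of the singularity. The
    pointwise bound is returned as well, to dominate in the limit theorems; the bound on d is asked
    only where the kernel may be non-zero. *)
Lemma kernel_integrable (d : 'rV[R]_n -> R) (L : R) (j : 'I_n) :
  measurable_fun setT d -> (forall z, enorm z < delta -> `|d z| <= L * `|z|) ->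
  leb.-integrable setT (fun z => (d z * (z ord0 j * kap z))%:E) /\
  forall z, `|d z * (z ord0 j * kap z)| <= L * (enorm z ^+ 2 * kap z).
Proof.
move=> md dL.
have bd z : `|d z * (z ord0 j * kap z)| <= L * (enorm z ^+ 2 * kap z).
  have [dz|zd] := leP delta (enorm z); first by rewrite radial_kernel_out// !mulr0 normr0.
  rewrite normrM (normrM (z ord0 j) (kap z)) (ger0_norm (radial_kernel_ge0 z)).
  rewrite [leLHS]mulrA [leRHS]mulrA; apply: ler_wpM2r; first exact: radial_kernel_ge0.
  (* The sign of [L] is not assumed: it is read off from the bound on d at a non-zero z. *)
  have [z0|z0] := eqVneq z 0.
    by rewrite z0 mxE normr0 mulr0 (eqP (etrans (enorm_eq0 0) (eqxx _))) expr0n mulr0.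
  have L0 : 0 <= L.
    by have := le_trans (normr_ge0 _) (dL z zd); rewrite pmulr_lge0// normr_gt0.
  apply: (@le_trans _ _ (L * `|z| * enorm z)).
    by apply: ler_pM => //; [exact: dL|exact: coord_le_enorm].
  by rewrite -mulrA ler_wpM2l// expr2 ler_wpM2r ?enorm_ge0// norm_le_enorm.
split=> //.
apply: (@le_integrable _ _ _ leb setT measurableT _ (fun z => L%:E * (enorm z ^+ 2 * kap z)%:E)%E).
- apply/measurable_EFinP; apply: measurable_funM => //.
  apply: measurable_funM; [exact: measurable_coor|exact: measurable_radial_kernel].
- move=> z _; rewrite -EFinM lee_fin; apply: le_trans (bd z) _; exact: ler_norm.
- by apply: integrableZl => //; exact: integrable_sqr_enorm_kernel.
Qed.


Section regularised.
Variables (eps : R).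
Hypothesis eps_gt0 : 0 < eps.

(** The exponent is halved because the base is a squared norm; formally eps = 0 gives
    [radial_kernel] back. *)
Definition regular_kernel (z : 'rV[R]_n) : R := w z * (enorm z ^+ 2 + eps) `^ (- p / 2).

Let i0 : 'I_n := Ordinal n_gt0.
(** The regularised kernel as a function of t = |z|^2, halved to offset the factor 2 z_j of the
    chain rule. As w is radial it may be sampled on one axis. The absolute value keeps the base of
    the power positive for t < 0, so the profile is continuous on the whole line. *)
Let profile (t : R) : R := w (Num.sqrt t *: e_ i0) * (2^-1 * (`|t| + eps) `^ (- p / 2)).
(** Integrating from -1 makes t = 0 an interior point, as differentiability at z = 0 requires. *)
Let primitive (t : R) : R := \int[lebesgue_measure]_(r in `[-1, t]) profile r.
(** The constant makes Q vanish for |z| >= delta, where the primitive no longer varies. *)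
Let Q (z : 'rV[R]_n) : R := primitive (enorm z ^+ 2) - primitive (delta ^+ 2).

Let is_derive_conj (f : R -> R) (x df : R) : is_derive x (1 : R) f df -> derivable f x 1 /\ 'D_1 f x = df.
Proof. by case. Qed.

Let enorm_e (a : R) : enorm (a *: e_ i0 : 'rV[R]_n) = `|a|.
Proof.
rewrite enormZ /enorm (bigD1 i0)//= big1 => [|j ji]; last by rewrite mxE (negbTE ji) andbF expr0n.
by rewrite mxE !eqxx expr1n addr0 sqrtr1 mulr1.
Qed.

Let profile_enorm z : profile (enorm z ^+ 2) *+ 2 = regular_kernel z.
Proof.
rewrite /profile /regular_kernel sqrtr_sqr ger0_norm ?enorm_ge0// ger0_norm ?sqr_ge0//.
rewrite (@cutoff_radial _ z); first by rewrite -mulr_natr; field.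
by rewrite enorm_e ger0_norm// enorm_ge0.
Qed.

Let continuous_profile : continuous profile.
Proof.
move=> t; apply: cvgM.
  apply: (@continuous_comp _ _ _ (fun t : R => Num.sqrt t *: e_ i0) w); last first.
    exact: C1_continuous cutoff_C1 _.
  apply: cvgZr_tmp.
  exact: sqrt_continuous.
apply: cvgM; first exact: cvg_cst.
apply: (@continuous_comp _ _ _ (fun t : R => `|t| + eps) (fun x => x `^ (- p / 2))).
  by apply: cvgD; [exact: norm_continuous|exact: cvg_cst].
by apply: continuous_powR_base; rewrite ltr_wpDl.
Qed.

Let primitive_derive (t : R) : -1 < t -> is_derive t (1 : R) primitive (profile t).
Proof.
move=> t1; have tt : t < t + 1 by rewrite ltrDl.
have ip : lebesgue_measure.-integrable [set` `[-1, t + 1]] (EFin \o profile).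
  by apply: continuous_compact_integrable; [exact: segment_compact|exact: continuous_subspaceT].
have [d e] := @continuous_FTC1 R profile (BLeft (-1)) t (t + 1) tt ip t1 (continuous_profile (x := t)).
by split; [exact: d|rewrite -derive1E e].
Qed.

Let Q_derive z j : is_derive z (e_ j) Q (z ord0 j * regular_kernel z).
Proof.
have d0 : -1 < enorm z ^+ 2 by apply: lt_le_trans (sqr_ge0 _); rewrite ltrN10.
have d1 : is_derive (0 : R) (1 : R) (fun t : R => enorm (z + t *: e_ j) ^+ 2) (2 * z ord0 j).
  by apply: (is_derive_line (u := fun y => enorm y ^+ 2)); rewrite scale0r addr0; exact: is_derive_sqr_enorm.
have d2 : is_derive (enorm (z + (0 : R) *: e_ j) ^+ 2) (1 : R) primitive (profile (enorm z ^+ 2)).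
  by rewrite scale0r addr0; exact: primitive_derive.
apply: is_derive_line0.
have d3 := @is_derive1_comp R primitive (fun t : R => enorm (z + t *: e_ j) ^+ 2) 0 _ _ d2 d1.
have d4 := is_deriveB d3 (is_derive_cst (primitive (delta ^+ 2)) (0 : R) (1 : R)).
apply: (is_derive_eq d4).
by rewrite subr0 -profile_enorm -[_ *+ 2]mulr_natl; ring.
Qed.

Let Q_C1 : Ck 1 Q /\ forall j, partial j Q = fun z => z ord0 j * regular_kernel z.
Proof.
apply: C1_intro => [z|//|j z].
  have cp : {for enorm z ^+ 2, continuous primitive}.
    apply/differentiable_continuous/derivable1_diffP.
    by have [] : is_derive (enorm z ^+ 2) (1 : R) primitive (profile (enorm z ^+ 2));
      [apply: primitive_derive; apply: lt_le_trans (sqr_ge0 _); rewrite ltrN10|].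
  have c2 : {for z, continuous (fun z => primitive (enorm z ^+ 2))}.
    exact: (continuous_comp (@continuous_sqr_enorm R n z) cp).
  by apply: (continuousB c2); exact: cst_continuous.
have c2 : {for z, continuous (fun z : 'rV[R]_n => (enorm z ^+ 2 + eps) `^ (- p / 2))}.
  apply: (@continuous_comp _ _ _ (fun z : 'rV[R]_n => enorm z ^+ 2 + eps) (fun x => x `^ (- p / 2))).
    by apply: continuousD; [exact: continuous_sqr_enorm|exact: cst_continuous].
  by apply: continuous_powR_base; rewrite ltr_wpDl// sqr_ge0.
apply: continuousM; first exact: coord_continuous.
by apply: continuousM c2; exact: C1_continuous cutoff_C1 _.
Qed.

Let Q_out z : delta < `|z| -> Q z = 0.
Proof.
move=> dz; have de : delta <= enorm z by apply: le_trans (norm_le_enorm z); exact: ltW.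
have d2 : delta ^+ 2 <= enorm z ^+ 2 by rewrite ler_pXn2r ?nnegrE ?enorm_ge0// ltW.
have t1 t : t \in `[delta ^+ 2, enorm z ^+ 2] -> -1 < t.
  rewrite in_itv/= => /andP[dt _]; apply: lt_le_trans dt; apply: lt_le_trans (sqr_ge0 _).
  by rewrite ltrN10.
(* Between delta^2 and |z|^2 the derivative of the primitive is 0, because w vanishes at norms at
   least delta. *)
have [c cI cE] := MVT_segment d2 (fun t tI => primitive_derive (t1 t (subset_itv_oo_cc tI)))
  (derivable_within_continuous (fun t tI => let: conj d _ := is_derive_conj (primitive_derive (t1 t tI)) in d)).
rewrite /Q cE /profile cutoff_out ?mul0r// enorm_e.
move: cI; rewrite in_itv/= => /andP[dc _].
rewrite (ger0_norm (sqrtr_ge0 c)).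
have <- : Num.sqrt (delta ^+ 2) = delta by rewrite sqrtr_sqr gtr0_norm.
exact: ler_wsqrtr.
Qed.

(* z * regular_kernel z is the gradient of the compactly supported Q: integrate by parts. *)
Lemma integral_divfree_regular_kernel (v : 'I_n -> 'rV[R]_n -> R) :
  (forall j, Ck 1 (v j)) -> (forall x, \sum_j partial j (v j) x = 0) ->
  \int[leb]_z (\sum_j v j z * (z ord0 j * regular_kernel z)) = 0.
Proof.
move=> Cv dv.
have [CQ pQ] := Q_C1.
have cQ := C1_continuous CQ.
have pQ0 j := partial_support (fun x => C1_is_derive j x CQ) Q_out.
have i1 j : leb.-integrable setT (EFin \o (fun z => v j z * (z ord0 j * regular_kernel z))).
  apply: (@continuous_support_integrable _ _ _ delta) => [x|x rx].
    have := C1_continuous_partial (i:=j) CQ; rewrite pQ => cp.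
    exact: (cvgM (C1_continuous (Cv j) (x:=x)) (cp x)).
  by have := pQ0 j x rx; rewrite pQ => ->; rewrite mulr0.
have i2 j : leb.-integrable setT (EFin \o (fun z => Q z * partial j (v j) z)).
  apply: (@continuous_support_integrable _ _ _ delta) => [x|x rx]; last by rewrite Q_out// mul0r.
  exact: (cvgM (cQ x) (C1_continuous_partial (i:=j) (Cv j) (x:=x))).
rewrite Rintegral_sum//.
transitivity (\sum_j - \int[leb]_z (Q z * partial j (v j) z)).
  apply: eq_bigr => j _; rewrite -(integration_by_parts_rV j (Cv j) CQ Q_out).
  by rewrite pQ.
rewrite sumrN -Rintegral_sum//; under eq_Rintegral do rewrite -mulr_sumr dv mulr0.
by rewrite Rintegral_cst// mul0r oppr0.
Qed.

(** The origin is excluded: there the singular kernel is 0 by convention, while the regularised one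
    is positive. *)
Lemma regular_kernel_le z : z != 0 -> 0 <= regular_kernel z <= kap z.
Proof.
move=> z0; have e0 : 0 < enorm z by rewrite lt_neqAle enorm_ge0 eq_sym enorm_eq0 z0.
rewrite /regular_kernel mulr_ge0 ?powR_ge0 ?cutoff_ge0//= radial_kernelE.
rewrite ler_wpM2l ?cutoff_ge0//.
have -> : enorm z `^ (- p) = (enorm z ^+ 2) `^ (- p / 2) by rewrite sqr_powR_half// enorm_ge0.
rewrite mulNr; apply: ler_powR_neg; rewrite ?exprn_gt0 ?lerDl ?ltW//.
by rewrite divr_gt0// /p; have := s_gt0; have := n_ge1; lra.
Qed.

Lemma measurable_regular_kernel : measurable_fun [set: 'rV[R]_n] regular_kernel.
Proof.
apply: measurable_funM.
  by apply: continuous_measurable_rV; exact: C1_continuous cutoff_C1.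
apply: (@measurableT_comp _ _ _ _ _ _ (fun x : R => x `^ (- p / 2)) _ (fun z => enorm z ^+ 2 + eps)).
  exact: measurable_powR.
apply: measurable_funD => //.
by apply: continuous_measurable_rV; exact: continuous_sqr_enorm.
Qed.

End regularised.

Lemma cvg_regular_kernel z : z != 0 ->
  regular_kernel (k.+1%:R^-1) z @[k --> \oo] --> kap z.
Proof.
move=> z0; have e0 : 0 < enorm z by rewrite lt_neqAle enorm_ge0 eq_sym enorm_eq0 z0.
rewrite radial_kernelE; apply: cvgM; first exact: cvg_cst.
rewrite -(sqr_powR_half (- p) (enorm_ge0 z)).
have h1 : enorm z ^+ 2 + k.+1%:R^-1 @[k --> \oo] --> enorm z ^+ 2.
  rewrite -[X in _ --> X]addr0; apply: cvgD; first exact: cvg_cst.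
  exact: cvg_harmonic.
have h2 : {for enorm z ^+ 2, continuous (fun x : R => x `^ (- p / 2))}.
  by apply: continuous_powR_base; rewrite exprn_gt0.
exact: (cvg_comp _ _ h1 h2).
Qed.

(** Dominated convergence along eps = 1/(k+1). Since v vanishes at 0 and is Lipschitz on the ball of
    radius delta, the integrands are dominated by a multiple of |z|^2 times the kernel; at z = 0
    they all vanish, whatever the kernels are worth there. *)
Lemma integral_divfree_kernel (v : 'I_n -> 'rV[R]_n -> R) :
  (forall j, Ck 1 (v j)) -> (forall x, \sum_j partial j (v j) x = 0) -> (forall j, v j 0 = 0) ->
  \int[leb]_z (\sum_j v j z * (z ord0 j * kap z)) = 0.
Proof.
move=> Cv dv v0.
have /choice[L LP] : forall j, exists L : R, forall z, enorm z < delta -> `|v j z| <= L * `|z|.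
  move=> j; have [L L0 LP] := C1_lipschitz_ball delta (Cv j).
  exists L => z zd; have := LP z 0; rewrite v0 !subr0 normr0; apply; rewrite ?ltW//.
  exact: le_lt_trans (norm_le_enorm z) zd.
have mv j : measurable_fun setT (v j).
  by apply: continuous_measurable_rV; exact: C1_continuous (Cv j).
have KI j := kernel_integrable j (mv j) (LP j).
pose f z := (\sum_j v j z * (z ord0 j * kap z))%:E.
pose f_ k z := (\sum_j v j z * (z ord0 j * regular_kernel (k.+1%:R^-1) z))%:E.
pose g z := (\sum_j (L j)%:E * (enorm z ^+ 2 * kap z)%:E)%E.
have k0 (k : nat) : 0 < (k.+1%:R^-1 : R) by [].
have fg k z : (`|f_ k z| <= g z)%E.
  rewrite /g sumEFin lee_fin; apply: (le_trans (ler_norm_sum _ _ _)); apply: ler_sum => j _.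
  apply: le_trans ((KI j).2 z).
  have [->|z0] := eqVneq z 0; first by rewrite v0 !mul0r.
  have /andP[h1 h2] := regular_kernel_le (k0 k) z0.
  rewrite normrM [leRHS]normrM ler_wpM2l// normrM (normrM (z ord0 j) (kap z)) ler_wpM2l//.
  by rewrite !ger0_norm// radial_kernel_ge0.
have mf : measurable_fun setT f.
  apply/measurable_EFinP; apply: measurable_sum => j; apply: measurable_funM => //.
  apply: measurable_funM; [exact: measurable_coor|exact: measurable_radial_kernel].
have mf_ k : measurable_fun setT (f_ k).
  apply/measurable_EFinP; apply: measurable_sum => j; apply: measurable_funM => //.
  apply: measurable_funM; [exact: measurable_coor|exact: measurable_regular_kernel].
have ig : leb.-integrable setT g.
  apply: integrable_sum => // j _; apply: integrableZl => //.
  exact: integrable_sqr_enorm_kernel.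
have cf z : f_ ^~ z @ \oo --> f z.
  apply: cvg_EFin; first exact: nearW.
  apply: (cvg_sumr (f := fun j k => v j z * (z ord0 j * regular_kernel (k.+1%:R^-1) z))) => j.
  have [->|z0] := eqVneq z 0.
    by rewrite v0 mul0r; under eq_fun do rewrite mul0r; exact: cvg_cst.
  apply: cvgM; first exact: cvg_cst.
  apply: cvgM; first exact: cvg_cst.
  exact: cvg_regular_kernel.
have [_ _ H] := @dominated_convergence _ _ _ leb setT measurableT f_ f g mf_ mf
  (aeW _ (fun z _ => cf z)) ig (aeW _ (fun z k _ => fg k z)).
have f0 k : (\int[leb]_z f_ k z = 0)%E.
  have if_ : leb.-integrable setT (f_ k).
    by apply: (le_integrable measurableT (mf_ k) _ ig) => z _; apply: le_trans (fg k z) _; exact: lee_abs.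
  have := integral_divfree_regular_kernel (k0 k) Cv dv.
  rewrite /Rintegral => h; rewrite -[LHS]fineK; first by rewrite h.
  exact: integrable_fin_num.
have : (\int[leb]_z f z = 0)%E.
  apply: (cvg_unique _ H) => //; rewrite /=; under eq_fun do rewrite f0; exact: cvg_cst.
by rewrite /Rintegral => ->.
Qed.

End kernel.

Lemma Rintegral_combination d (T : measurableType d) (R : realType) (mu : {measure set T -> \bar R})
    (h : R) (f g k : T -> R) : mu.-integrable setT (EFin \o f) -> mu.-integrable setT (EFin \o g) ->
  mu.-integrable setT (EFin \o k) ->
  \int[mu]_x (f x - g x - h * k x) = \int[mu]_x f x - \int[mu]_x g x - h * \int[mu]_x k x.
Proof.
move=> fi gi ki; have hki : mu.-integrable setT (EFin \o (fun x => h * k x)).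
  exact: (integrableZl measurableT h ki).
rewrite RintegralB//; first by rewrite RintegralB// RintegralZl.
exact: (integrableB measurableT fi gi).
Qed.

Lemma Rintegral_cst0 d (T : measurableType d) (R : realType) (mu : {measure set T -> \bar R}) (D : set T) :
  \int[mu]_(x in D) (0 : R) = 0.
Proof. by rewrite /Rintegral integral0. Qed.

Lemma norm_between (R : realDomainType) (t h : R) : Num.min 0 h <= t <= Num.max 0 h -> `|t| <= `|h|.
Proof.
case: (leP 0 h) => [h0|/ltW h0] /andP[h1 h2].
  by rewrite !ger0_norm.
by rewrite !ler0_norm// lerN2.
Qed.

Lemma lt_of_ltD_leD (R : realDomainType) (r d a b c : R) : r + d < a -> a <= b + c -> c <= d -> r < b.
Proof.
move=> rd ab cd; rewrite -(ltrD2r d); apply: (lt_le_trans rd); apply: (le_trans ab).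
by rewrite lerD2l.
Qed.

(** * Reflections, translations and differences of functions *)

Section translations.
Context {R : realType} {n : nat}.
Implicit Types (u : 'rV[R]_n -> R) (x y z : 'rV[R]_n).
Local Notation e_ := (delta_mx (ord0 : 'I_1)).

Lemma continuous_subl x : continuous (fun z : 'rV[R]_n => x - z).
Proof. by move=> z; apply: continuousB; [exact: cst_continuous|exact: cvg_id]. Qed.

Lemma continuous_addl x : continuous (fun z : 'rV[R]_n => x + z).
Proof. by move=> z; apply: continuousD; [exact: cst_continuous|exact: cvg_id]. Qed.

Lemma is_derive_reflect u x z i d : is_derive (x - z) (e_ i) u d ->
  is_derive z (e_ i) (fun z => u (x - z)) (- d).
Proof.
move=> du; apply: is_derive_line0.
have dN : is_derive (0 : R) (1 : R) (fun t : R => - t) (-1) by exact: is_deriveN.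
have d1 : is_derive (- (0 : R)) (1 : R) (fun t : R => u (x - z + t *: e_ i)) d.
  by apply: is_derive_line; rewrite oppr0 scale0r addr0.
have d2 := @is_derive1_comp R (fun t : R => u (x - z + t *: e_ i)) (fun t : R => - t) 0 _ _ d1 dN.
have -> : (fun t : R => u (x - (z + t *: e_ i))) =
   (fun t : R => u (x - z + t *: e_ i)) \o (fun t : R => - t).
  by apply/funext => t /=; rewrite scaleNr opprD addrA.
by apply: (is_derive_eq d2); rewrite mulrN1.
Qed.

Lemma is_derive_translate u x z i d : is_derive (x + z) (e_ i) u d ->
  is_derive z (e_ i) (fun z => u (x + z)) d.
Proof.
move=> du; apply: is_derive_line0.
have -> : (fun t : R => u (x + (z + t *: e_ i))) = (fun t : R => u (x + z + t *: e_ i)).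
  by apply/funext => t; rewrite addrA.
by apply: is_derive_line; rewrite scale0r addr0.
Qed.

Lemma C1_reflect u x : Ck 1 u -> Ck 1 (fun z => u (x - z)) /\
  forall i, partial i (fun z => u (x - z)) = fun z => - partial i u (x - z).
Proof.
move=> /C1P[cu du cdu]; apply: C1_intro => [z|i z|i z].
- exact: (continuous_comp (@continuous_subl x z) (cu _)).
- exact: is_derive_reflect.
- exact: (cvgN (continuous_comp (@continuous_subl x z) (cdu i (x - z)))).
Qed.

(** The signs from the reflection and from the subtraction cancel, so the difference of a
    divergence-free field is divergence-free in z, and it vanishes at z = 0. *)
Lemma C1_difference u x : Ck 1 u -> Ck 1 (fun z => u x - u (x - z)) /\
  forall i, partial i (fun z => u x - u (x - z)) = fun z => partial i u (x - z).
Proof.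
move=> Cu; have [C0 P0] := @C1_cst R n (u x); have [C1 P1] := C1_reflect x Cu.
have [C2 P2] := C1N C1; have [C3 P3] := C1D C0 C2.
split; first exact: C3.
move=> i; rewrite [LHS]P3 P0 P2 P1; apply/funext => z /=.
by rewrite add0r opprK.
Qed.

Lemma measurable_difference u x : continuous u ->
  measurable_fun [set: 'rV[R]_n] (fun z : 'rV[R]_n => u x - u (x - z)).
Proof.
move=> cu; apply: measurable_funB => //; apply: continuous_measurable_rV => z.
exact: (continuous_comp (@continuous_subl x z) (cu _)).
Qed.

Lemma C1_translate u x : Ck 1 u -> Ck 1 (fun z => u (x + z)) /\
  forall i, partial i (fun z => u (x + z)) = fun z => partial i u (x + z).
Proof.
move=> /C1P[cu du cdu]; apply: C1_intro => [z|i z|i z].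
- exact: (continuous_comp (@continuous_addl x z) (cu _)).
- exact: is_derive_translate.
- by apply: (@continuous_comp _ _ _ (fun z => x + z) (partial i u)); [exact: continuous_addl|exact: cdu].
Qed.

Lemma lipschitz_continuous_rV u (C : R) :
  (forall x y, `|u x - u y| <= C * `|x - y|) -> continuous u.
Proof.
move=> H x A /nbhs_normP[e /= e0 eA]; have C0 : 0 < `|C| + 1 by rewrite ltr_wpDl.
have d0 : 0 < e / (`|C| + 1) by rewrite divr_gt0.
apply: (filterS _ (nbhsx_ballx x _ d0)) => y; rewrite mx_norm_ball /ball_ /= => xy.
apply: eA => /=; apply: (le_lt_trans (H x y)).
apply: (@le_lt_trans _ _ ((`|C| + 1) * `|x - y|)).
  by apply: ler_wpM2r => //; apply: (le_trans (ler_norm _)); rewrite lerDl.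
by rewrite mulrC -ltr_pdivlMr.
Qed.

(** A quadratic remainder is what an estimate of the kernel integral yields; it takes the place of
    differentiation under the integral sign. *)
Lemma quadratic_is_derive u x (v : 'rV[R]_n) (d C : R) :
  (forall h : R, `|u (x + h *: v) - u x - h * d| <= C * h ^+ 2) -> is_derive x v u d.
Proof.
move=> H; have lim : h^-1 *: ((u \o shift x) (h *: v) - u x) @[h --> 0^'] --> d.
  apply/cvgrPdist_le => e e0; near=> h.
  have h0 : h != 0 by near: h; exact: nbhs_dnbhs_neq.
  have -> : d - h^-1 *: ((u \o shift x) (h *: v) - u x) = - (h^-1 * (u (x + h *: v) - u x - h * d)).
    by rewrite /GRing.scale/= [h *: v + x]addrC; field.
  rewrite normrN normrM normfV ler_pdivrMl ?normr_gt0//.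
  apply: (le_trans (H h)).
  have -> : C * h ^+ 2 = `|h| * (C * `|h|).
    by rewrite [RHS]mulrCA -[`|h| * _]expr2 real_normK ?num_real.
  (* [C] may be zero or negative; [|C| + 1] is a positive substitute that can be divided by. *)
  apply: ler_wpM2l => //; apply: (@le_trans _ _ ((`|C| + 1) * `|h|)).
    by apply: ler_wpM2r => //; apply: (le_trans (ler_norm _)); rewrite lerDl.
  rewrite -ler_pdivlMl ?ltr_wpDl//.
  near: h; apply: dnbhs0_le; rewrite mulr_gt0// invr_gt0 ltr_wpDl//.
split; first by apply/cvg_ex; exists d.
exact: cvg_lim lim.
Unshelve. all: by end_near. Qed.

End translations.

(** * Nonlocal gradient and divergence of smooth functions *)

Section nonlocal_operators.
Context {R : realType} {n : nat} (s delta : R) (w : 'rV[R]_n -> R).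
Hypotheses (n_gt0 : (0 < n)%N) (s01 : 0 < s < 1) (delta_gt0 : 0 < delta)
  (hw : cutoff delta w).
Local Notation leb := (lebesgue_rV (n := n)).
Local Notation e_ := (delta_mx (ord0 : 'I_1)).
Local Notation kap := (radial_kernel s w).

(** A component of the nonlocal gradient without its constant, after y = x - z. The domain no longer
    depends on x: the kernel vanishes for |z| >= delta, so the integral may run over the whole
    space. *)
Definition nldiff (j : 'I_n) (u : 'rV[R]_n -> R) (x : 'rV[R]_n) : R :=
  \int[leb]_z ((u x - u (x - z)) * (z ord0 j * kap z)).

(** The second moment of the kernel: a kernel integral is at most the Lipschitz constant of its
    factor times [H]. *)
Let H : R := \int[leb]_z (enorm z ^+ 2 * kap z).
Let mkap := measurable_radial_kernel n_gt0 s01 hw.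
Let kap_out := radial_kernel_out n_gt0 s01 hw.

Lemma integral_eball_kernel (x : 'rV[R]_n) (f : 'rV[R]_n -> R) :
  measurable_fun setT f ->
  \int[leb]_(y in eball x delta) (f (x - y) * kap (x - y)) = \int[leb]_z (f z * kap z).
Proof.
move=> mf; rewrite Rintegral_mkcond /Rintegral; congr fine.
rewrite -(integral_rV_reflect x (f := fun z => (f z * kap z)%:E)); last first.
  by apply/measurable_EFinP; exact: measurable_funM.
apply: eq_integral => y _; congr EFin; rewrite patchE; case: ifPn => // /negP yx.
rewrite kap_out ?mulr0// leNgt; apply/negP => xy; apply: yx.
by rewrite inE /eball /= -enormN opprB.
Qed.

Lemma nlgradE u x j : continuous u -> nlgrad s delta w u x ord0 j = @c_ns R n s * nldiff j u x.
Proof.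
move=> cu; rewrite mxE; congr (_ * _); rewrite /nldiff.
under [RHS]eq_Rintegral do rewrite mulrA.
rewrite -(integral_eball_kernel x (f := fun z => (u x - u (x - z)) * z ord0 j)); last first.
  apply: measurable_funM; last exact: measurable_coor.
  exact: measurable_difference.
apply: eq_Rintegral => y _; rewrite subKr /radial_kernel; ring.
Qed.

Lemma nldivE (phi : 'rV[R]_n -> 'rV[R]_n) x : (forall j, continuous (fun x => phi x ord0 j)) ->
  nldiv s delta w phi x = @c_ns R n s *
    \int[leb]_z (\sum_j (phi x ord0 j - phi (x - z) ord0 j) * (z ord0 j * kap z)).
Proof.
move=> cphi; congr (_ * _).
have -> : (fun z => \sum_j (phi x ord0 j - phi (x - z) ord0 j) * (z ord0 j * kap z)) =
   fun z => (\sum_j (phi x ord0 j - phi (x - z) ord0 j) * z ord0 j) * kap z.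
  by apply/funext => z; rewrite mulr_suml; apply: eq_bigr => j _; rewrite mulrA.
rewrite -(integral_eball_kernel x (f := fun z => \sum_j (phi x ord0 j - phi (x - z) ord0 j) * z ord0 j)); last first.
  apply: measurable_sum => j.
  apply: measurable_funM; last exact: measurable_coor.
  exact: (measurable_difference x (cphi j)).
apply: eq_Rintegral => y _; rewrite /radial_kernel !mulrA; congr (_ * _); rewrite !mulr_suml.
apply: eq_bigr => j _; rewrite subKr !mxE; ring.
Qed.

Lemma nldiv_divfree (phi : 'rV[R]_n -> 'rV[R]_n) x :
  (forall j, Ck 1 (fun x => phi x ord0 j)) -> (forall x, divergence phi x = 0) ->
  nldiv s delta w phi x = 0.
Proof.
move=> Cphi dphi; rewrite nldivE; last by move=> j; exact: C1_continuous.
have CD j := C1_difference x (Cphi j).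
rewrite (integral_divfree_kernel n_gt0 s01 delta_gt0 hw (v := fun j z => phi x ord0 j - phi (x - z) ord0 j)) ?mulr0//.
- by move=> j; exact: (CD j).1.
- by move=> z; rewrite -[RHS](dphi (x - z)); apply: eq_bigr => j _; rewrite (CD j).2.
- by move=> j; rewrite subr0 subrr.
Qed.

Lemma nldiff_integrable u x j : Ck 1 u ->
  leb.-integrable setT (fun z => ((u x - u (x - z)) * (z ord0 j * kap z))%:E).
Proof.
move=> Cu; have [L L0 LP] := C1_lipschitz_ball (`|x| + delta) Cu.
apply: (kernel_integrable n_gt0 s01 delta_gt0 hw (L := L) _ _ _).1.
  exact: (measurable_difference x (C1_continuous Cu)).
move=> z zd; have zd' := le_trans (norm_le_enorm z) (ltW zd).
have -> : `|z| = `|x - (x - z)| by rewrite subKr.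
apply: LP; first by rewrite lerDl ltW.
by apply: (le_trans (ler_normB _ _)); rewrite lerD2l.
Qed.

(* The field f e_j - g e_i is divergence-free. *)
Lemma integral_curlfree_kernel (f g : 'rV[R]_n -> R) i j : Ck 1 f -> Ck 1 g ->
  (forall z, partial j f z = partial i g z) -> f 0 = 0 -> g 0 = 0 -> i != j ->
  leb.-integrable setT (fun z => (f z * (z ord0 j * kap z))%:E) ->
  leb.-integrable setT (fun z => (g z * (z ord0 i * kap z))%:E) ->
  \int[leb]_z (f z * (z ord0 j * kap z)) = \int[leb]_z (g z * (z ord0 i * kap z)).
Proof.
move=> Cf Cg fg f0 g0 ij iF iG.
(* With the Kronecker symbol the components of f e_j - g e_i have one formula for all k; [bs]
   collapses the resulting sums. *)
pose a (k l : 'I_n) : R := (k == l)%:R.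
have bs (h : 'I_n -> R) l : \sum_k a k l * h k = h l.
  rewrite (bigD1 l)//= /a eqxx mul1r big1 ?addr0// => k /negbTE ->.
  by rewrite mul0r.
have Ck1 k : Ck 1 (fun z => a k j * f z + - (a k i * g z)) /\
   forall l z, partial l (fun z => a k j * f z + - (a k i * g z)) z = a k j * partial l f z - a k i * partial l g z.
  have [C1 P1] := C1M (C1_cst (a k j)).1 Cf.
  have [C2 P2] := C1M (C1_cst (a k i)).1 Cg.
  have [C3 P3] := C1N C2; have [C4 P4] := C1D C1 C3.
  split; first exact: C4.
  move=> l z; rewrite P4 P3 P1 P2 (C1_cst _).2 (C1_cst _).2 /=.
  by rewrite !mulr0 !addr0.
have I0 := integral_divfree_kernel n_gt0 s01 delta_gt0 hw (fun k => (Ck1 k).1).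
apply/eqP; rewrite -subr_eq0 -RintegralB//; apply/eqP; rewrite -[RHS]I0.
- apply: eq_Rintegral => z _; rewrite -(bs (fun k => f z * (z ord0 k * kap z)) j).
  rewrite -(bs (fun k => g z * (z ord0 k * kap z)) i) -sumrB.
  by apply: eq_bigr => k _; ring.
- move=> z; rewrite -[RHS](subrr (partial j f z)) {2}fg -(bs (fun k => partial k f z) j).
  rewrite -(bs (fun k => partial k g z) i) -sumrB.
  by apply: eq_bigr => k _; rewrite (Ck1 k).2.
- by move=> k; rewrite f0 g0 !mulr0 subr0.
Qed.

Lemma nldiff_curlfree (f g : 'rV[R]_n -> R) i j x : Ck 1 f -> Ck 1 g -> i != j ->
  (forall z, partial j f z = partial i g z) -> nldiff j f x = nldiff i g x.
Proof.
move=> Cf Cg ij fg.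
have [Cdf Pdf] := C1_difference x Cf; have [Cdg Pdg] := C1_difference x Cg.
apply: (@integral_curlfree_kernel (fun z => f x - f (x - z)) (fun z => g x - g (x - z))) => //.
- by move=> z; rewrite Pdf Pdg fg.
- by rewrite subr0 subrr.
- by rewrite subr0 subrr.
- exact: nldiff_integrable.
- exact: nldiff_integrable.
Qed.

(** Once derivatives are moved under [nldiff], this is the symmetry D_i (D^s u)_j = D_j (D^s
    u)_i. *)
Lemma nldiff_partialC u i j x : Ck 2 u ->
  nldiff j (partial i u) x = nldiff i (partial j u) x.
Proof.
move=> Cu; have [->//|ij] := eqVneq i j.
have e z : partial j (partial i u) z = partial i (partial j u) z by rewrite (C2_partialC j i Cu).
exact: (nldiff_curlfree x (Ck_partial i Cu) (Ck_partial j Cu) ij e).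
Qed.

Let H_ge0 : 0 <= H.
Proof.
apply: Rintegral_ge0 => z _; rewrite mulr_ge0 ?sqr_ge0//; exact: (radial_kernel_ge0 n_gt0 s01 hw).
Qed.

Lemma le_norm_kernel_integral (d : 'rV[R]_n -> R) (L : R) (j : 'I_n) :
  measurable_fun setT d -> (forall z, enorm z < delta -> `|d z| <= L * `|z|) ->
  `|\int[leb]_z (d z * (z ord0 j * kap z))| <= L * H.
Proof.
move=> md dL; have [id bd] := kernel_integrable n_gt0 s01 delta_gt0 hw j md dL.
have ih := integrable_sqr_enorm_kernel n_gt0 s01 delta_gt0 hw.
apply: (le_trans (le_normr_Rintegral measurableT id)).
rewrite /H -RintegralZl//; apply: le_Rintegral => //.
- by apply: (integrable_norm id).
- by have := integrableZl measurableT L ih.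
Qed.

Lemma nldiff_bounded D u j : Cc_infty D u -> exists M : R, forall x, `|nldiff j u x| <= M.
Proof.
move=> Cu; have [L L0 LP] := Cc_lipschitz Cu; exists (L * H) => x.
have [/(_ 1%N)/C1_continuous cu _ _] := Cu.
apply: le_norm_kernel_integral; first exact: measurable_difference.
by move=> z _; apply: le_trans (LP _ _) _; rewrite subKr.
Qed.

(** Every estimate on the increments in x must keep a factor |z| to pay for the singularity. It
    comes from the Lipschitz bound on one further derivative of u, applied to the difference u(x) -
    u(x - z). *)
Lemma nldiff_C1 D u j : Cc_infty D u -> Ck 1 (nldiff j u) /\
  forall i, partial i (nldiff j u) = nldiff j (partial i u).
Proof.
move=> Cu.
have lipJ v : Cc_infty D v -> continuous (nldiff j v).
  move=> Cv; have [/(_ 1%N) C1v _ _] := Cv; have cv := C1_continuous C1v.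
  have /choice[L LP] : forall i, exists L : R, 0 <= L /\ forall x y, `|partial i v x - partial i v y| <= L * `|x - y|.
    by move=> i; have [L L0 LP] := Cc_lipschitz (Cc_partial i Cv); exists L.
  pose M := \sum_i L i.
  have LM i : L i <= M by rewrite /M (bigD1 i)//= lerDl; apply: sumr_ge0 => k _; exact: (LP k).1.
  have M0 : 0 <= M by apply: sumr_ge0 => i _; exact: (LP i).1.
  have bd x y : `|nldiff j v x - nldiff j v y| <= n%:R * M * `|x - y| * H.
    rewrite /nldiff -RintegralB//; [|exact: nldiff_integrable|exact: nldiff_integrable].
    under eq_Rintegral do rewrite -mulrBl.
    apply: le_norm_kernel_integral.
      by apply: measurable_funB; exact: measurable_difference.
    (* With z fixed, t -> v t - v (t - z) has partial derivatives of size M |z|, hence Lipschitz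
       constant n M |z|. *)
    move=> z _; have dG i (t : 'rV[R]_n) : is_derive t (e_ i) (fun t => v t - v (t - z)) (partial i v t - partial i v (t - z)).
      apply: is_deriveB; first exact: C1_is_derive.
      have -> : (fun t => v (t - z)) = (fun t => v (- z + t)) by apply/funext => ?; rewrite addrC.
      by apply: is_derive_translate; rewrite addrC; exact: C1_is_derive.
    have := @bounded_partials_lipschitz _ _ (fun t => v t - v (t - z)) _ (Num.max `|x| `|y|) (M * `|z|) _ dG _ x y.
    rewrite !le_max !lexx orbT => /(_ _ _ isT isT) h.
    apply: (le_trans (h _ _)); first by rewrite mulr_ge0.
      move=> i t _; apply: (le_trans ((LP i).2 _ _)); rewrite subKr; exact: ler_wpM2r.
    by rewrite le_eqVlt; apply/orP; left; apply/eqP; ring.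
  by apply: (@lipschitz_continuous_rV _ _ _ (n%:R * M * H)) => x y; rewrite mulrAC; exact: bd.
apply: C1_intro => [|i x|i]; [exact: lipJ|idtac|exact: lipJ (Cc_partial i Cu)].
have Cp := Cc_partial i Cu; have Cpp := Cc_partial i Cp.
have [L L0 LP] := Cc_lipschitz Cpp.
have [/(_ 1%N) C1u _ _] := Cu; have [/(_ 1%N) C1p _ _] := Cp.
have [/(_ 1%N) C1pp _ _] := Cpp.
apply: (@quadratic_is_derive _ _ _ _ _ _ (L * H)) => h.
have i1 y : leb.-integrable setT (fun z => ((u y - u (y - z)) * (z ord0 j * kap z))%:E).
  exact: nldiff_integrable.
have i2 : leb.-integrable setT (fun z => ((partial i u x - partial i u (x - z)) * (z ord0 j * kap z))%:E).
  exact: nldiff_integrable.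
have -> : nldiff j u (x + h *: e_ i) - nldiff j u x - h * nldiff j (partial i u) x =
  \int[leb]_z (((u (x + h *: e_ i) - u (x + h *: e_ i - z)) - (u x - u (x - z)) -
     h * (partial i u x - partial i u (x - z))) * (z ord0 j * kap z)).
  rewrite /nldiff -(Rintegral_combination h (i1 (x + h *: e_ i)) (i1 x) i2).
  by apply: eq_Rintegral => z _; ring.
rewrite mulrAC; apply: le_norm_kernel_integral.
  apply: measurable_funB; first by apply: measurable_funB; exact: (measurable_difference _ (C1_continuous C1u)).
  by apply: measurable_funM => //; exact: (measurable_difference _ (C1_continuous C1p)).
move=> z _.
have dG v (Cv : Ck 1 v) (t : 'rV[R]_n) : is_derive t (e_ i) (fun t => v t - v (t - z)) (partial i v t - partial i v (t - z)).
  apply: is_deriveB; first exact: C1_is_derive.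
  have -> : (fun t => v (t - z)) = (fun t => v (- z + t)) by apply/funext => ?; rewrite addrC.
  by apply: is_derive_translate; rewrite addrC; exact: C1_is_derive.
(* The remainder is h times an increment of the first derivative over a length |t| <= |h|, hence h t
   times a second derivative of the difference, itself at most L |z|. *)
have [t th E1] := MVT_line x h (dG _ C1u).
have [t' th' E2] := MVT_line x t (dG _ C1p).
rewrite E1 -mulrBr E2 !normrM.
have tt : `|t'| <= `|t| /\ `|t| <= `|h|.
  by split; exact: norm_between.
apply: (@le_trans _ _ (`|h| * (`|h| * (L * `|z|)))).
  apply: ler_wpM2l => //; apply: ler_pM => //; first exact: tt.2.
  by apply: (le_trans (LP _ _)); rewrite subKr.
by rewrite -[h ^+ 2]ger0_norm ?sqr_ge0// normrX le_eqVlt; apply/orP; left; apply/eqP; ring.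
Qed.

(** The majorant is a product: |z|^2 times the kernel in z, and the indicator of a bounded ball in
    x. Integrability of the inner integral is part of the conclusion, because the sum over j is
    exchanged with the outer integral later. *)
Lemma kernel_fubini (d : 'rV[R]_n -> 'rV[R]_n -> R) (j : 'I_n) (L r : R) :
  measurable_fun setT (fun p : 'rV[R]_n * 'rV[R]_n => d p.1 p.2) ->
  0 <= L -> (forall x z, enorm z < delta -> `|d x z| <= L * `|z|) ->
  (forall x z, enorm z < delta -> r < `|x| -> d x z = 0) ->
  leb.-integrable setT (fun x => (\int[leb]_z (d x z * (z ord0 j * kap z)))%:E) /\
  \int[leb]_x (\int[leb]_z (d x z * (z ord0 j * kap z))) =
  \int[leb]_z ((\int[leb]_x d x z) * (z ord0 j * kap z)).
Proof.
move=> md L0 dL dr.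
pose K (z : 'rV[R]_n) := z ord0 j * kap z.
have mK : measurable_fun [set: 'rV[R]_n] K by apply: measurable_funM => //; exact: measurable_coor.
pose f (p : 'rV[R]_n * 'rV[R]_n) : \bar R := (d p.1 p.2 * K p.2)%:E.
have mf : measurable_fun setT f.
  apply/measurable_EFinP; apply: measurable_funM => //.
  exact: (measurableT_comp mK measurable_snd).
have md1 x : measurable_fun [set: 'rV[R]_n] (d x).
  exact: (measurableT_comp md (pair1_measurable x)).
have md2 z : measurable_fun [set: 'rV[R]_n] (d ^~ z).
  exact: (measurableT_comp md (pair2_measurable z)).
have KI x := kernel_integrable n_gt0 s01 delta_gt0 hw j (md1 x) (dL x).
have ih := integrable_sqr_enorm_kernel n_gt0 s01 delta_gt0 hw.
have hf : (\int[leb]_z (enorm z ^+ 2 * kap z)%:E = H%:E)%E.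
  by rewrite /H /Rintegral fineK//; exact: integrable_fin_num.
have hf2 : (\int[leb]_z (L%:E * (enorm z ^+ 2 * kap z)%:E) = (L * H)%:E)%E.
  by rewrite integralZl// hf EFinM.
pose B := [set x : 'rV[R]_n | `|x| <= r].
have ifub : (leb \x leb)%E.-integrable setT f.
  apply/integrable12ltyP => //.
  apply: (@le_lt_trans _ _ (\int[leb]_x ((L * H)%:E * (\1_B x)%:E))%E).
    apply: ge0_le_integral => //.
    - by move=> x _; exact: integral_ge0.
    - apply: (measurable_fun_fubini_tonelli_F (fun p => `|f p|)%E) => //; exact: measurableT_comp.
    - apply: emeasurable_funM => //; apply/measurable_EFinP; apply: measurable_indic.
      exact: measurable_ball0.
    move=> x _; rewrite indicE; have [xr|xr] := leP `|x| r.
      rewrite mem_set// mule1 -hf2.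
      apply: ge0_le_integral => //.
      + by apply: measurableT_comp => //; have /integrableP[] := (KI x).1.
      + by apply: measurable_funeM; have /integrableP[] := ih.
      by move=> z _; rewrite -EFinM lee_fin; exact: (KI x).2.
    rewrite memNset; last by rewrite /B /= leNgt xr.
    rewrite mule0 integral0_eq// => z _; rewrite /f /K /=.
    have [dz|zd] := leP delta (enorm z); first by rewrite kap_out// !mulr0 normr0.
    by rewrite dr// mul0r normr0.
  rewrite ge0_integralZl//; last 2 first.
  - by apply/measurable_EFinP; apply: measurable_indic; exact: measurable_ball0.
  - by rewrite lee_fin mulr_ge0.
  rewrite integral_indic//; last exact: measurable_ball0.
  rewrite setIT; apply: lte_mul_pinfty => //; first by rewrite lee_fin mulr_ge0.
  exact: lebesgue_ball0_lty.
have dI z : enorm z < delta -> leb.-integrable setT (fun x => (d x z)%:E).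
  move=> zd; apply: (@bounded_support_integrable _ _ (d ^~ z) (L * `|z|) r) => // x; [exact: dL|exact: dr].
have eF x : (\int[leb]_z (d x z * (z ord0 j * kap z)))%:E = (\int[leb]_z f (x, z))%E.
  by rewrite /Rintegral fineK//; exact: (integrable_fin_num measurableT (KI x).1).
split.
  have := @integrable_fubini_F _ _ _ _ _ leb leb f ifub.
  by congr (integrable _ _ _); apply/funext => x; rewrite eF.
rewrite /Rintegral; congr fine.
under eq_integral do rewrite -/(Rintegral _ _ _) eF.
rewrite (Fubini ifub); apply: eq_integral => z _; rewrite /f /=.
(* For |z| >= delta nothing bounds d(., z), but the kernel is 0 and both sides vanish. *)
have [dz|zd] := leP delta (enorm z).
  by rewrite /K kap_out// !mulr0; apply: integral0_eq => x _; rewrite mulr0.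
under eq_integral do rewrite EFinM.
rewrite integralZr//; last exact: dI.
by rewrite [RHS]EFinM fineK//; exact: (integrable_fin_num measurableT (dI z zd)).
Qed.

(** For fixed z, a translation gives int psi(x) (phi(x) - phi(x - z)) dx = int phi(x) (psi(x) -
    psi(x + z)) dx. Fubini before and after carries this through the kernel integral, and z ->
    psi(x) - psi(x + z) is divergence-free and zero at z = 0. *)
Lemma integral_divfree_nldiff (psi : 'I_n -> 'rV[R]_n -> R) (phi : 'rV[R]_n -> R) (D : set 'rV[R]_n) :
  (forall j, Ck 1 (psi j)) -> (forall x, \sum_j partial j (psi j) x = 0) -> Cc_infty D phi ->
  \sum_j \int[leb]_x (psi j x * nldiff j phi x) = 0.
Proof.
move=> Cpsi dpsi Cphi.
have [/(_ 1%N) C1phi _ _] := Cphi; have cphi := C1_continuous C1phi.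
have [r r0 phir] := Cc_supp_bounded Cphi.
have [L L0 LP] := Cc_lipschitz Cphi.
have [P P0 PP] := Cc_bounded Cphi.
have mphi := continuous_measurable_rV cphi.
have mpsi j := continuous_measurable_rV (C1_continuous (Cpsi j)).
have msub : measurable_fun setT (fun p : 'rV[R]_n * 'rV[R]_n => p.1 - p.2).
  exact: (measurableT_comp (@measurable_rV_add R n) (measurable_fun_pair measurable_fst
    (measurableT_comp (@measurable_rV_opp R n) measurable_snd))).
pose d1 j x z := psi j x * (phi x - phi (x - z)).
pose d2 j x z := phi x * (psi j x - psi j (x + z)).
have E1 j : \int[leb]_x (psi j x * nldiff j phi x) =
    \int[leb]_z ((\int[leb]_x d1 j x z) * (z ord0 j * kap z)).
  (* Beyond this radius both phi(x) and phi(x - z) vanish for |z| < delta, so psi has to be bounded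
     on this ball only. *)
  pose r1 := r + delta.
  have [M M0 MP] := continuous_bounded_ball r1 (C1_continuous (Cpsi j)).
  have d1r x z : enorm z < delta -> r1 < `|x| -> d1 j x z = 0.
    move=> zd rx; rewrite /d1 !phir ?subrr ?mulr0//.
      have := ler_normD (x - z) z; rewrite subrK => h.
      exact: lt_of_ltD_leD rx h (le_trans (norm_le_enorm z) (ltW zd)).
    by apply: le_lt_trans rx; rewrite lerDl ltW.
  have [||||_ <-] := @kernel_fubini (d1 j) j (M * L) r1.
  - apply: measurable_funM; first exact: (measurableT_comp (mpsi j) measurable_fst).
    apply: measurable_funB; first exact: (measurableT_comp mphi measurable_fst).
    exact: (measurableT_comp mphi msub).
  - by rewrite mulr_ge0.
  - move=> x z zd; have [rx|xr] := ltP r1 `|x|.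
      by rewrite d1r// normr0 mulr_ge0// mulr_ge0.
    rewrite /d1 normrM -mulrA; apply: ler_pM => //; first exact: MP.
    by apply: (le_trans (LP _ _)); rewrite subKr.
  - exact: d1r.
  apply: eq_Rintegral => x _; rewrite /nldiff -RintegralZl//; last exact: nldiff_integrable.
  by apply: eq_Rintegral => z _; rewrite /d1 mulrA.
have E2 j z : \int[leb]_x d1 j x z = \int[leb]_x d2 j x z.
  have ci1 : leb.-integrable setT (EFin \o (fun x => psi j x * phi x)).
    apply: (@continuous_support_integrable _ _ _ r) => [x|x rx]; last by rewrite phir// mulr0.
    exact: (cvgM (C1_continuous (Cpsi j) (x:=x)) (cphi x)).
  have cphiz : continuous (fun x : 'rV[R]_n => phi (x - z)).
    have -> : (fun x : 'rV[R]_n => phi (x - z)) = (fun x => phi (- z + x)).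
      by apply/funext => x; rewrite addrC.
    exact: C1_continuous (C1_translate (- z) C1phi).1.
  have cpsiz : continuous (fun x : 'rV[R]_n => psi j (z + x)).
    exact: C1_continuous (C1_translate z (Cpsi j)).1.
  have ci2 : leb.-integrable setT (EFin \o (fun x => psi j x * phi (x - z))).
    apply: (@continuous_support_integrable _ _ _ (r + `|z|)) => [x|x rx].
      exact: (cvgM (C1_continuous (Cpsi j) (x:=x)) (cphiz x)).
    by rewrite phir ?mulr0//; have := ler_normD (x - z) z; rewrite subrK => h; exact: lt_of_ltD_leD rx h (lexx _).
  have ci3 : leb.-integrable setT (EFin \o (fun x => phi x * psi j (z + x))).
    apply: (@continuous_support_integrable _ _ _ r) => [x|x rx]; last by rewrite phir// mul0r.
    exact: (cvgM (cphi x) (cpsiz x)).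
  have ci4 : leb.-integrable setT (EFin \o (fun x => phi x * psi j x)).
    by under eq_fun do rewrite mulrC.
  (* The difference is split so that only the term with phi(x - z) is translated; each product is
     integrable since phi has bounded support. *)
  transitivity (\int[leb]_x (psi j x * phi x) - \int[leb]_x (psi j x * phi (x - z))).
    by rewrite -RintegralB//; apply: eq_Rintegral => x _; rewrite /d1 mulrBr.
  transitivity (\int[leb]_x (phi x * psi j x) - \int[leb]_x (phi x * psi j (z + x))); last first.
    by rewrite -RintegralB//; apply: eq_Rintegral => x _; rewrite /d2 mulrBr [x + z]addrC.
  congr (_ - _); first by apply: eq_Rintegral => x _; rewrite mulrC.
  rewrite /Rintegral -(integral_rV_translate z); last by have /integrableP[] := ci2.
  by congr fine; apply: eq_integral => x _; rewrite mulrC addrC addKr.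
(* Up to sign, since the kernel is even, the j-th term of the nonlocal divergence of psi without its
   constant; only the sum over j vanishes. *)
pose S j x := \int[leb]_z ((psi j x - psi j (x + z)) * (z ord0 j * kap z)).
have E3 j : leb.-integrable setT (EFin \o (fun x => phi x * S j x)) /\
   \int[leb]_z ((\int[leb]_x d2 j x z) * (z ord0 j * kap z)) = \int[leb]_x (phi x * S j x).
  have [M M0 MP] := C1_lipschitz_ball (r + delta) (Cpsi j).
  have LM x z : `|x| <= r -> enorm z < delta -> `|psi j x - psi j (x + z)| <= M * `|z|.
    move=> xr zd; have zd' := le_trans (norm_le_enorm z) (ltW zd).
    have -> : `|z| = `|x - (x + z)| by rewrite opprD addNKr normrN.
    apply: MP; first by apply: (le_trans xr); rewrite lerDl ltW.
    by apply: (le_trans (ler_normD _ _)); exact: lerD.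
  have ES x : \int[leb]_z (d2 j x z * (z ord0 j * kap z)) = phi x * S j x.
    have [rx|xr] := ltP r `|x|.
      rewrite phir// mul0r -[RHS](Rintegral_cst0 leb setT).
      by apply: eq_Rintegral => z _; rewrite /d2 phir// !mul0r.
    rewrite /S -RintegralZl//; first by apply: eq_Rintegral => z _; rewrite /d2 -mulrA.
    apply: (kernel_integrable n_gt0 s01 delta_gt0 hw (L := M) _ _ _).1 => [|z zd]; last exact: LM.
    apply: measurable_funB => //; exact: (measurableT_comp (mpsi j) (measurable_rV_addl x)).
  have [||||I2 <-] := @kernel_fubini (d2 j) j (P * M) r.
  - apply: measurable_funM; first exact: (measurableT_comp mphi measurable_fst).
    apply: measurable_funB; first exact: (measurableT_comp (mpsi j) measurable_fst).
    exact: (measurableT_comp (mpsi j) (@measurable_rV_add R n)).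
  - by rewrite mulr_ge0.
  - move=> x z zd; have [rx|xr] := ltP r `|x|.
      by rewrite /d2 phir// mul0r normr0 mulr_ge0// mulr_ge0.
    by rewrite /d2 normrM -mulrA; apply: ler_pM => //; exact: LM.
  - by move=> x z _ rx; rewrite /d2 phir// mul0r.
  split; last by apply: eq_Rintegral => x _.
  by move: I2; congr (integrable _ _ _); apply/funext => x /=; rewrite ES.
have bJ x j : leb.-integrable setT (fun z => ((psi j x - psi j (x + z)) * (z ord0 j * kap z))%:E).
  have [M M0 MP] := C1_lipschitz_ball (`|x| + delta) (Cpsi j).
  apply: (kernel_integrable n_gt0 s01 delta_gt0 hw (L := M) _ _ _).1 => [|z zd].
    by apply: measurable_funB => //; exact: (measurableT_comp (mpsi j) (measurable_rV_addl x)).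
  have -> : `|z| = `|x - (x + z)| by rewrite opprD addNKr normrN.
  apply: MP; first by rewrite lerDl ltW.
  by apply: (le_trans (ler_normD _ _)); rewrite lerD2l (le_trans (norm_le_enorm z))// ltW.
have I0 x : \sum_j S j x = 0.
  rewrite /S.
  rewrite -Rintegral_sum//; last by move=> j; exact: bJ.
  have CT j := C1_translate x (Cpsi j).
  have CN j := C1N (CT j).1.
  have CD j := C1D (C1_cst (psi j x)).1 (CN j).1.
  apply: (integral_divfree_kernel n_gt0 s01 delta_gt0 hw (v := fun j z => psi j x - psi j (x + z))).
  - by move=> j; exact: (CD j).1.
  - move=> z; have := congr1 -%R (dpsi (x + z)); rewrite oppr0 -sumrN; apply: etrans; apply: eq_bigr => j _.
    by rewrite (CD j).2 (C1_cst _).2 (CN j).2 (CT j).2 /= add0r.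
  - by move=> j; rewrite addr0 subrr.
have E4 j : \int[leb]_x (psi j x * nldiff j phi x) = \int[leb]_x (phi x * S j x).
  by rewrite E1 -(E3 j).2; apply: eq_Rintegral => z _; rewrite E2.
rewrite (eq_bigr _ (fun j _ => E4 j)) -Rintegral_sum//; last by move=> j; exact: (E3 j).1.
under eq_Rintegral do rewrite -mulr_sumr I0 mulr0.
exact: Rintegral_cst0.
Qed.

End nonlocal_operators.

(** * Growth of cofactors *)

Section power_inequalities.
Context {R : realType}.

(** Comparing all terms with the largest one gives a crude constant without any convexity; an empty
    index set has no largest term and is set apart. *)
Lemma powR_sum_le (I : finType) (e : I -> R) (p : R) : 0 < p -> (forall i, 0 <= e i) ->
  (\sum_i e i) `^ p <= #|I|%:R `^ p * \sum_i e i `^ p.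
Proof.
move=> p0 e0; have [i0 _|I0] := pickP (@predT I); last first.
  by rewrite !big1 ?mulr0 ?powR0 ?gt_eqF// => i _; have := I0 i.
have [im _ imP] : exists2 im : I, true & forall i, e i <= e im.
  by case: (arg_maxP e (isT : predT i0)) => im _ imP; exists im => // i; exact: imP.
have S0 : 0 <= \sum_i e i by apply: sumr_ge0.
apply: (@le_trans _ _ ((#|I|%:R * e im) `^ p)).
  apply: ge0_ler_powR; rewrite ?nnegrE ?mulr_ge0//; first exact: ltW.
  rewrite mulr_natl; apply: (le_trans (ler_sum _ (fun i _ => imP i))).
  by rewrite sumr_const.
rewrite powRM//; apply: ler_wpM2l; first exact: powR_ge0.
by rewrite (bigD1 im)//= lerDl; apply: sumr_ge0 => i _; exact: powR_ge0.
Qed.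

Lemma powR_add_le (a b p : R) : 0 < p -> 0 <= a -> 0 <= b ->
  (a + b) `^ p <= 2 `^ p * (a `^ p + b `^ p).
Proof.
move=> p0 a0 b0; have := @powR_sum_le bool (fun i => if i then a else b) p p0.
by rewrite !big_bool /= card_bool; apply => -[].
Qed.

Lemma powR_add1_le (a b p : R) : 0 < p -> 0 <= a -> 0 <= b ->
  (1 + a + b) `^ p <= 4 `^ p * (1 + a `^ p + b `^ p).
Proof.
move=> p0 a0 b0.
have h1 := powR_add_le p0 (addr_ge0 ler01 a0) b0.
have h2 := powR_add_le p0 ler01 a0; rewrite powR1 in h2.
have c1 : 1 <= (2 : R) `^ p by rewrite -[leLHS](powRr0 (2 : R)) ler_powR ?ler1n//; exact: ltW.
have -> : (4 : R) = 2 * 2 by ring.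
rewrite powRM//; apply: (le_trans h1); rewrite -mulrA; apply: ler_wpM2l; first exact: powR_ge0.
rewrite mulrDr; apply: lerD => //.
by rewrite ler_peMl// powR_ge0.
Qed.

(* Either D <= eps M or M < D / eps. *)
Lemma mul_powR_absorb (D M eps p : R) : 0 < eps -> 1 <= p -> 1 <= M -> 0 <= D ->
  D * M `^ (p - 1) <= eps * M `^ p + eps `^ (1 - p) * D `^ p.
Proof.
move=> e0 p1 M1 D0; have M0 : 0 < M by apply: lt_le_trans M1.
have p0 : 0 < p by apply: lt_le_trans p1.
have [DM|MD] := leP D (eps * M).
  apply: (@le_trans _ _ (eps * M `^ p)); last by rewrite lerDl mulr_ge0 ?powR_ge0.
  by rewrite -(mulr_powRB1 (ltW M0) p0) mulrA ler_wpM2r ?powR_ge0.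
apply: (@le_trans _ _ (eps `^ (1 - p) * D `^ p)); last first.
  by rewrite lerDr; apply: mulr_ge0; [exact: ltW|exact: powR_ge0].
rewrite -(mulr_powRB1 D0 p0) mulrCA; apply: ler_wpM2l => //.
have -> : eps `^ (1 - p) * D `^ (p - 1) = (eps^-1 * D) `^ (p - 1).
  have i0 : 0 <= eps^-1 by rewrite invr_ge0; exact: ltW.
  rewrite (powRM _ i0 D0); congr (_ * _); rewrite -(powR_inv1 (ltW e0)) -powRrM.
  by congr (_ `^ _); ring.
have ie0 : 0 <= eps^-1 by rewrite invr_ge0; exact: ltW.
apply: ge0_ler_powR; rewrite ?nnegrE ?subr_ge0 ?mulr_ge0//; first exact: ltW.
by rewrite ler_pdivlMl// ltW.
Qed.

(** The factors are exchanged one at a time. The first bound is carried along because the induction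
    step for the second needs it. *)
Lemma prod_difference_le (I : Type) (r : seq I) (a b : I -> R) (D M : R) : 0 <= D -> 0 <= M ->
  (forall k, `|a k| <= M) -> (forall k, `|b k| <= M) -> (forall k, `|a k - b k| <= D) ->
  `|\prod_(k <- r) a k| <= M ^+ size r /\
  `|\prod_(k <- r) a k - \prod_(k <- r) b k| <= (size r)%:R * D * M ^+ (size r).-1.
Proof.
move=> D0 M0 aM bM abD; elim: r => [|k r [IH1 IH2]].
  by rewrite !big_nil normr1 expr0 subrr normr0 !mul0r.
rewrite !big_cons; split.
  by rewrite normrM exprS; exact: ler_pM.
have -> : a k * \prod_(j <- r) a j - b k * \prod_(j <- r) b j =
  (a k - b k) * \prod_(j <- r) a j + b k * (\prod_(j <- r) a j - \prod_(j <- r) b j) by ring.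
apply: (le_trans (ler_normD _ _)).
apply: (@le_trans _ _ (D * M ^+ size r + M * ((size r)%:R * D * M ^+ (size r).-1))).
  by rewrite !normrM; apply: lerD; apply: ler_pM.
rewrite /= -natr1 le_eqVlt; apply/orP; left; apply/eqP.
(* For an empty tail the truncated exponent is harmless: it is multiplied by [0%:R]. *)
case: (size r) => [|m] /=; first by ring.
by rewrite exprS; ring.
Qed.

End power_inequalities.

Section cofactor_growth.
Context {R : realType} {n : nat}.

(** The l^1 norm bounds each entry with constant 1 and splits along the rows, which is how it is
    compared with the Euclidean norms of the row gradients. *)
Definition entry_norm (A : 'M[R]_n) : R := \sum_i \sum_j `|A i j|.

Lemma entry_norm_ge0 A : 0 <= entry_norm A.
Proof. by apply: sumr_ge0 => i _; apply: sumr_ge0. Qed.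

Lemma entry_le_norm (A : 'M[R]_n) i j : `|A i j| <= entry_norm A.
Proof.
rewrite /entry_norm (bigD1 i)//= (bigD1 j)//= -addrA lerDl addr_ge0//; first exact: sumr_ge0.
by apply: sumr_ge0 => k _; apply: sumr_ge0.
Qed.

Lemma entry_normD A B : entry_norm (A + B) <= entry_norm A + entry_norm B.
Proof.
rewrite /entry_norm -big_split/=; apply: ler_sum => i _; rewrite -big_split/=; apply: ler_sum => j _.
by rewrite mxE ler_normD.
Qed.

(** A minor has (n-1)! terms, and a term has n-1 factors to exchange. *)
Definition cofactor_const : R := #|{perm 'I_n.-1}|%:R * n.-1%:R.

Lemma cofactor_const_ge0 : 0 <= cofactor_const.
Proof. by rewrite mulr_ge0. Qed.

(** Exchanging the n-1 entries of a term costs (n-1) D M^(n-2). The 1 in M makes M >= 1, so the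
    exponent may be raised to p-1; this is where p >= n-1 enters. *)
Lemma cofactor_difference_le (A B : 'M[R]_n) i j (p : R) : 1 <= p -> n%:R - 1 <= p ->
  `|cofactor A i j - cofactor B i j| <= cofactor_const *
     (entry_norm (A - B) * (1 + entry_norm B + entry_norm (A - B)) `^ (p - 1)).
Proof.
move=> p1 np; set D := entry_norm (A - B); set M := 1 + _ + _.
have D0 : 0 <= D := entry_norm_ge0 _.
have M1 : 1 <= M by rewrite /M -addrA lerDl addr_ge0// entry_norm_ge0.
have M0 : 0 <= M by apply: le_trans M1.
rewrite /cofactor -mulrBr normrM normrX normrN1 expr1n mul1r /determinant -sumrB.
apply: (le_trans (ler_norm_sum _ _ _)).
apply: (@le_trans _ _ (\sum_(sg : {perm 'I_n.-1}) n.-1%:R * D * M `^ (p - 1))); last first.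
  by rewrite sumr_const /cofactor_const -[X in X <= _]mulr_natl !mulrA.
apply: ler_sum => sg _; rewrite -mulrBr normrM normrX normrN1 expr1n mul1r.
have AM k l : `|A k l| <= M.
  have -> : A k l = B k l + (A - B) k l by rewrite !mxE addrCA subrr addr0.
  apply: (le_trans (ler_normD _ _)); rewrite /M -addrA; apply: ler_wpDl => //.
  by apply: lerD; exact: entry_le_norm.
have BM k l : `|B k l| <= M.
  apply: (le_trans (entry_le_norm B k l)); rewrite /M addrAC; apply: ler_wpDl => //.
  by rewrite addr_ge0.
have ABD k l : `|A k l - B k l| <= D.
  by have := entry_le_norm (A - B) k l; rewrite !mxE.
have := (@prod_difference_le R _ (index_enum 'I_n.-1)
  (fun k => (row' i (col' j A)) k (sg k)) (fun k => (row' i (col' j B)) k (sg k)) D M D0 M0 _ _ _).2.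
have -> : size (index_enum 'I_n.-1) = n.-1 by rewrite -[index_enum _]enumT size_enum_ord.
move=> h; apply: (le_trans (h _ _ _)) => [k|k|k|]; rewrite ?mxE//.
apply: ler_wpM2l; first by rewrite mulr_ge0.
rewrite -powR_mulrn//; apply: ler_powR => //.
(* For n <= 1 the truncated exponent is 0 and p >= 1 is used; otherwise it is n - 2 and p >= n - 1
   is used. *)
case: (n) np => [|[|m]] /= np; rewrite ?subr_ge0//.
by move: np; rewrite -!natr1; lra.
Qed.

End cofactor_growth.

(** * Cofactors under L^p approximation *)

Section cofactor_limit.
Context {R : realType} {n : nat} (p : R) (Omega : set 'rV[R]_n).
Hypotheses (n0 : (0 < n)%N) (p1 : 1 <= p) (np : n%:R - 1 <= p) (mO : measurable Omega)
  (fO : (lebesgue_rV Omega < +oo)%E).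
Local Notation leb := (lebesgue_rV (n := n)).
Local Notation cc := (@cofactor_const R n).
Local Notation nrm := (@entry_norm R n).

Let p0 : 0 < p. Proof. exact: lt_le_trans p1. Qed.

Lemma measurable_entry_norm_powR (V : 'rV[R]_n -> 'M[R]_n) :
  (forall k l, measurable_fun Omega (fun x => V x k l)) ->
  measurable_fun Omega (fun x => nrm (V x) `^ p).
Proof.
move=> mV; apply: (@measurableT_comp _ _ _ _ _ _ (fun x : R => x `^ p)); first exact: measurable_powR.
by apply: measurable_sum => k; apply: measurable_sum => l; apply: measurableT_comp.
Qed.

Lemma measurable_cofactor (V : 'rV[R]_n -> 'M[R]_n) i j :
  (forall k l, measurable_fun Omega (fun x => V x k l)) ->
  measurable_fun Omega (fun x => cofactor (V x) i j).
Proof.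
move=> mV; apply: measurable_funM => //; apply: measurable_sum => sg.
apply: measurable_funM => //; apply: measurable_prod => k _.
rewrite (_ : (fun x => _) = fun x => V x (lift i k) (lift j (sg k)))//.
by apply/funext => x; rewrite !mxE.
Qed.

Lemma integrable_one : leb.-integrable Omega (fun=> 1%:E).
Proof.
apply: (@measurable_bounded_integrable _ _ _ leb (fun=> 1) Omega) => //.
by exists 1; split; [exact: num_real|move=> K K1 x _; rewrite normr1 ltW].
Qed.

Lemma integrable_cofactor (V : 'rV[R]_n -> 'M[R]_n) (g : 'rV[R]_n -> R) (G : R) i j :
  (forall k l, measurable_fun Omega (fun x => V x k l)) ->
  leb.-integrable Omega (fun x => (nrm (V x) `^ p)%:E) ->
  measurable_fun Omega g -> (forall x, `|g x| <= G) ->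
  leb.-integrable Omega (fun x => (cofactor (V x) i j * g x)%:E).
Proof.
move=> mV iV mg gG.
have i1 := integrable_one.
pose c := `|cofactor (0 : 'M[R]_n) i j|.
pose C := cc * 4 `^ p.
have C0 : 0 <= C by rewrite mulr_ge0 ?powR_ge0// cofactor_const_ge0.
have G0 : 0 <= G by apply: le_trans (gG 0).
have bd x : `|cofactor (V x) i j| <= (c + C) + C * nrm (V x) `^ p.
  have -> : cofactor (V x) i j = cofactor 0 i j + (cofactor (V x) i j - cofactor 0 i j).
    by rewrite addrC subrK.
  apply: (le_trans (ler_normD _ _)); rewrite -addrA; apply: lerD => //.
  apply: (le_trans (cofactor_difference_le (V x) 0 i j p1 np)); rewrite subr0.
  have -> : nrm 0 = 0 by rewrite /entry_norm big1// => k _; rewrite big1// => l _; rewrite mxE normr0.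
  rewrite addr0 /C -[X in _ <= X + _]mulr1 -mulrA -mulrA -!mulrDr; apply: ler_wpM2l; first exact: cofactor_const_ge0.
  have V0 := entry_norm_ge0 (V x).
  have := powR_add1_le p0 V0 (lexx 0); rewrite addr0 powR0 ?gt_eqF// addr0 mulrDr => h.
  apply: le_trans h; rewrite -(mulr_powRB1 (addr_ge0 ler01 V0) p0); apply: ler_wpM2r; first exact: powR_ge0.
  by rewrite lerDr.
apply: (@le_integrable _ _ _ leb Omega mO _ (fun x => ((c + C) * G)%:E * 1%:E + (C * G)%:E * (nrm (V x) `^ p)%:E)%E).
- by apply/measurable_EFinP; apply: measurable_funM => //; exact: measurable_cofactor.
- move=> x _; rewrite -!EFinM -EFinD lee_fin mulr1; apply: le_trans (ler_norm _).
  rewrite normrM; apply: (@le_trans _ _ (((c + C) + C * nrm (V x) `^ p) * G)).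
    by apply: ler_pM.
  by rewrite mulrDl [C * _ * _]mulrAC.
- by apply: integrableD => //; apply: integrableZl.
Qed.

(** The vanishing integral passes from bounded approximants to their L^p limit: the error is at most
    eps times a quantity depending on U, plus a multiple, depending on eps, of the integral of |A -
    U|^p. *)
Lemma cofactor_limit (U : 'rV[R]_n -> 'M[R]_n) (g : 'I_n -> 'rV[R]_n -> R) (G : R) i :
  (forall k l, measurable_fun Omega (fun x => U x k l)) ->
  (forall j, measurable_fun Omega (g j)) -> (forall j x, `|g j x| <= G) ->
  (forall eta : R, 0 < eta -> exists A : 'rV[R]_n -> 'M[R]_n,
    [/\ forall k l, measurable_fun Omega (fun x => A x k l),
        exists M : R, forall x k l, Omega x -> `|A x k l| <= M,
        \int[leb]_(x in Omega) (\sum_j cofactor (A x) i j * g j x) = 0 &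
        (\int[leb]_(x in Omega) (nrm (A x - U x) `^ p)%:E <= eta%:E)%E]) ->
  (\int[leb]_(x in Omega) (\sum_j cofactor (U x) i j * g j x)%:E = 0)%E.
Proof.
move=> mU mg gG approx.
have mB (A : 'rV[R]_n -> 'M[R]_n) k l : (forall k l, measurable_fun Omega (fun x => A x k l)) ->
    measurable_fun Omega (fun x => (A x - U x) k l).
  by move=> mA; under eq_fun do rewrite !mxE; exact: measurable_funB.
have i1 := integrable_one.
have iA (A : 'rV[R]_n -> 'M[R]_n) : (forall k l, measurable_fun Omega (fun x => A x k l)) ->
    (exists M : R, forall x k l, Omega x -> `|A x k l| <= M) ->
    leb.-integrable Omega (fun x => (nrm (A x) `^ p)%:E).
  move=> mA [M MP]; apply: measurable_bounded_integrable => //.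
    exact: measurable_entry_norm_powR.
  exists ((\sum_(k < n) \sum_(l < n) M) `^ p); split; first exact: num_real.
  move=> K MK x Ox; apply: le_trans (ltW MK); rewrite ger0_norm ?powR_ge0//.
  have h : nrm (A x) <= \sum_(k < n) \sum_(l < n) M.
    by apply: ler_sum => k _; apply: ler_sum => l _; exact: MP.
  apply: ge0_ler_powR; rewrite ?nnegrE ?entry_norm_ge0//; first exact: ltW.
  exact: le_trans (entry_norm_ge0 _) h.
have iD (A : 'rV[R]_n -> 'M[R]_n) eta : (forall k l, measurable_fun Omega (fun x => A x k l)) ->
    (\int[leb]_(x in Omega) (nrm (A x - U x) `^ p)%:E <= (eta : R)%:E)%E ->
    leb.-integrable Omega (fun x => (nrm (A x - U x) `^ p)%:E).
  move=> mA h; apply/integrableP; split.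
    by apply/measurable_EFinP; apply: measurable_entry_norm_powR => k l; exact: mB.
  under eq_integral do rewrite gee0_abs ?lee_fin ?powR_ge0//.
  exact: le_lt_trans h (ltry _).
(* Integrability of |U|^p is not assumed: it follows from one bounded approximant at distance 1. *)
have iU : leb.-integrable Omega (fun x => (nrm (U x) `^ p)%:E).
  have [A [mA bA _ dA]] := approx 1 ltr01.
  apply: (@le_integrable _ _ _ leb Omega mO _ (fun x => (2 `^ p)%:E * ((nrm (A x) `^ p)%:E + (nrm (A x - U x) `^ p)%:E))%E).
  - by apply/measurable_EFinP; exact: measurable_entry_norm_powR.
  - move=> x _; rewrite -EFinD -EFinM lee_fin; apply: le_trans (ler_norm _).
    rewrite ger0_norm ?powR_ge0//.
    apply: le_trans (powR_add_le p0 (entry_norm_ge0 _) (entry_norm_ge0 _)).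
    apply: ge0_ler_powR; rewrite ?nnegrE ?addr_ge0 ?entry_norm_ge0//; first exact: ltW.
    have -> : entry_norm (A x - U x) = entry_norm (U x - A x).
      by apply: eq_bigr => k _; apply: eq_bigr => l _; rewrite -normrN !mxE opprB.
    by apply: le_trans (entry_normD _ _); rewrite addrC subrK.
  - by apply: integrableZl => //; apply: integrableD => //; [exact: iA|exact: iD dA].
have ic (V : 'rV[R]_n -> 'M[R]_n) : (forall k l, measurable_fun Omega (fun x => V x k l)) ->
    leb.-integrable Omega (fun x => (nrm (V x) `^ p)%:E) ->
    leb.-integrable Omega (fun x => (\sum_j cofactor (V x) i j * g j x)%:E).
  move=> mV iV; under eq_fun do rewrite -sumEFin.
  by apply: integrable_sum => // j _; exact: (integrable_cofactor i j mV iV (mg j) (gG j)).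
have icU := ic U mU iU.
suff : \int[leb]_(x in Omega) (\sum_j cofactor (U x) i j * g j x) = 0.
  by rewrite /Rintegral => h; rewrite -[LHS]fineK ?h//; exact: integrable_fin_num.
apply/eqP; rewrite -normr_le0; apply/ler_addgt0Pr => e e0; rewrite add0r.
have G0 : 0 <= G by apply: le_trans (gG (Ordinal n0) 0).
pose K := n%:R * G * cc.
have K0 : 0 <= K by rewrite !mulr_ge0 ?cofactor_const_ge0.
pose I := \int[leb]_(x in Omega) (1 + nrm (U x) `^ p).
have I0 : 0 <= I by apply: Rintegral_ge0 => x _; rewrite addr_ge0 ?powR_ge0.
pose c4 := (4 : R) `^ p.
have c40 : 0 <= c4 by exact: powR_ge0.
(* First eps is fitted to the fixed integral [I], then eta to eps, each for an error e / 2. The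
   summands 1 in [q1] and [q2] only keep the denominators positive. *)
pose q1 := K * c4 * I + 1.
have q10 : 0 < q1 by rewrite ltr_wpDl// !mulr_ge0.
pose eps := e / (2 * q1).
have eps0 : 0 < eps by rewrite divr_gt0// mulr_gt0.
pose q2 := K * (eps * c4 + eps `^ (1 - p)) + 1.
have q20 : 0 < q2 by rewrite ltr_wpDl// mulr_ge0// addr_ge0 ?powR_ge0// mulr_ge0// ltW.
pose eta := e / (2 * q2).
have eta0 : 0 < eta by rewrite divr_gt0// mulr_gt0.
have [A [mA bA zA dA]] := approx eta eta0.
have icA := ic A mA (iA A mA bA).
have idA := iD A eta mA dA.
pose a := \int[leb]_(x in Omega) (nrm (A x - U x) `^ p).
have aeta : a <= eta.
  by rewrite /a /Rintegral -lee_fin fineK//; exact: integrable_fin_num.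
have i1U : leb.-integrable Omega (EFin \o (fun x => 1 + nrm (U x) `^ p)).
  exact: (integrableD mO i1 iU).
have bd x : `|\sum_j cofactor (U x) i j * g j x - \sum_j cofactor (A x) i j * g j x| <=
   K * (eps * c4) * (1 + nrm (U x) `^ p) + K * (eps * c4 + eps `^ (1 - p)) * nrm (A x - U x) `^ p.
  rewrite -sumrB; apply: (le_trans (ler_norm_sum _ _ _)).
  set D := nrm (A x - U x); set u := nrm (U x).
  have D0 : 0 <= D := entry_norm_ge0 _; have u0 : 0 <= u := entry_norm_ge0 _.
  apply: (@le_trans _ _ (\sum_(j < n) G * (cc * (eps * (c4 * (1 + u `^ p + D `^ p)) + eps `^ (1 - p) * D `^ p)))).
    apply: ler_sum => j _; rewrite -mulrBl normrM mulrC; apply: ler_pM => //.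
    rewrite distrC; apply: (le_trans (cofactor_difference_le (A x) (U x) i j p1 np)).
    apply: ler_wpM2l; first exact: cofactor_const_ge0.
    have M1 : 1 <= 1 + u + D by rewrite -addrA lerDl addr_ge0.
    apply: (le_trans (mul_powR_absorb eps0 p1 M1 D0)); rewrite lerD2r.
    by apply: ler_wpM2l; [exact: ltW|exact: powR_add1_le].
  by rewrite sumr_const card_ord -mulr_natl le_eqVlt; apply/orP; left; apply/eqP; rewrite /K; ring.
have ia : leb.-integrable Omega (EFin \o (fun x => K * (eps * c4) * (1 + nrm (U x) `^ p))).
  exact: (integrableZl mO _ i1U).
have ib : leb.-integrable Omega (EFin \o (fun x => K * (eps * c4 + eps `^ (1 - p)) * nrm (A x - U x) `^ p)).
  exact: (integrableZl mO _ idA).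
have iab : leb.-integrable Omega
    (EFin \o (fun x => K * (eps * c4) * (1 + nrm (U x) `^ p) +
      K * (eps * c4 + eps `^ (1 - p)) * nrm (A x - U x) `^ p)).
  exact: (integrableD mO ia ib).
rewrite -[X in `|X|]subr0 -[X in `|_ - X|]zA -RintegralB//.
have iUA := integrableB mO icU icA.
apply: (le_trans (le_normr_Rintegral mO iUA)).
apply: (@le_trans _ _ (\int[leb]_(x in Omega) (K * (eps * c4) * (1 + nrm (U x) `^ p) +
  K * (eps * c4 + eps `^ (1 - p)) * nrm (A x - U x) `^ p))).
  apply: le_Rintegral => //; exact: (integrable_norm iUA).
rewrite RintegralD// RintegralZl// RintegralZl// -/I -/a.
have h1 : K * (eps * c4) * I <= e / 2.
  have -> : K * (eps * c4) * I = eps * (K * c4 * I) by ring.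
  have -> : e / 2 = eps * q1 by rewrite /eps; field; rewrite gt_eqF.
  by apply: ler_wpM2l; [exact: ltW|rewrite /q1 lerDl].
have h2 : K * (eps * c4 + eps `^ (1 - p)) * a <= e / 2.
  have -> : e / 2 = q2 * eta by rewrite /eta; field; rewrite gt_eqF.
  apply: (@le_trans _ _ (K * (eps * c4 + eps `^ (1 - p)) * eta)).
    apply: ler_wpM2l => //; apply: mulr_ge0 => //.
    by apply: addr_ge0; [apply: mulr_ge0 => //; exact: ltW|exact: powR_ge0].
  by apply: ler_wpM2r; [exact: ltW|rewrite /q2 lerDl].
by rewrite [leRHS]splitr; exact: lerD.
Qed.

End cofactor_limit.

(** On the segment from x to x + z, a point of the closure outside Omega would be a boundary point
    at distance less than delta from x. So the parameters that stay in Omega form an open and closed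
    subset of [0, 1] containing 0. *)
Lemma shrink_enorm_subset (R : realType) (n : nat) (Omega : set 'rV[R]_n) (delta : R) x z :
  open Omega -> shrink Omega delta x -> enorm z < delta -> Omega (x + z).
Proof.
move=> oO [Ox dx] zd; pose f (t : R) : 'rV[R]_n := x + t *: z.
have cf : continuous f.
  apply: continuous_rV => i t; under eq_fun do rewrite !mxE.
  exact: (cvgD (cvg_cst _) (cvgM cvg_id (cvg_cst _))).
have no_boundary t : 0 <= t <= 1 -> closure Omega (f t) -> Omega (f t).
  move=> /andP[t0 t1] cl; apply: contrapT => nO.
  have : dist_set x (boundary Omega) <= enorm (x - f t).
    apply: ge_inf; first by exists 0 => _ [y _ <-]; exact: enorm_ge0.
    by exists (f t) => //; split => //; rewrite ((interior_id Omega).1 oO).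
  rewrite /f opprD addNKr enormN enormZ ger0_norm// => h.
  have := lt_le_trans dx h; rewrite ltNge => /negP; apply.
  by rewrite (le_trans (ler_piMl (enorm_ge0 z) t1))// ltW.
have -> : x + z = f 1 by rewrite /f scale1r.
have /(_ [set t | t \in `[0, 1] /\ Omega (f t)]) := @segment_connected R 0 1.
move=> conn; have := conn _ _ _; move=> {}conn.
suff E : [set t | t \in `[0, 1] /\ Omega (f t)] = `[0, 1]%classic.
  have : `[0, 1]%classic (1 : R) by rewrite /= in_itv/= lexx ler01.
  by rewrite -E => -[].
apply: conn.
- by exists 0; split; rewrite /= ?in_itv/= ?lexx ?ler01// /f scale0r addr0.
- exists (f @^-1` Omega); first by move/continuousP : cf; exact.
  by apply/seteqP; split => t.
- exists (f @^-1` closure Omega); first by apply: preimage_closed => //; exact: closed_closure.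
  apply/seteqP; split => t /= [t01 h]; split => //; first exact: subset_closure.
  by apply: no_boundary => //; move: t01; rewrite in_itv.
Qed.

Lemma continuous_mul_support_integrable (R : realType) (n : nat) (f g : 'rV[R]_n -> R) (r : R) :
  continuous f -> continuous g -> (forall x, r < `|x| -> g x = 0) ->
  (lebesgue_rV (n := n)).-integrable setT (EFin \o (fun x => f x * g x)).
Proof.
move=> cf cg gr; apply: (@continuous_support_integrable _ _ _ r) => [x|x rx].
  exact: (cvgM (cf x) (cg x)).
by rewrite gr// mulr0.
Qed.

Lemma finite_uniform_bound (R : realType) (I : finType) (T : Type) (f : I -> T -> R) :
  (forall i, exists M : R, forall x, `|f i x| <= M) -> exists M : R, forall i x, `|f i x| <= M.
Proof.
move=> /choice[M MP]; exists (\sum_i `|M i|) => i x.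
apply: (le_trans (MP i x)); apply: (le_trans (ler_norm _)).
by rewrite (bigD1 i)//= lerDl; apply: sumr_ge0.
Qed.

(** * Nonlocal gradients as curl-free fields, and their limits *)

Section nonlocal_piola.
Context {R : realType} {n : nat} (s delta : R) (w : 'rV[R]_n -> R).
Hypotheses (n_gt0 : (0 < n)%N) (s01 : 0 < s < 1) (delta_gt0 : 0 < delta)
  (hw : cutoff delta w).
Local Notation leb := (lebesgue_rV (n := n)).
Local Notation dlt := (nlgrad s delta w).

Lemma C1_nlgrad D u j : Cc_infty D u -> Ck 1 (fun x => dlt u x ord0 j) /\
  forall i, partial i (fun x => dlt u x ord0 j) = fun x => @c_ns R n s * nldiff s w j (partial i u) x.
Proof.
move=> Cu; have [/(_ 1%N)/C1_continuous cu _ _] := Cu.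
have -> : (fun x => dlt u x ord0 j) = fun x => @c_ns R n s * nldiff s w j u x.
  by apply/funext => x; exact: nlgradE.
have [Cd Pd] := nldiff_C1 n_gt0 s01 delta_gt0 hw j Cu.
have [Cc Pc] := C1M (@C1_cst R n (@c_ns R n s)).1 Cd.
split => // i; apply: (etrans (Pc i)); apply/funext => x.
by rewrite (C1_cst _).2 Pd /= mulr0 addr0.
Qed.

Lemma nlgrad_curlfree D u i j : Cc_infty D u ->
  partial i (fun x => dlt u x ord0 j) = partial j (fun x => dlt u x ord0 i).
Proof.
move=> Cu; have [/(_ 2%N) C2 _ _] := Cu.
apply: (etrans ((C1_nlgrad j Cu).2 i)); apply: etrans (esym ((C1_nlgrad i Cu).2 j)).
by apply/funext => x; congr (_ * _); exact: (nldiff_partialC n_gt0 s01 delta_gt0 hw).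
Qed.

Lemma nlgrad_bounded D u j : Cc_infty D u -> exists M : R, forall x, `|dlt u x ord0 j| <= M.
Proof.
move=> Cu; have [/(_ 1%N)/C1_continuous cu _ _] := Cu.
have [M MP] := nldiff_bounded n_gt0 s01 delta_gt0 hw j Cu.
exists (`|@c_ns R n s| * M) => x.
by rewrite (nlgradE n_gt0 s01 hw x j cu) normrM ler_wpM2l.
Qed.

(** If phi were non-zero at x - z with |z| < delta, then x - z would lie in Omega_{-delta} and x in
    Omega; phi(x) is 0 as well, so the integrand vanishes. *)
Lemma nldiff_shrink_out (Omega : set 'rV[R]_n) phi j x : open Omega ->
  Cc_infty (shrink Omega delta) phi -> ~ Omega x -> nldiff s w j phi x = 0.
Proof.
move=> oO Cphi nOx; have [_ _ sphi] := Cphi.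
have out y : ~ shrink Omega delta y -> phi y = 0 by move=> h; apply: supp0 => /sphi.
rewrite /nldiff; under eq_Rintegral => z _.
  have -> : (phi x - phi (x - z)) * (z ord0 j * radial_kernel s w z) = 0.
    have [dz|zd] := leP delta (enorm z).
      by rewrite (radial_kernel_out n_gt0 s01 hw dz) !mulr0.
    rewrite (out x); last by move=> [].
    rewrite (out (x - z)) ?subrr ?mul0r// => /(shrink_enorm_subset oO)/(_ zd).
    by rewrite subrK.
  over.
exact: Rintegral_cst0.
Qed.

Lemma cof_curlfree (F : 'rV[R]_n -> 'M[R]_n) :
  (forall k l, Ck 1 (fun x => F x k l)) ->
  (forall k j l, partial j (fun x => F x k l) = partial l (fun x => F x k j)) ->
  [/\ forall i j, Ck 1 (fun x => cof (F x) i j),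
      forall x, divergence_mx (fun y => cof (F y)) x = 0 &
      forall x, nldiv_mx s delta w (fun y => cof (F y)) x = 0].
Proof.
move=> CF curl.
have E i j : (fun x => cof (F x) i j) = fun x => cofactor (F x) i j.
  by apply/funext => x; rewrite mxE.
have Er i j : (fun x => row i (cof (F x)) ord0 j) = fun x => cofactor (F x) i j.
  by apply/funext => x; rewrite !mxE.
have div0 i x : divergence (fun y => row i (cof (F y))) x = 0.
  rewrite /divergence; under eq_bigr do rewrite Er.
  exact: piola.
split=> [i j|x|x].
- by rewrite E; exact: C1_cofactor.
- by apply/colP => i; rewrite mxE div0 mxE.
- apply/colP => i; rewrite mxE [RHS]mxE.
  apply: (nldiv_divfree n_gt0 s01 delta_gt0 hw) => [j|y]; last exact: div0.
  by rewrite Er; exact: C1_cofactor.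
Qed.

Section null_lagrangian.
Variables (p : R) (Omega : set 'rV[R]_n).
Hypotheses (p1 : 1 <= p) (np : n%:R - 1 <= p) (oO : open Omega) (bO : bounded_set Omega).

Let p0 : 0 < p. Proof. exact: lt_le_trans p1. Qed.
Let mO : measurable Omega. Proof. exact: open_measurable_rV. Qed.

(** The norm is a p-th root, hence the threshold [eta ^ p^-1]; after raising to the power p the term
    in u is dropped. *)
Lemma Hspace_approximation u U (eta : R) : Hspace s p delta w Omega u U -> 0 < eta ->
  exists2 v, Cc_infty setT v &
    (\int[leb]_(x in Omega) (enorm (dlt v x - U x) `^ p)%:E <= eta%:E)%E.
Proof.
move=> [_ [u_ [Cu_ cv]]] eta0.
have e0 : (0 < (eta `^ p^-1)%:E)%E by rewrite lte_fin powR_gt0.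
have /filter_ex[k /= /ltW kP] : \forall k \near \oo,
    (Hnorm p delta Omega (u_ k \- u)%R (dlt (u_ k) \- U)%R < (eta `^ p^-1)%:E)%E.
  by apply: (cv [set y | (y < (eta `^ p^-1)%:E)%E]); apply: open_nbhs_nbhs; split => //; exact: open_ereal_lt_ereal.
exists (u_ k) => //; move: kP; rewrite /Hnorm; set X := (_ `^ p)%E; set Y := (_ `^ p)%E => kP.
have EY : (\int[leb]_(x in Omega) (enorm (dlt (u_ k) x - U x) `^ p)%:E = Y)%E.
  rewrite /Y /Lpnorm_rV /Lpnorm poweR_Lnorm ?gt_eqF// [LHS]integral_mkcond.
  apply: eq_integral => x _; rewrite !patchE; case: ifPn => _ /=.
    by rewrite ger0_norm ?enorm_ge0.
  by rewrite normr0 powR0 ?gt_eqF.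
rewrite EY.
have X0 : (0 <= X)%E by exact: poweR_ge0.
have Y0 : (0 <= Y)%E by exact: poweR_ge0.
apply: (@le_trans _ _ (X + Y)%E); first by rewrite leeDr.
have := gt0_ler_poweR (ltW p0) _ _ kP; rewrite !in_itv/=.
rewrite -poweRrM mulVf ?gt_eqF// poweRe1 ?adde_ge0// -powRrM mulVf ?gt_eqF// powRr1; last exact: ltW.
by apply; rewrite ?leey ?andbT ?poweR_ge0// lee_fin powR_ge0.
Qed.

(** The test field is abstract so as to serve for both D^s phi and D phi. The approximants take one
    smooth function for each row; their rows are curl-free, so Piola's identity makes the i-th row
    of cofactors divergence-free and [gdiv] applies to it. *)
Lemma null_lagrangian (U : 'rV[R]_n -> 'M[R]_n) (u : 'rV[R]_n -> 'rV[R]_n)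
    (g : 'I_n -> 'rV[R]_n -> R) i :
  (forall k, Hspace s p delta w Omega (component u k) (fun x => row k (U x))) ->
  (forall j, continuous (g j)) -> (forall j x, ~ Omega x -> g j x = 0) ->
  (forall psi : 'I_n -> 'rV[R]_n -> R, (forall j, Ck 1 (psi j)) ->
     (forall x, \sum_j partial j (psi j) x = 0) ->
     \sum_j \int[leb]_x (psi j x * g j x) = 0) ->
  (\int[leb]_(x in Omega) (\sum_j cofactor (U x) i j * g j x)%:E = 0)%E.
Proof.
move=> HU cg gO gdiv.
have [r r0 rP] : exists2 r : R, 0 < r & forall x, Omega x -> `|x| <= r.
  have /pinfty_ex_gt0[r /= r0 rP] := bO; exists r => //.
have gr j x : r < `|x| -> g j x = 0.
  by move=> rx; apply: gO => /rP; rewrite leNgt rx.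
have [G GP] : exists G : R, forall j x, `|g j x| <= G.
  apply: finite_uniform_bound => j.
  have [M M0 MP] := continuous_bounded_ball r (cg j).
  by exists M => x; have [rx|xr] := ltP r `|x|; [rewrite gr// normr0|exact: MP].
apply: (@cofactor_limit R n p Omega n_gt0 p1 np mO _ U g G i) => //.
- exact: bounded_finite_measure.
- move=> k l; have [[_ /(_ l)/integrableP[mU _] _] _] := HU k.
  by apply/measurable_EFinP; move: mU; under eq_fun do rewrite mxE.
- by move=> j; apply: measurable_funTS; exact: continuous_measurable_rV.
move=> eta eta0.
(* The total constant lost between the matrix and its n rows; 1 is added so that it can be divided
   by. *)
pose K : R := n%:R `^ p * n%:R `^ p * n%:R + 1.
have K0 : 0 < K by rewrite ltr_wpDl// !mulr_ge0 ?powR_ge0.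
have eK : 0 < eta / K by rewrite divr_gt0.
have /choice[v vP] : forall k, exists v, Cc_infty setT v /\
    (\int[leb]_(x in Omega) (enorm (dlt v x - row k (U x)) `^ p)%:E <= (eta / K)%:E)%E.
  by move=> k; have [v] := Hspace_approximation (HU k) eK; exists v.
have Cv k : Cc_infty setT (v k) by case: (vP k).
have mU k l : measurable_fun Omega (fun x => U x k l).
  have [[_ /(_ l)/integrableP[mU _] _] _] := HU k.
  by apply/measurable_EFinP; move: mU; under eq_fun do rewrite mxE.
have Ev x k l : (\matrix_k dlt (v k) x) k l = dlt (v k) x ord0 l by rewrite mxE.
have CA k l : Ck 1 (fun x => (\matrix_k dlt (v k) x) k l).
  under eq_fun do rewrite Ev; exact: (C1_nlgrad l (Cv k)).1.
have curlA k j l : partial j (fun x => (\matrix_k dlt (v k) x) k l) = partial l (fun x => (\matrix_k dlt (v k) x) k j).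
  under eq_fun do rewrite Ev; under [in RHS]eq_fun do rewrite Ev; exact: (nlgrad_curlfree j l (Cv k)).
exists (fun x => \matrix_k dlt (v k) x); split.
- by move=> k l; apply: measurable_funTS; apply: continuous_measurable_rV; exact: C1_continuous (CA k l).
- have /choice[M MP] : forall k, exists M : R, forall l x, `|dlt (v k) x ord0 l| <= M.
    by move=> k; apply: finite_uniform_bound => l; exact: nlgrad_bounded (Cv k).
  exists (\sum_k `|M k|) => x k l _; rewrite Ev; apply: (le_trans (MP k l x)).
  by apply: (le_trans (ler_norm _)); rewrite (bigD1 k)//= lerDl; apply: sumr_ge0.
(* Since g vanishes off Omega, the integral extends to the whole space, where the hypothesis on
   divergence-free fields is stated. *)
- rewrite Rintegral_mkcond.
  transitivity (\int[leb]_x \sum_j cofactor (\matrix_k dlt (v k) x) i j * g j x).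
    apply: eq_Rintegral => x _; rewrite patchE; case: ifPn => // /negP xO.
    by rewrite big1// => j _; rewrite gO ?mulr0// => Ox; apply: xO; rewrite inE.
  rewrite Rintegral_sum//.
    by apply: gdiv => [j|x]; [exact: C1_cofactor|exact: piola].
  move=> j; apply: (continuous_mul_support_integrable (r := r)) => //; last exact: gr.
  by apply: C1_continuous; exact: (C1_cofactor i j CA).
pose B k x : R := enorm (dlt (v k) x - row k (U x)) `^ p.
have mB k : measurable_fun Omega (B k).
  have -> : B k = fun x => (\sum_l (dlt (v k) x ord0 l - U x k l) ^+ 2) `^ (p / 2).
    apply/funext => x; rewrite /B -(sqr_powR_half _ (enorm_ge0 _)) sqr_enorm.
    by congr (_ `^ _); apply: eq_bigr => l _; rewrite !mxE.
  apply: (@measurableT_comp _ _ _ _ _ _ (fun t : R => t `^ (p / 2))); first exact: measurable_powR.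
  apply: measurable_sum => l; apply: measurable_funX; apply: measurable_funB => //.
  by apply: measurable_funTS; apply: continuous_measurable_rV; exact: C1_continuous (C1_nlgrad l (Cv k)).1.
(* One factor from the power of a sum over n rows, the other from bounding the l^1 norm of a row by
   n times its Euclidean norm. *)
pose c : R := n%:R `^ p * n%:R `^ p.
have c0 : 0 <= c by rewrite mulr_ge0 ?powR_ge0.
have B0 k x : 0 <= B k x by exact: powR_ge0.
have AUB x : entry_norm (\matrix_k dlt (v k) x - U x) `^ p <= c * \sum_k B k x.
  apply: (@le_trans _ _ ((\sum_k n%:R * enorm (dlt (v k) x - row k (U x))) `^ p)).
    apply: ge0_ler_powR; rewrite ?nnegrE ?entry_norm_ge0//; first exact: ltW.
      by apply: sumr_ge0 => k _; rewrite mulr_ge0// enorm_ge0.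
    apply: ler_sum => k _.
    apply: (@le_trans _ _ (\sum_(l < n) enorm (dlt (v k) x - row k (U x)))); last first.
      by rewrite sumr_const card_ord mulr_natl.
    apply: ler_sum => l _; apply: le_trans (coord_le_enorm _ l).
    by rewrite !mxE.
  have e0 k : 0 <= n%:R * enorm (dlt (v k) x - row k (U x)) by rewrite mulr_ge0// enorm_ge0.
  apply: (le_trans (powR_sum_le p0 e0)); rewrite card_ord /c -mulrA; apply: ler_wpM2l; first exact: powR_ge0.
  by rewrite mulr_sumr; apply: ler_sum => k _; rewrite powRM// enorm_ge0.
apply: (@le_trans _ _ (\int[leb]_(x in Omega) (c%:E * \sum_k (B k x)%:E))%E).
  apply: ge0_le_integral => //.
  - by move=> x _; rewrite lee_fin powR_ge0.
  - apply/measurable_EFinP; apply: measurable_entry_norm_powR => // k l.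
    rewrite (_ : (fun x => _) = fun x => (\matrix_k dlt (v k) x) k l - U x k l).
      by apply: measurable_funB => //; apply: measurable_funTS; apply: continuous_measurable_rV; exact: C1_continuous (CA k l).
    by apply/funext => x; rewrite [LHS]mxE [X in _ + X]mxE.
  - by under eq_fun do rewrite sumEFin -EFinM; apply/measurable_EFinP; apply: measurable_funM => //; exact: measurable_sum.
  - by move=> x _; rewrite sumEFin -EFinM lee_fin.
rewrite ge0_integralZl//; last 2 first.
- by under eq_fun do rewrite sumEFin; apply/measurable_EFinP; exact: measurable_sum.
- by move=> x _; apply: sume_ge0 => k _; rewrite lee_fin.
rewrite ge0_integral_sum//; last 2 first.
- by move=> k; apply/measurable_EFinP.
- by move=> k x _; rewrite lee_fin.
apply: (@le_trans _ _ (c%:E * \sum_(k < n) (eta / K)%:E)%E).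
  by apply: lee_wpmul2l; [rewrite lee_fin|apply: lee_sum => k _; case: (vP k)].
rewrite sumEFin -EFinM lee_fin sumr_const card_ord -mulr_natl mulrA mulrCA ler_piMr//; first exact: ltW.
by rewrite ler_pdivrMr// mul1r /K lerDl.
Qed.

End null_lagrangian.
End nonlocal_piola.

(** * The identities for smooth fields and for Sobolev fields *)

(** The divergences are total functions, so the C^1 clause in (a) certifies that those of cof D^s u
    are genuine. In (b), U ranges over all representatives of D^s u given row by row by [Hspace]. *)
Theorem proposition5p1 (R : realType) (n : nat) (s delta : R)
    (Omega : set 'rV[R]_n) (w : 'rV[R]_n -> R)
    (n_gt0 : (0 < n)%N) (s01 : 0 < s < 1) (delta_gt0 : 0 < delta)
    (Omega0 : Omega !=set0) (Omega_bounded : bounded_set Omega)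
    (Omega_open : open Omega) (shrink0 : shrink Omega delta !=set0)
    (hw : cutoff delta w) :
  (forall u : 'rV[R]_n -> 'rV[R]_n,
    (forall i, Cc_infty setT (component u i)) ->
    (forall i j, Ck 1 (fun x => cof (nlgrad_mx s delta w u x) i j)) /\
    (forall x,
      [/\ nldiv_mx s delta w (fun y => cof (nlgrad_mx s delta w u y)) x = 0,
          divergence_mx (fun y => cof (nlgrad_mx s delta w u y)) x = 0 &
          nldiv_mx s delta w (fun y => cof (grad_mx u y)) x = 0])) /\
  (forall (p : R) (u : 'rV[R]_n -> 'rV[R]_n) (U : 'rV[R]_n -> 'M[R]_n),
    1 <= p -> n%:R - 1 <= p ->
    (forall i, Hspace s p delta w Omega (component u i)
                      (fun x => row i (U x))) ->
    (forall phi : 'rV[R]_n -> R, Cc_infty (shrink Omega delta) phi ->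
      forall i, (\int[lebesgue_rV (n := n)]_(x in Omega)
        ((cof (U x) *m (nlgrad s delta w phi x)^T) i ord0)%:E = 0)%E) /\
    (forall phi : 'rV[R]_n -> R, Cc_infty Omega phi ->
      forall i, (\int[lebesgue_rV (n := n)]_(x in Omega)
        ((cof (U x) *m (grad phi x)^T) i ord0)%:E = 0)%E)).
Proof.
split=> [u Cu|p u U p1 np HU].
  have EF (k l : 'I_n) x : nlgrad_mx s delta w u x k l = nlgrad s delta w (component u k) x ord0 l.
    by rewrite mxE.
  have EG (k l : 'I_n) x : grad_mx u x k l = partial l (component u k) x by rewrite !mxE.
  have EFf k l : (fun x => nlgrad_mx s delta w u x k l) = fun x => nlgrad s delta w (component u k) x ord0 l.
    by apply/funext => x; exact: EF.
  have EGf k l : (fun x => grad_mx u x k l) = partial l (component u k) by apply/funext => x; exact: EG.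
  have [k l|k j l|cofC cof1 cof2] := @cof_curlfree R n s delta w n_gt0 s01 delta_gt0 hw (nlgrad_mx s delta w u).
  - by rewrite EFf; exact: (C1_nlgrad n_gt0 s01 delta_gt0 hw l (Cu k)).1.
  - by rewrite !EFf; exact: nlgrad_curlfree (Cu k).
  have [k l|k j l|_ _ cof3] := @cof_curlfree R n s delta w n_gt0 s01 delta_gt0 hw (grad_mx u).
  - by rewrite EGf; apply: Ck_partial; have [] := Cu k.
  - by rewrite !EGf; apply: C2_partialC; have [] := Cu k.
  by split => // x; split.
have E (V : 'rV[R]_n -> 'rV[R]_n) i x :
    (cof (U x) *m (V x)^T) i ord0 = \sum_j cofactor (U x) i j * V x ord0 j.
  by rewrite mxE; apply: eq_bigr => j _; rewrite !mxE.
split=> phi Cphi i; under eq_integral do rewrite E.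
- have [/(_ 1%N)/C1_continuous cphi _ _] := Cphi.
  apply: (null_lagrangian n_gt0 s01 delta_gt0 hw p1 np Omega_open Omega_bounded i HU
    (g := fun j x => nlgrad s delta w phi x ord0 j)) => [j|j x nOx|psi Cpsi dpsi].
  + exact: C1_continuous (C1_nlgrad n_gt0 s01 delta_gt0 hw j Cphi).1.
  + by rewrite nlgradE// (nldiff_shrink_out n_gt0 s01 hw j Omega_open Cphi nOx) mulr0.
  + have [r r0 rP] : exists2 r : R, 0 < r & forall x, Omega x -> `|x| <= r.
      by have /pinfty_ex_gt0[r /= r0 rP] := Omega_bounded; exists r.
    (* The constant c_{n,s} is pulled out, since the duality is stated for [nldiff]. *)
    transitivity (@c_ns R n s * \sum_j \int[lebesgue_rV (n := n)]_x (psi j x * nldiff s w j phi x)).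
      rewrite mulr_sumr; apply: eq_bigr => j _.
      rewrite -RintegralZl//.
        by apply: eq_Rintegral => x _; rewrite nlgradE// mulrCA.
      apply: (continuous_mul_support_integrable (r := r)) => [||x rx].
      - exact: C1_continuous.
      - exact: C1_continuous (nldiff_C1 n_gt0 s01 delta_gt0 hw j Cphi).1.
      - rewrite (nldiff_shrink_out n_gt0 s01 hw j Omega_open Cphi)// => /rP.
        by rewrite leNgt rx.
    by rewrite (integral_divfree_nldiff n_gt0 s01 delta_gt0 hw Cpsi dpsi Cphi) mulr0.
- have EG (j : 'I_n) x : grad phi x ord0 j = partial j phi x by rewrite mxE.
  have [C1phi _ sphi] := Cphi.
  apply: (null_lagrangian n_gt0 s01 delta_gt0 hw p1 np Omega_open Omega_bounded i HU
    (g := fun j x => grad phi x ord0 j)) => [j|j x nOx|psi Cpsi dpsi].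
  + by under eq_fun do rewrite EG; exact: C1_continuous_partial (C1phi 1%N).
  + rewrite EG; apply: supp0 => /supp_partial/sphi.
    exact: nOx.
  + have [r r0 rP] := Cc_supp_bounded Cphi.
    under eq_bigr => j _ do (under eq_Rintegral do rewrite EG).
    (* For the classical gradient the annihilation of divergence-free fields is plain integration by
       parts, with the bounded support on the side of phi. *)
    under eq_bigr => j _ do rewrite (integration_by_parts_rV j (Cpsi j) (C1phi 1%N) rP).
    rewrite sumrN -Rintegral_sum//.
      under eq_Rintegral do rewrite -mulr_sumr dpsi mulr0.
      by rewrite Rintegral_cst0 oppr0.
    move=> j; under eq_fun do rewrite mulrC.
    apply: (continuous_mul_support_integrable (r := r)) => //.
      exact: C1_continuous_partial.
    exact: C1_continuous (C1phi 1%N).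
Qed.
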